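(* Let $U \subset \mathbb{R}^2$ be open, $f : U \to \mathbb{R}^2$ continuous, and $p \in U$ a fixed point of $f$ such that $\{p\}$ is an isolated invariant set and $p$ is neither a sink nor a source. Then there exist a finite non-empty set $F \subset \mathbb{N}$ and positive integers $a_k$ ($k \in F$) such that $$\{i(f^n, p)\}_{n \ge 1} = \sigma^1 - \sum_{k \in F} a_k \sigma^k,$$ that is, $i(f^n,p) = 1 - \sum_{k \in F,\ k \mid n} k\, a_k$ for every $n \ge 1$. Equivalently, there is a map $\varphi : J \to J$ of a finite non-empty set $J$ with $i(f^n,p) = 1 - \#\mathrm{Fix}(\varphi^n)$ for all $n\ge 1$.
   Context: $i(g,p)$ denotes the fixed point index of $g$ at an isolated fixed point $p$. For $k \ge 1$, $\sigma^k = \{\sigma^k_n\}_{n\ge1}$ is the integer sequence with $\sigma^k_n = k$ if $k \mid n$ and $\sigma^k_n = 0$ otherwise. A solution through $x$ is a sequence $(x_n)_{n\in\mathbb{Z}}$ with $x_0 = x$ and $f(x_n) = x_{n+1}$ for all $n$. For $N \subset U$, $\mathrm{Inv}(f,N)$ is the set of $x \in N$ admitting a solution through $x$ entirely contained in $N$. A compact set $N \subset U$ is an isolating neighborhood if $\mathrm{Inv}(f,N) \subset \mathrm{int}(N)$; a compact invariant set $X$ ($f(X)=X$) is isolated (an isolated invariant set) if $X = \mathrm{Inv}(f,N)$ for some isolating neighborhood $N$. A fixed point $p$ is a sink if $\{p\}$ is isolated and has an isolating neighborhood $N$ with $\mathrm{Inv}(f,N)=\{p\}$ and $f(N) \subset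 N$. A fixed point $p$ is a source if $\{p\}$ is isolated and has an isolating neighborhood $N$ with $\mathrm{Inv}(f,N)=\{p\}$ such that (i) $f(\partial N) \cap \mathrm{int}(N) = \emptyset$ and (ii) the forward orbit of every $x \in N \setminus \{p\}$ eventually leaves $N$. *)

(* Defs.v *)
From Stdlib Require Import Reals Lra Lia ZArith List.
Open Scope R_scope.

Definition pt : Type := (R * R)%type.

Definition dist2 (x y : pt) : R :=
  sqrt ((fst x - fst y)^2 + (snd x - snd y)^2).

Definition psub (x y : pt) : pt := (fst x - fst y, snd x - snd y).

Definition fiter (f : pt -> pt) (n : nat) (x : pt) : pt := Nat.iter n f x.

Definition open2 (U : pt -> Prop) : Prop :=
  forall x, U x -> exists e, 0 < e /\ forall y, dist2 x y < e -> U y.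

Definition cont_on2 (D : pt -> Prop) (g : pt -> pt) : Prop :=
  forall x, D x -> forall e, 0 < e -> exists d, 0 < d /\
    forall y, D y -> dist2 x y < d -> dist2 (g x) (g y) < e.

Definition closed2 (N : pt -> Prop) : Prop := open2 (fun x => ~ N x).

Definition bounded2 (N : pt -> Prop) : Prop :=
  exists M, forall x, N x -> dist2 x (0, 0) <= M.

(* Heine-Borel in R^2 *)
Definition compact2 (N : pt -> Prop) : Prop := closed2 N /\ bounded2 N.

Definition int2 (N : pt -> Prop) (x : pt) : Prop :=
  exists e, 0 < e /\ forall y, dist2 x y < e -> N y.

(* bd2 of a (closed) set N *)
Definition bd2 (N : pt -> Prop) (x : pt) : Prop := N x /\ ~ int2 N x.

Definition subset2 (A B : pt -> Prop) : Prop := forall x, A x -> B x.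

Definition solution_in (f : pt -> pt) (N : pt -> Prop) (x : pt) : Prop :=
  exists s : Z -> pt, s 0%Z = x /\
    (forall n : Z, f (s n) = s (n + 1)%Z) /\ (forall n : Z, N (s n)).

Definition Inv (f : pt -> pt) (N : pt -> Prop) (x : pt) : Prop :=
  N x /\ solution_in f N x.

Definition isolating_nbhd (U : pt -> Prop) (f : pt -> pt) (N : pt -> Prop) : Prop :=
  subset2 N U /\ compact2 N /\ subset2 (Inv f N) (int2 N).

Definition Inv_is_point (f : pt -> pt) (N : pt -> Prop) (p : pt) : Prop :=
  forall x, Inv f N x <-> x = p.

(* {p} is an isolated invariant set (for a fixed point p, {p} is compact invariant) *)
Definition isolated_fixed_set (U : pt -> Prop) (f : pt -> pt) (p : pt) : Prop :=
  f p = p /\ exists N, isolating_nbhd U f N /\ Inv_is_point f N p.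

Definition is_sink (U : pt -> Prop) (f : pt -> pt) (p : pt) : Prop :=
  isolated_fixed_set U f p /\
  exists N, isolating_nbhd U f N /\ Inv_is_point f N p /\
    (forall x, N x -> N (f x)).

Definition is_source (U : pt -> Prop) (f : pt -> pt) (p : pt) : Prop :=
  isolated_fixed_set U f p /\
  exists N, isolating_nbhd U f N /\ Inv_is_point f N p /\
    (forall x, bd2 N x -> ~ int2 N (f x)) /\
    (forall x, N x -> x <> p -> exists n : nat, ~ N (fiter f n x)).

Definition cont_on_unit (g : R -> pt) : Prop :=
  forall t, 0 <= t <= 1 -> forall e, 0 < e -> exists d, 0 < d /\
    forall s, 0 <= s <= 1 -> Rabs (s - t) < d -> dist2 (g t) (g s) < e.

Definition winding_number (gamma : R -> pt) (k : Z) : Prop :=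
  cont_on_unit gamma /\ gamma 0 = gamma 1 /\
  (forall t, 0 <= t <= 1 -> gamma t <> (0, 0)) /\
  exists theta : R -> R,
    (forall t, 0 <= t <= 1 -> forall e, 0 < e -> exists d, 0 < d /\
       forall s, 0 <= s <= 1 -> Rabs (s - t) < d -> Rabs (theta t - theta s) < e) /\
    (forall t, 0 <= t <= 1 ->
       gamma t = (dist2 (gamma t) (0,0) * cos (theta t),
                  dist2 (gamma t) (0,0) * sin (theta t))) /\
    theta 1 - theta 0 = 2 * PI * IZR k.

Definition circ (p : pt) (r t : R) : pt :=
  (fst p + r * cos (2 * PI * t), snd p + r * sin (2 * PI * t)).

Definition fp_index (D : pt -> Prop) (g : pt -> pt) (p : pt) (k : Z) : Prop :=
  g p = p /\
  exists r, 0 < r /\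
    (forall x, dist2 x p <= r -> D x) /\
    cont_on2 (fun x => dist2 x p <= r) g /\
    (forall x, dist2 x p <= r -> g x = x -> x = p) /\
    winding_number (fun t => psub (circ p r t) (g (circ p r t))) k.

Definition fiter_dom (U : pt -> Prop) (f : pt -> pt) (n : nat) (x : pt) : Prop :=
  forall j, (j < n)%nat -> U (fiter f j x).

Definition sigk (k n : nat) : Z :=
  if Nat.eqb (n mod k) 0 then Z.of_nat k else 0%Z.

Definition sum_Z (l : list Z) : Z := fold_right Z.add 0%Z l.

(* Main.v *)
Require Import Defs.
From Stdlib Require Import Reals Lra Lia ZArith List.
From Stdlib Require Import Classical ClassicalEpsilon FunctionalExtensionality.
Open Scope R_scope.

(** Write b(n) = 1 - i(f^n, p).  Fix k large, let g = f^k, and let B be a small square around p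
    carrying a fine grid.  On grid chains g induces a chain map F, and i(g^n, p) is the local
    Lefschetz number of F^n at p: both count the crossings of a half axis by x - g^n x along a small
    square.  Let M be the component at p of the union of the grid squares near the set of those x in
    B whose orbit segment of length k stays in the isolating square and ends in B, and let L be the
    rest of the grid.  A frontier point of M leaves B under g, and its image in the truncated grid
    map is far from M; so F maps the frontier into L, and because the grid is simply connected this
    defines a map psi on the components of L.  Replacing F on L by psi gives a chain map with
    Lefschetz number 1 on the acyclic grid, and closed walks of F that avoid L concentrate at p;
    hence b(kn) = #Fix(psi^n).  When M lies in the interior of B this comparison needs a
    two-dimensional correction term to vanish: it does because, p not being a source, M contains a
    point without long backward orbit.  As p is not a sink, L is not empty, so psi has a cycle.

    The number of periodic points of psi is bounded independently of the mesh, so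
    b(kn) = sum_(d | n, d <= C) d a_d for all n.  Comparing different k, b(m) lies in a fixed interval
    [0, P] for all large m.  Finally i(g^q) = i(g) modulo q for q prime, since tr(A^q) = tr(A) modulo q
    for integer matrices; hence b(n) = b(qn) for one large prime q and all n, and the formula for
    k = q is the theorem. *)

(** * Angles *)

(** Two squares are used, of radius [s] inside radius [R0]. By compactness and isolation, for all
    large k every orbit segment of length 2k in the large square has its midpoint strictly inside
    the small one. So if x is in the block and g x lies on or beyond the boundary of B, then g x is
    not in the block, since otherwise g x would be such a midpoint. The frontier is therefore thrown
    off the block by a positive distance eta, which f itself need not achieve. The grid map is
    clamped to B to be a self map of a contractible complex; the closed walks that count do not see
    the clamping. Homology is replaced by integer matrices: an explicit contraction gives the
    Lefschetz number 1, and a nonzero entry of a power gives a walk, which tends to an orbit as the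
    mesh tends to 0. Two images of frontier vertices in one box of size eta/4 lie in the same
    component of L, and the number of boxes depends only on eta and s. This uniformity is essential,
    because the mesh must be refined as n grows. *)

Definition nrm (w : pt) : R := sqrt (fst w ^ 2 + snd w ^ 2).

Lemma dist2_origin w : dist2 w (0, 0) = nrm w.
Proof. unfold dist2, nrm; simpl. f_equal; ring. Qed.

Definition isang (th : R) (w : pt) : Prop :=
  fst w = nrm w * cos th /\ snd w = nrm w * sin th.

(* The four open half planes x > 0, y > 0, x < 0, y < 0, numbered by quarter turns. *)
Definition hp (k : nat) (w : pt) : R :=
  match k with 0%nat => fst w | 1%nat => snd w | 2%nat => - fst w | _ => - snd w end.
Definition ro (k : nat) (w : pt) : R :=
  match k with 0%nat => snd w | 1%nat => - fst w | 2%nat => - snd w | _ => fst w end.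
Definition quarter (k : nat) : R :=
  match k with 0%nat => 0 | 1%nat => PI / 2 | 2%nat => PI | _ => 3 * (PI / 2) end.
(** A continuous branch of the argument on the half plane [hp k > 0]: [ro k / hp k] is the tangent
    of the angle measured from the axis at [quarter k]. *)
Definition ang (k : nat) (w : pt) : R := quarter k + atan (ro k w / hp k w).

Lemma nrm_pos w : w <> (0, 0) -> 0 < nrm w.
Proof.
  intros H. unfold nrm. apply sqrt_lt_R0.
  destruct w as [x y]; simpl. 
  destruct (Req_dec x 0) as [->|hx]; [|nra].
  destruct (Req_dec y 0) as [->|hy]; [now elim H|nra].
Qed.

Lemma hp_neq0 k w : 0 < hp k w -> w <> (0, 0).
Proof. intros H E; subst; destruct k as [|[|[|k]]]; simpl in H; lra. Qed.

Lemma nrm_sqr w : nrm w * nrm w = fst w ^ 2 + snd w ^ 2.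
Proof. unfold nrm. apply sqrt_sqrt. nra. Qed.

Lemma nrm_hp k w : 0 < hp k w ->
  nrm w = hp k w * sqrt (1 + (ro k w / hp k w) ^ 2).
Proof.
  intros H. rewrite <- (sqrt_square (hp k w)) at 1 by lra.
  rewrite <- sqrt_mult; [|nra|nra]. unfold nrm. f_equal.
  destruct k as [|[|[|k]]]; simpl in *; field; lra.
Qed.

Lemma ang_isang k w : 0 < hp k w -> isang (ang k w) w.
Proof.
  intros H. unfold isang. rewrite (nrm_hp k w H). 
  set (z := ro k w / hp k w).
  assert (Hs : 0 < sqrt (1 + z ^ 2)) by (apply sqrt_lt_R0; nra).
  assert (Hc : cos (atan z) = / sqrt (1 + z ^ 2)).
  { rewrite cos_atan. unfold Rsqr. replace (z ^ 2) with (z * z) by ring. field.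
    replace (z * z) with (z ^ 2) by ring. lra. }
  assert (Hsn : sin (atan z) = z / sqrt (1 + z ^ 2)).
  { rewrite sin_atan. unfold Rsqr. replace (z ^ 2) with (z * z) by ring. reflexivity. }
  assert (Hz : z * hp k w = ro k w) by (unfold z; field; lra).
  unfold ang; fold z. 
  assert (A : hp k w * sqrt (1 + z ^ 2) * cos (atan z) = hp k w) by (rewrite Hc; field; lra).
  assert (B : hp k w * sqrt (1 + z ^ 2) * sin (atan z) = ro k w) by (rewrite Hsn, <- Hz; field; lra).
  destruct k as [|[|[|k]]]; simpl quarter in *; simpl hp in *; simpl ro in *.
  - rewrite Rplus_0_l. lra.
  - rewrite cos_plus, sin_plus, cos_PI2, sin_PI2. split; lra.
  - rewrite cos_plus, sin_plus, cos_PI, sin_PI. split; lra.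
  - rewrite cos_plus, sin_plus, cos_3PI2, sin_3PI2. split; lra.
Qed.

Lemma cos_sin_1 t : cos t * cos t + sin t * sin t = 1.
Proof. generalize (sin2_cos2 t); unfold Rsqr; lra. Qed.

Lemma isang_cs th al w : w <> (0, 0) -> isang th w -> isang al w ->
  cos th = cos al /\ sin th = sin al.
Proof.
  intros H [A B] [C D]. apply nrm_pos in H. split; nra.
Qed.

(** Two arguments of one nonzero vector have the same sine and cosine, so [th - al] is invisible to
    both. *)
Lemma isang_shift th al be w g : w <> (0, 0) ->
  isang th w -> isang al w -> isang be g -> isang (th + be - al) g.
Proof.
  intros H A B C. destruct (isang_cs _ _ _ H A B) as [E F].
  destruct C as [C D]. pose proof (cos_sin_1 al).
  assert (cos (th - al) = 1) by (rewrite cos_minus, E, F; lra).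
  assert (sin (th - al) = 0) by (rewrite sin_minus, E, F; lra).
  replace (th + be - al) with (be + (th - al)) by ring.
  split; rewrite ?cos_plus, ?sin_plus; rewrite H1, H2; lra.
Qed.

Lemma atan_quarter a b : 0 < a -> 0 < b -> atan (b / a) = PI / 2 + atan (- a / b).
Proof.
  intros Ha Hb. replace (- a / b) with (- (/ (b / a))) by (field; lra).
  rewrite atan_opp, atan_inv; [ring|]. apply Rdiv_lt_0_compat; lra.
Qed.

Lemma ang_adj k w : (k < 3)%nat -> 0 < hp k w -> 0 < hp (S k) w -> ang k w = ang (S k) w.
Proof.
  intros Hk A B. unfold ang.
  assert (E1 : ro k w = hp (S k) w) by (destruct k as [|[|[|k]]]; simpl; lia || lra).
  assert (E2 : ro (S k) w = - hp k w) by (destruct k as [|[|[|k]]]; simpl; lia || lra).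
  rewrite E1, E2, atan_quarter by assumption.
  destruct k as [|[|[|k]]]; simpl quarter; lia || lra.
Qed.

Lemma ang_adj30 w : 0 < hp 3 w -> 0 < hp 0 w -> ang 3 w = ang 0 w + 2 * PI.
Proof.
  intros A B. unfold ang. simpl hp in *; simpl ro in *; simpl quarter.
  rewrite (atan_quarter (- snd w) (fst w)) by assumption.
  replace (- - snd w / fst w) with (snd w / fst w) by (field; lra). lra.
Qed.

(** On the overlap of two neighbouring half planes the branches differ by the constant 0 or 2 PI,
    and opposite half planes are disjoint. Increments therefore do not depend on the branch. *)
Lemma ang_diff k k' w g : (k < 4)%nat -> (k' < 4)%nat ->
  0 < hp k w -> 0 < hp k g -> 0 < hp k' w -> 0 < hp k' g ->
  ang k g - ang k w = ang k' g - ang k' w.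
Proof.
  assert (A : forall k k', (k < k')%nat -> (k' < 4)%nat ->
    0 < hp k w -> 0 < hp k g -> 0 < hp k' w -> 0 < hp k' g ->
    ang k g - ang k w = ang k' g - ang k' w).
  { clear k k'. intros k k' H1 H2 Hw Hg Hw' Hg'.
    destruct (Nat.eq_dec k' (S k)) as [->|N].
    { rewrite !(ang_adj k) by (assumption || lia). ring. }
    destruct (Nat.eq_dec k 0) as [->|].
    { destruct (Nat.eq_dec k' 3) as [->|]. { rewrite !ang_adj30 by assumption. ring. }
      replace k' with 2%nat in * by lia. simpl in *; lra. }
    replace k with 1%nat in * by lia. replace k' with 3%nat in * by lia. simpl in *; lra. }
  intros Hk Hk' a b c d. destruct (Nat.lt_total k k') as [H|[->|H]]; auto.
  symmetry; apply A; auto.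
Qed.

Definition upz (w : pt) : Z := if Rlt_dec 0 (snd w) then 1%Z else 0%Z.

(* The argument in (0, 2 PI), cut along the positive first axis; only meant for [snd w <> 0]. *)
Definition Arg (w : pt) : R := if Rlt_dec 0 (snd w) then ang 1 w else ang 3 w.

(** Only half plane 0 contains the cut, so only a step inside it can cross; passing from below to
    above, the counterclockwise sense, counts +1. *)
Definition crossing (k : nat) (w w' : pt) : Z :=
  match k with O => (upz w' - upz w)%Z | _ => 0%Z end.

Lemma Arg_isang w : snd w <> 0 -> isang (Arg w) w.
Proof.
  intros H; unfold Arg; destruct (Rlt_dec 0 (snd w)); apply ang_isang; simpl; lra.
Qed.

Lemma ang_step k w w' : (k < 4)%nat -> 0 < hp k w -> 0 < hp k w' -> snd w <> 0 -> snd w' <> 0 ->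
  ang k w' - ang k w = Arg w' - Arg w + 2 * PI * IZR (crossing k w w').
Proof.
  intros Hk A B Hw Hw'.
  (* In half plane 0 the branch [ang 0] runs through the cut while [Arg] jumps, exceeding it by 2 PI
     below the axis. *)
  assert (C : forall u, 0 < hp k u -> snd u <> 0 ->
     ang k u = Arg u + 2 * PI * match k with O => IZR (upz u) - 1 | _ => 0 end).
  { clear - Hk. intros u A Hu. unfold Arg, upz. destruct (Rlt_dec 0 (snd u)) as [L|L].
    - destruct k as [|[|[|[|k]]]]; try lia.
      + rewrite (ang_adj 0) by (simpl in *; lia || lra). lra.
      + lra.
      + rewrite (ang_adj 1) by (simpl in *; lia || lra). lra.
      + simpl in A; lra.
    - destruct k as [|[|[|[|k]]]]; try lia.
      + rewrite ang_adj30 by (simpl in *; lra). lra.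
      + simpl in A; lra.
      + rewrite (ang_adj 2) by (simpl in *; lia || lra). lra.
      + lra. }
  rewrite !C by assumption. unfold crossing. destruct k; [|lra].
  rewrite minus_IZR. lra.
Qed.

Definition cpath (g : R -> pt) : Prop :=
  continuity (fun t => fst (g t)) /\ continuity (fun t => snd (g t)).

Definition clamp (a b t : R) : R := Rmax a (Rmin b t).

Lemma Rmax_cont a : continuity (fun t => Rmax a t).
Proof.
  intros t e He. exists e; split; auto. intros x [_ Hx]. simpl in *. unfold Rdist, R_dist in *.
  unfold Rmax; destruct (Rle_dec a x), (Rle_dec a t); unfold Rabs in *; repeat destruct Rcase_abs; lra.
Qed.
Lemma Rmin_cont a : continuity (fun t => Rmin a t).
Proof.
  intros t e He. exists e; split; auto. intros x [_ Hx]. simpl in *. unfold Rdist, R_dist in *.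
  unfold Rmin; destruct (Rle_dec a x), (Rle_dec a t); unfold Rabs in *; repeat destruct Rcase_abs; lra.
Qed.
Lemma clamp_cont a b : continuity (clamp a b).
Proof. apply (continuity_comp (Rmin b) (Rmax a)). apply Rmin_cont. apply Rmax_cont. Qed.
Lemma clamp_in a b t : a <= b -> a <= clamp a b t <= b.
Proof. intros; unfold clamp, Rmax, Rmin; repeat destruct Rle_dec; lra. Qed.
Lemma clamp_id a b t : a <= t <= b -> clamp a b t = t.
Proof. intros; unfold clamp, Rmax, Rmin; repeat destruct Rle_dec; lra. Qed.

Lemma ang_cont k g a b : a <= b -> cpath g -> (forall t, a <= t <= b -> 0 < hp k (g t)) ->
  continuity (fun t => ang k (g (clamp a b t))).
Proof.
  intros Hab [A B] H.
  assert (Ch : continuity (fun t => hp k (g (clamp a b t)))).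
  { destruct k as [|[|[|k]]]; simpl.
    - apply (continuity_comp (clamp a b) (fun t => fst (g t))); auto using clamp_cont.
    - apply (continuity_comp (clamp a b) (fun t => snd (g t))); auto using clamp_cont.
    - apply (continuity_opp (fun t => fst (g (clamp a b t)))).
      apply (continuity_comp (clamp a b) (fun t => fst (g t))); auto using clamp_cont.
    - apply (continuity_opp (fun t => snd (g (clamp a b t)))).
      apply (continuity_comp (clamp a b) (fun t => snd (g t))); auto using clamp_cont. }
  assert (Cr : continuity (fun t => ro k (g (clamp a b t)))).
  { destruct k as [|[|[|k]]]; simpl.
    - apply (continuity_comp (clamp a b) (fun t => snd (g t))); auto using clamp_cont.
    - apply (continuity_opp (fun t => fst (g (clamp a b t)))).
      apply (continuity_comp (clamp a b) (fun t => fst (g t))); auto using clamp_cont.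
    - apply (continuity_opp (fun t => snd (g (clamp a b t)))).
      apply (continuity_comp (clamp a b) (fun t => snd (g t))); auto using clamp_cont.
    - apply (continuity_comp (clamp a b) (fun t => fst (g t))); auto using clamp_cont. }
  unfold ang. apply (continuity_plus (fun _ => quarter k)).
  { apply continuity_const. intros x y; reflexivity. }
  apply (continuity_comp (fun t => ro k (g (clamp a b t)) / hp k (g (clamp a b t))) atan).
  - apply (continuity_div (fun t => ro k (g (clamp a b t))) (fun t => hp k (g (clamp a b t)))); auto.
    intros t. specialize (H _ (clamp_in a b t Hab)). lra.
  - intros x. apply derivable_continuous_pt. apply derivable_pt_atan.
Qed.

(** * Winding numbers from crossings *)

(* [w] and [w'] are approximations of [g a] and [g b], and [c] counts the signed crossings
   of the positive first axis on the way. *)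
Definition turn (g : R -> pt) (a : R) (w : pt) (b : R) (w' : pt) (c : Z) : Prop :=
  a <= b /\ exists th : R -> R, continuity th /\
    (forall t, a <= t <= b -> isang (th t) (g t)) /\
    (exists k, (k < 4)%nat /\ 0 < hp k w /\ 0 < hp k (g a) /\ th a = Arg w + ang k (g a) - ang k w) /\
    (exists k, (k < 4)%nat /\ 0 < hp k w' /\ 0 < hp k (g b) /\
       th b = Arg w' + ang k (g b) - ang k w' + 2 * PI * IZR c).

Lemma turn_step g a w b w' k : cpath g -> a <= b -> (k < 4)%nat ->
  snd w <> 0 -> snd w' <> 0 -> 0 < hp k w -> 0 < hp k w' ->
  (forall t, a <= t <= b -> 0 < hp k (g t)) -> turn g a w b w' (crossing k w w').
Proof.
  intros Hg Hab Hk W W' A B H. split; auto.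
  exists (fun t => Arg w + ang k (g (clamp a b t)) - ang k w). split; [|split; [|split]].
  - apply (continuity_minus (fun t => Arg w + ang k (g (clamp a b t))) (fun _ => ang k w)).
    + apply (continuity_plus (fun _ => Arg w)); [|apply ang_cont; auto].
      apply continuity_const; intros x y; reflexivity.
    + apply continuity_const; intros x y; reflexivity.
  - intros t Ht. rewrite clamp_id by auto.
    apply isang_shift with w; eauto using hp_neq0, Arg_isang, ang_isang.
  - exists k. rewrite clamp_id by lra. repeat split; auto. apply H; lra.
  - exists k. rewrite clamp_id by lra. repeat split; auto. apply H; lra.
    pose proof (ang_step k w w' Hk A B W W'). lra.
Qed.

Lemma turn_trans g a w b w' d w'' c c' :
  turn g a w b w' c -> turn g b w' d w'' c' -> turn g a w d w'' (c + c').
Proof.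
  intros [Hab (t1 & C1 & L1 & S1 & k & Hk & E1 & E2 & E3)]
         [Hbd (t2 & C2 & L2 & (k' & Hk' & F1 & F2 & F3) & S2)].
  (* Both lifts are normalized at b by the same approximation [w'], though perhaps in different half
     planes, so they differ there by full turns only. *)
  assert (E : t1 b = t2 b + 2 * PI * IZR c).
  { rewrite E3, F3. pose proof (ang_diff k k' w' (g b) Hk Hk' E1 E2 F1 F2). lra. }
  (* Freezing each lift at b with [Rmin] and [Rmax] glues them into one function continuous on all
     of R. *)
  split; [lra|]. exists (fun t => t1 (Rmin b t) + t2 (Rmax b t) - t2 b).
  split; [|split; [|split]].
  - apply (continuity_minus (fun t => t1 (Rmin b t) + t2 (Rmax b t)) (fun _ => t2 b)).
    + apply (continuity_plus (fun t => t1 (Rmin b t)) (fun t => t2 (Rmax b t))).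
      * apply (continuity_comp (Rmin b) t1); auto using Rmin_cont.
      * apply (continuity_comp (Rmax b) t2); auto using Rmax_cont.
    + apply continuity_const; intros x y; reflexivity.
  - intros t Ht. destruct (Rle_dec t b) as [Hl|Hl].
    + rewrite Rmin_right, Rmax_left by lra.
      replace (t1 t + t2 b - t2 b) with (t1 t) by ring. apply L1; lra.
    + rewrite Rmin_left, Rmax_right by lra.
      replace (t1 b + t2 t - t2 b) with (t1 b + t2 t - t2 b) by ring.
      apply isang_shift with (g b). eapply hp_neq0; eauto. apply L1; lra. apply L2; lra. apply L2; lra.
  - destruct S1 as (j & ? & ? & ? & S1). exists j. repeat split; auto.
    rewrite Rmin_right, Rmax_left by lra. lra.
  - destruct S2 as (j & ? & ? & ? & S2). exists j. repeat split; auto.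
    rewrite Rmin_left, Rmax_right by lra. rewrite plus_IZR. lra.
Qed.

Lemma nrm_bound w e : Rabs (fst w) < e -> Rabs (snd w) < e -> nrm w < 2 * e.
Proof.
  intros A B. assert (0 < e) by (pose proof (Rabs_pos (fst w)); lra).
  unfold nrm. rewrite <- (sqrt_square (2 * e)) by lra. apply sqrt_lt_1_alt.
  unfold Rabs in *; repeat destruct Rcase_abs; nra.
Qed.

Lemma dist2_psub x y : dist2 x y = nrm (psub x y).
Proof. reflexivity. Qed.

Lemma cpath_cont_on_unit g : cpath g -> cont_on_unit g.
Proof.
  intros [A B] t Ht e He.
  destruct (A t (e / 2) ltac:(lra)) as [d1 [Hd1 H1]].
  destruct (B t (e / 2) ltac:(lra)) as [d2 [Hd2 H2]].
  exists (Rmin d1 d2); split. { apply Rmin_glb_lt; lra. }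
  intros s Hs Hst. rewrite dist2_psub. replace e with (2 * (e / 2)) by field.
  destruct (Req_dec t s) as [->|N].
  { apply nrm_bound; simpl; rewrite Rminus_diag, Rabs_R0; lra. }
  pose proof (Rmin_l d1 d2); pose proof (Rmin_r d1 d2).
  apply nrm_bound; simpl; rewrite Rabs_minus_sym.
  - apply (H1 s). split; [split; [exact I|auto]|]. simpl. unfold Rdist, R_dist. lra.
  - apply (H2 s). split; [split; [exact I|auto]|]. simpl. unfold Rdist, R_dist. lra.
Qed.

Lemma winding_intro g th k : cpath g -> g 0 = g 1 -> (forall t, 0 <= t <= 1 -> g t <> (0, 0)) ->
  continuity th -> (forall t, 0 <= t <= 1 -> isang (th t) (g t)) ->
  th 1 - th 0 = 2 * PI * IZR k -> winding_number g k.
Proof.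
  intros Hg Hc Hn Ht Hl He. split; [apply cpath_cont_on_unit; auto|]. split; auto. split; auto.
  exists th. split; [|split; auto].
  - intros t _ e Hee. destruct (Ht t e Hee) as [d [Hd H]]. exists d; split; auto.
    intros s _ Hs. destruct (Req_dec t s) as [->|N].
    { rewrite Rminus_diag, Rabs_R0; lra. }
    rewrite Rabs_minus_sym. apply (H s). split; [split; [exact I|auto]|]. exact Hs.
  - intros t Hs. rewrite dist2_origin. destruct (Hl t Hs) as [A B].
    rewrite <- A, <- B. apply surjective_pairing.
Qed.

(** On a closed path both ends are compared with the same [w], so the total gain of the lift is
    exactly the crossing count. *)
Lemma turn_closed g w c : cpath g -> g 0 = g 1 -> (forall t, 0 <= t <= 1 -> g t <> (0, 0)) ->
  turn g 0 w 1 w c -> winding_number g c.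
Proof.
  intros Hg Hc Hn [_ (th & C & L & (k & Hk & A1 & A2 & A3) & (k' & Hk' & B1 & B2 & B3))].
  apply winding_intro with th; auto. rewrite B3, A3. rewrite Hc in *.
  pose proof (ang_diff k k' w (g 1) Hk Hk' A1 A2 B1 B2). lra.
Qed.

Lemma winding_elim g k : winding_number g k -> exists th, continuity th /\
  (forall t, 0 <= t <= 1 -> isang (th t) (g t)) /\ th 1 - th 0 = 2 * PI * IZR k.
Proof.
  intros (_ & _ & _ & th & C & L & E).
  exists (fun t => th (clamp 0 1 t)). split; [|split].
  - intros t e He. pose proof (clamp_in 0 1 t ltac:(lra)) as Ht.
    destruct (C _ Ht e He) as [d [Hd H]].
    destruct (clamp_cont 0 1 t d Hd) as [d' [Hd' H']].
    exists d'; split; auto. intros x Hx. specialize (H' x Hx). simpl in *.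
    unfold Rdist, R_dist in *. rewrite Rabs_minus_sym. apply H; auto. apply clamp_in; lra.
  - intros t Ht. rewrite clamp_id by auto. specialize (L t Ht). rewrite dist2_origin in L.
    split; rewrite L at 1; reflexivity.
  - rewrite !clamp_id by lra. exact E.
Qed.

Lemma winding_unique_lt g k k' : winding_number g k -> winding_number g k' -> ~ (k < k')%Z.
Proof.
  intros H H' L. assert (Hn : forall t, 0 <= t <= 1 -> g t <> (0, 0)) by apply H.
  destruct (winding_elim _ _ H) as (a & Ca & La & Ea).
  destruct (winding_elim _ _ H') as (b & Cb & Lb & Eb).
  (* A zero of [D] is a time at which the difference of the two lifts has moved by half a turn,
     which is impossible: at every time the difference is a multiple of a full turn. *)
  set (D := fun t => b t - a t - (b 0 - a 0) - PI).
  assert (CD : continuity D).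
  { unfold D. apply (continuity_minus (fun t => b t - a t - (b 0 - a 0)) (fun _ => PI)).
    apply (continuity_minus (fun t => b t - a t) (fun _ => b 0 - a 0)).
    apply (continuity_minus b a); auto.
    apply continuity_const; intros x y; reflexivity.
    apply continuity_const; intros x y; reflexivity. }
  assert (Hk : 1 <= IZR k' - IZR k). { rewrite <- minus_IZR. apply IZR_le. lia. }
  pose proof PI_RGT_0.
  destruct (IVT D 0 1 CD ltac:(lra)) as [z [Hz Dz]]; unfold D; [lra|nra|].
  assert (P : forall t, 0 <= t <= 1 -> cos (b t - a t) = 1 /\ sin (b t - a t) = 0).
  { intros t Ht. destruct (isang_cs _ _ _ (Hn t Ht) (La t Ht) (Lb t Ht)) as [E F].
    rewrite cos_minus, sin_minus, E, F. pose proof (cos_sin_1 (b t)). lra. }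
  assert (b z - a z = (b 0 - a 0) + PI) by (unfold D in Dz; lra).
  destruct (P z Hz) as [P1 _]. rewrite H1, cos_plus, cos_PI, sin_PI in P1.
  destruct (P 0 ltac:(lra)) as [P2 P3]. rewrite P2, P3 in P1. lra.
Qed.

Lemma winding_unique g k k' : winding_number g k -> winding_number g k' -> k = k'.
Proof.
  intros H H'. pose proof (winding_unique_lt _ _ _ H H'). pose proof (winding_unique_lt _ _ _ H' H). lia.
Qed.

(** * Stability of the winding number under small deformations *)

Definition dot (u v : pt) : R := fst u * fst v + snd u * snd v.
Definition crs (u v : pt) : R := fst u * snd v - snd u * fst v.

Lemma dot_pos_neq0 u v : 0 < dot u v -> u <> (0, 0) /\ v <> (0, 0).
Proof. unfold dot; split; intros ->; simpl in *; lra. Qed.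

(** In complex notation [(dot u v, crs u v)] is the conjugate of u times v, so its argument is the
    angle from u to v. *)
Lemma isang_rotate u v th : 0 < dot u v -> isang th u -> isang (th + ang 0 (dot u v, crs u v)) v.
Proof.
  intros H [A B]. set (q := (dot u v, crs u v)).
  destruct (ang_isang 0 q H) as [C D]. destruct (dot_pos_neq0 _ _ H) as [Hu Hv].
  apply nrm_pos in Hu, Hv.
  assert (E : nrm q = nrm u * nrm v).
  { assert (nrm q * nrm q = (nrm u * nrm v) * (nrm u * nrm v)).
    { replace (nrm u * nrm v * (nrm u * nrm v)) with ((nrm u * nrm u) * (nrm v * nrm v)) by ring.
      rewrite !nrm_sqr. unfold q, dot, crs; simpl. ring. }
    assert (0 < nrm u * nrm v) by nra.
    assert (0 <= nrm q) by apply sqrt_pos. apply Rsqr_inj; unfold Rsqr; lra. }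
  unfold q in C, D; simpl in C, D. fold q in C, D. rewrite E in C, D.
  pose proof (nrm_sqr u) as Nu.
  assert (X : fst v * (nrm u * nrm u) = dot u v * fst u - crs u v * snd u).
  { rewrite Nu; unfold dot, crs; ring. }
  assert (Y : snd v * (nrm u * nrm u) = dot u v * snd u + crs u v * fst u).
  { rewrite Nu; unfold dot, crs; ring. }
  split; rewrite ?cos_plus, ?sin_plus; (apply (Rmult_eq_reg_r (nrm u * nrm u)); [|nra]).
  - rewrite X, C, D, A, B. ring.
  - rewrite Y, C, D, A, B. ring.
Qed.

(** The angle from [g t] to [g' t] stays within PI/2, so it is given by the single branch [ang 0]
    and returns to its initial value. *)
Lemma winding_close g g' k : cpath g -> cpath g' -> g' 0 = g' 1 ->
  (forall t, 0 <= t <= 1 -> 0 < dot (g t) (g' t)) ->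
  winding_number g k -> winding_number g' k.
Proof.
  intros Hg Hg' Hc Hd W. assert (Hc0 : g 0 = g 1) by apply W.
  destruct (winding_elim _ _ W) as (th & C & L & E).
  set (q := fun t => (dot (g t) (g' t), crs (g t) (g' t))).
  assert (Hq : cpath q).
  { destruct Hg as [a b], Hg' as [a' b']. split; unfold q, dot, crs; simpl.
    - apply (continuity_plus (fun t => fst (g t) * fst (g' t)) (fun t => snd (g t) * snd (g' t))).
      apply (continuity_mult (fun t => fst (g t)) (fun t => fst (g' t))); auto.
      apply (continuity_mult (fun t => snd (g t)) (fun t => snd (g' t))); auto.
    - apply (continuity_minus (fun t => fst (g t) * snd (g' t)) (fun t => snd (g t) * fst (g' t))).
      apply (continuity_mult (fun t => fst (g t)) (fun t => snd (g' t))); auto.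
      apply (continuity_mult (fun t => snd (g t)) (fun t => fst (g' t))); auto. }
  apply winding_intro with (fun t => th t + ang 0 (q (clamp 0 1 t))); auto.
  - intros t Ht. apply (dot_pos_neq0 (g t)). auto.
  - apply (continuity_plus th); auto. apply ang_cont; auto; lra.
  - intros t Ht. rewrite clamp_id by auto. apply isang_rotate; auto.
  - rewrite !clamp_id by lra. unfold q. rewrite Hc, Hc0. lra.
Qed.

(** * Sup metric and sequential compactness *)

Definition nd (x y : pt) : R := Rmax (Rabs (fst x - fst y)) (Rabs (snd x - snd y)).

Lemma nd_le x y e : nd x y <= e <-> Rabs (fst x - fst y) <= e /\ Rabs (snd x - snd y) <= e.
Proof.
  unfold nd, Rmax; destruct Rle_dec; lra.
Qed.
Lemma nd_lt x y e : nd x y < e <-> Rabs (fst x - fst y) < e /\ Rabs (snd x - snd y) < e.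
Proof.
  unfold nd, Rmax; destruct Rle_dec; lra.
Qed.
Lemma nd_sym x y : nd x y = nd y x.
Proof. unfold nd. now rewrite (Rabs_minus_sym (fst x)), (Rabs_minus_sym (snd x)). Qed.
Lemma nd_pos x y : 0 <= nd x y.
Proof. unfold nd. pose proof (Rabs_pos (fst x - fst y)). pose proof (Rmax_l (Rabs (fst x - fst y)) (Rabs (snd x - snd y))). lra. Qed.
Lemma nd_refl x : nd x x = 0.
Proof. unfold nd. rewrite !Rminus_diag, Rabs_R0. apply Rmax_left; lra. Qed.
Lemma nd_tri x y z : nd x z <= nd x y + nd y z.
Proof.
  apply nd_le. pose proof (proj1 (nd_le x y _) (Rle_refl _)). pose proof (proj1 (nd_le y z _) (Rle_refl _)).
  split; unfold Rabs in *; repeat destruct Rcase_abs; lra.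
Qed.
Lemma nd_eq0 x y : nd x y <= 0 -> x = y.
Proof.
  intros H. apply nd_le in H. destruct H as [A B]. destruct x, y; simpl in *.
  f_equal; unfold Rabs in *; repeat destruct Rcase_abs; lra.
Qed.
Lemma nd_neq x y : x <> y -> 0 < nd x y.
Proof. intros H. pose proof (nd_pos x y). destruct (Rle_lt_dec (nd x y) 0); auto. elim H; now apply nd_eq0. Qed.

Lemma nd_le_dist2 x y : nd x y <= dist2 x y.
Proof.
  unfold nd, dist2. apply Rmax_lub; rewrite <- sqrt_Rsqr_abs; apply sqrt_le_1_alt; rewrite Rsqr_pow2;
  pose proof (pow2_ge_0 (fst x - fst y)); pose proof (pow2_ge_0 (snd x - snd y)); lra.
Qed.
Lemma dist2_le_nd x y : dist2 x y <= 2 * nd x y.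
Proof.
  pose proof (proj1 (nd_le x y _) (Rle_refl _)) as [A B]. pose proof (nd_pos x y).
  unfold dist2. rewrite <- (sqrt_square (2 * nd x y)) by lra. apply sqrt_le_1_alt.
  unfold Rabs in *; repeat destruct Rcase_abs; nra.
Qed.

Definition cv (u : nat -> pt) (x : pt) : Prop :=
  forall e, 0 < e -> exists N, forall n, (N <= n)%nat -> nd (u n) x < e.
Definition incr (s : nat -> nat) : Prop := forall n, (s n < s (S n))%nat.
Definition ev (P : nat -> Prop) : Prop := exists N, forall n, (N <= n)%nat -> P n.

Lemma ev_and P Q : ev P -> ev Q -> ev (fun n => P n /\ Q n).
Proof. intros [N H] [M K]. exists (N + M)%nat. intros n Hn. split; [apply H|apply K]; lia. Qed.
Lemma ev_imp (P Q : nat -> Prop) : ev P -> (forall n, P n -> Q n) -> ev Q.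
Proof. intros [N H] I. exists N; auto. Qed.
Lemma ev_ge N : ev (fun n => (N <= n)%nat).
Proof. exists N; auto. Qed.
Lemma ev_fin (P : nat -> nat -> Prop) k : (forall i, (i < k)%nat -> ev (P i)) ->
  ev (fun n => forall i, (i < k)%nat -> P i n).
Proof.
  induction k as [|k IH]; intros H.
  { exists O; intros; lia. }
  destruct (ev_and _ _ (IH ltac:(intros; apply H; lia)) (H k ltac:(lia))) as [N K].
  exists N. intros n Hn i Hi. destruct (K n Hn). destruct (Nat.eq_dec i k) as [->|]; auto.
  apply H0; lia.
Qed.

Lemma incr_ge s : incr s -> forall n, (n <= s n)%nat.
Proof. intros H n; induction n; [lia|]. specialize (H n); lia. Qed.
Lemma incr_lt s : incr s -> forall n m, (n < m)%nat -> (s n < s m)%nat.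
Proof. intros H n m; induction 1. apply H. specialize (H m); lia. Qed.
Lemma incr_comp s t : incr s -> incr t -> incr (fun n => s (t n)).
Proof. intros H K n. apply incr_lt; auto. Qed.
Lemma ev_sub P s : incr s -> ev P -> ev (fun n => P (s n)).
Proof. intros H [N K]. exists N. intros n Hn. apply K. pose proof (incr_ge s H n); lia. Qed.
Lemma cv_sub u x s : incr s -> cv u x -> cv (fun n => u (s n)) x.
Proof. intros H K e He. apply (ev_sub (fun n => nd (u n) x < e) s H). apply K; auto. Qed.
Lemma ev_ex P : ev P -> exists n, P n.
Proof. intros [N H]. exists N; auto. Qed.

Lemma cv_ext u v x : (forall n, u n = v n) -> cv u x -> cv v x.
Proof. intros H K e He. destruct (K e He) as [N L]. exists N. intros. rewrite <- H. auto. Qed.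
Lemma cv_const x : cv (fun _ => x) x.
Proof. intros e He; exists O; intros; rewrite nd_refl; auto. Qed.
Lemma cv_unique u x y : cv u x -> cv u y -> x = y.
Proof.
  intros H K. apply NNPP; intros N. apply nd_neq in N.
  destruct (ev_ex _ (ev_and _ _ (H (nd x y / 2) ltac:(lra)) (K (nd x y / 2) ltac:(lra)))) as [n [A B]].
  pose proof (nd_tri x (u n) y). rewrite (nd_sym x (u n)) in H0. lra.
Qed.
Lemma cv_le u x p r : cv u x -> ev (fun n => nd (u n) p <= r) -> nd x p <= r.
Proof.
  intros H K. apply Rnot_lt_le; intros L.
  destruct (ev_ex _ (ev_and _ _ (H (nd x p - r) ltac:(lra)) K)) as [n [A B]].
  pose proof (nd_tri x (u n) p). rewrite (nd_sym x (u n)) in H0. lra.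
Qed.
Lemma cv_ge u x p r : cv u x -> ev (fun n => r <= nd (u n) p) -> r <= nd x p.
Proof.
  intros H K. apply Rnot_lt_le; intros L.
  destruct (ev_ex _ (ev_and _ _ (H (r - nd x p) ltac:(lra)) K)) as [n [A B]].
  pose proof (nd_tri (u n) x p). lra.
Qed.
Definition null (e : nat -> R) : Prop := forall d, 0 < d -> ev (fun n => e n < d).
Lemma cv_near u v x e : cv u x -> null e -> ev (fun n => nd (v n) (u n) <= e n) -> cv v x.
Proof.
  intros H K L d Hd. 
  destruct (ev_and _ _ L (ev_and _ _ (H (d / 2) ltac:(lra)) (K (d / 2) ltac:(lra)))) as [N M].
  exists N. intros n Hn. destruct (M n Hn) as (A & B & C). pose proof (nd_tri (v n) (u n) x). lra.
Qed.
Lemma null_sub e s : incr s -> null e -> null (fun n => e (s n)).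
Proof. intros H K d Hd. apply (ev_sub (fun n => e n < d) s H). auto. Qed.
Lemma null_inv : null (fun n => / INR (S n)).
Proof.
  intros d Hd. destruct (archimed_cor1 d Hd) as [N [A B]]. exists N. intros n Hn.
  apply Rle_lt_trans with (/ INR N); auto. apply Rinv_le_contravar.
  apply lt_0_INR; lia. apply le_INR; lia.
Qed.
Lemma null_mult c e : (forall n, 0 <= e n) -> null e -> null (fun n => c * e n).
Proof.
  intros H K d Hd. destruct (Rle_lt_dec c 0).
  - exists O. intros n _. specialize (H n). nra.
  - apply ev_imp with (1 := K (d / c) ltac:(apply Rdiv_lt_0_compat; lra)).
    intros n Hn. apply (Rmult_lt_compat_l c) in Hn; auto. replace (c * (d / c)) with d in Hn by (field; lra). lra.
Qed.

Definition cvR (u : nat -> R) x := forall e, 0 < e -> ev (fun n => Rabs (u n - x) < e).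

Lemma BW_real (u : nat -> R) a r : (forall n, Rabs (u n - a) <= r) ->
  exists s x, incr s /\ cvR (fun n => u (s n)) x.
Proof.
  intros H.
  destruct (Bolzano_Weierstrass u (fun c => a - r <= c <= a + r) (compact_P3 (a - r) (a + r))) as [x Hx].
  { intros n. specialize (H n). unfold Rabs in H; destruct Rcase_abs in H; lra. }
  assert (C : forall m n : nat, exists k, (m < k)%nat /\ Rabs (u k - x) < / INR (S n)).
  { intros m n. destruct (Hx (disc x (mkposreal (/ INR (S n)) ltac:(apply Rinv_0_lt_compat, lt_0_INR; lia))) (S m)) as [k [A B]].
    - exists (mkposreal (/ INR (S n)) ltac:(apply Rinv_0_lt_compat, lt_0_INR; lia)). intros y Hy; exact Hy.
    - exists k; split; [lia|exact B]. }
  set (nx := fun m n => proj1_sig (constructive_indefinite_description _ (C m n))).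
  assert (Hnx : forall m n, (m < nx m n)%nat /\ Rabs (u (nx m n) - x) < / INR (S n)).
  { intros m n. unfold nx. destruct constructive_indefinite_description; simpl; auto. }
  set (s := fix s n := match n with O => nx O O | S m => nx (s m) (S m) end).
  exists s, x. split.
  - intros n. simpl. apply Hnx.
  - intros e He. apply ev_imp with (1 := null_inv e He). intros n Hn.
    destruct n; simpl s; eapply Rlt_trans; try apply Hnx; auto.
Qed.

Lemma BW (u : nat -> pt) p r : (forall n, nd (u n) p <= r) ->
  exists s x, incr s /\ cv (fun n => u (s n)) x /\ nd x p <= r.
Proof.
  intros H.
  destruct (BW_real (fun n => fst (u n)) (fst p) r) as (s & x & Hs & Hx).
  { intros n; apply (nd_le (u n) p r), H. }
  destruct (BW_real (fun n => snd (u (s n))) (snd p) r) as (t & y & Ht & Hy).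
  { intros n; apply (nd_le (u (s n)) p r), H. }
  exists (fun n => s (t n)), (x, y). 
  assert (C : cv (fun n => u (s (t n))) (x, y)).
  { intros e He. destruct (ev_and _ _ (ev_sub _ t Ht (Hx e He)) (Hy e He)) as [N K].
    exists N. intros n Hn. apply nd_lt. apply K; auto. }
  split; [apply incr_comp; auto|]. split; auto.
  apply cv_le with (1 := C). exists O; auto.
Qed.

(** Statements about all sufficiently fine meshes are proved by contradiction: this supplies meshes
    of counterexamples, and compactness supplies their limit. *)
Lemma not_ev (P : nat -> Prop) : ~ ev P -> exists s, incr s /\ forall n, ~ P (s n).
Proof.
  intros H. assert (C : forall m, exists k, (m < k)%nat /\ ~ P k).
  { intros m. apply NNPP; intros N. apply H. exists (S m). intros n Hn.
    apply NNPP; intros Q. apply N. exists n; split; auto. }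
  set (nx := fun m => proj1_sig (constructive_indefinite_description _ (C m))).
  assert (Hnx : forall m, (m < nx m)%nat /\ ~ P (nx m)).
  { intros m. unfold nx. destruct constructive_indefinite_description; simpl; auto. }
  exists (fix s n := match n with O => nx O | S m => nx (s m) end). split.
  - intros n; apply Hnx.
  - intros [|n]; apply Hnx.
Qed.

Definition contat (g : pt -> pt) (x : pt) : Prop :=
  forall e, 0 < e -> exists d, 0 < d /\ forall y, nd x y < d -> nd (g x) (g y) < e.

Lemma contat_cv g x u : contat g x -> cv u x -> cv (fun n => g (u n)) (g x).
Proof.
  intros H K e He. destruct (H e He) as [d [Hd L]]. destruct (K d Hd) as [N M].
  exists N. intros n Hn. rewrite nd_sym. apply L. rewrite nd_sym. auto.
Qed.
Lemma contat_comp g h x : contat g x -> contat h (g x) -> contat (fun y => h (g y)) x.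
Proof.
  intros H K e He. destruct (K e He) as [d [Hd L]]. destruct (H d Hd) as [d' [Hd' M]].
  exists d'; split; auto.
Qed.

Lemma fiter_add f m n x : fiter f (m + n) x = fiter f m (fiter f n x).
Proof. unfold fiter. induction m; simpl; congruence. Qed.
Lemma fiter_S f n x : fiter f (S n) x = fiter f n (f x).
Proof. replace (S n) with (n + 1)%nat by lia. apply fiter_add. Qed.
Lemma fiter_fix f p n : f p = p -> fiter f n p = p.
Proof. intros H; unfold fiter; induction n; simpl; congruence. Qed.
Lemma fiter_mul f m n x : fiter f (m * n) x = fiter (fiter f n) m x.
Proof. induction m; simpl; auto. rewrite fiter_add. now rewrite IHm. Qed.

Lemma contat_fiter f k x : (forall i, (i < k)%nat -> contat f (fiter f i x)) -> contat (fiter f k) x.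
Proof.
  induction k as [|k IH]; intros H.
  - intros e He; exists e; auto.
  - apply (contat_comp (fiter f k) f); auto.
Qed.

(** * Local stable and unstable sets *)

Record isodyn (f : pt -> pt) (p : pt) (R0 : R) : Prop := {
  iso_fix : f p = p;
  iso_pos : 0 < R0;
  iso_cont : forall x, nd x p <= R0 -> contat f x;
  iso_inv : forall s : Z -> pt, (forall n, f (s n) = s (n + 1)%Z) ->
    (forall n, nd (s n) p <= R0) -> s 0%Z = p }.

Section Dynamics.
Variables (f : pt -> pt) (p : pt) (R0 : R).
Hypothesis HD : isodyn f p R0.

Definition seg (k : nat) (x : pt) : Prop := forall i, (i <= k)%nat -> nd (fiter f i x) p <= R0.
Definition Km (j : nat) (x : pt) : Prop := exists y, seg j y /\ fiter f j y = x.
(** The local unstable set. Only finite backward orbits of every length are asked for; compactness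
    turns them into an infinite one in [Kminus_pred]. *)
Definition Kminus (x : pt) : Prop := forall j, Km j x.
Definition Kplus (x : pt) : Prop := forall i, nd (fiter f i x) p <= R0.

Lemma seg_mono k j x : (j <= k)%nat -> seg k x -> seg j x.
Proof. intros H K i Hi. apply K; lia. Qed.

Lemma seg_shift k j x : seg (j + k) x -> seg j (fiter f k x).
Proof. intros H i Hi. rewrite <- fiter_add. apply H; lia. Qed.

Lemma seg_join j k x : seg k x -> seg j (fiter f k x) -> seg (j + k) x.
Proof.
  intros H K i Hi. destruct (Nat.le_gt_cases i k); auto.
  replace i with ((i - k) + k)%nat by lia. rewrite fiter_add. apply K; lia.
Qed.

(** Continuity of an iterate needs only the points before the last one to be in the square, which is
    why [S k] is allowed. *)
Lemma seg_contat k x : seg k x -> forall i, (i <= S k)%nat -> contat (fiter f i) x.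
Proof. intros H i Hi. apply contat_fiter. intros j Hj. apply (iso_cont _ _ _ HD). apply H; lia. Qed.

Lemma seg_fix k : seg k p.
Proof. intros i Hi. rewrite (fiter_fix _ _ _ (iso_fix _ _ _ HD)), nd_refl. pose proof (iso_pos _ _ _ HD); lra. Qed.

Lemma contat_fiter_fix k : contat (fiter f k) p.
Proof. apply (seg_contat k); [apply seg_fix|lia]. Qed.

(** The induction is needed because the next iterate is known to be continuous at the limit only
    once the earlier points of the limit orbit are in the square. *)
Lemma seg_cv k u x : cv u x -> ev (fun n => seg k (u n)) -> seg k x.
Proof.
  intros Hc He. induction k as [|k IH]; intros i Hi.
  - replace i with O by lia. apply cv_le with (1 := Hc). apply ev_imp with (1 := He).
    intros n Hn. apply (Hn O); lia.
  - assert (Sk : seg k x). { apply IH. apply ev_imp with (1 := He). intros n; apply seg_mono; lia. }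
    apply cv_le with (1 := contat_cv _ _ _ (seg_contat k x Sk i Hi) Hc).
    apply ev_imp with (1 := He). intros n Hn; apply Hn; lia.
Qed.

Lemma Km_cv j u x : cv u x -> ev (fun n => Km j (u n)) -> Km j x.
Proof.
  intros Hc [N He].
  assert (C : forall n, exists y, seg j y /\ fiter f j y = u (N + n)%nat). { intros n; apply He; lia. }
  set (y := fun n => proj1_sig (constructive_indefinite_description _ (C n))).
  assert (Hy : forall n, seg j (y n) /\ fiter f j (y n) = u (N + n)%nat).
  { intros n. unfold y. destruct constructive_indefinite_description; simpl; auto. }
  destruct (BW y p R0) as (s & z & Hs & Hz & _). { intros n. apply (proj1 (Hy n) O); lia. }
  assert (Sz : seg j z). { apply seg_cv with (1 := Hz). exists O; intros; apply Hy. }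
  exists z; split; auto.
  apply cv_unique with (u := fun n => fiter f j (y (s n))).
  - apply contat_cv; auto. apply (seg_contat j); auto.
  - apply cv_ext with (u := fun n => u (N + s n)%nat). { intros n; symmetry; apply Hy. }
    apply (cv_sub u x (fun n => (N + s n)%nat)); auto. intros n; specialize (Hs n); lia.
Qed.

Lemma Km_pred j x : Km (S j) x -> exists y, f y = x /\ Km j y.
Proof.
  intros (y & A & B). exists (fiter f j y). split; [exact B|]. exists y; split; auto.
  apply seg_mono with (2 := A); lia.
Qed.

Lemma Km_mono i j x : (i <= j)%nat -> Km j x -> Km i x.
Proof.
  intros H (y & A & B). exists (fiter f (j - i) y). rewrite <- fiter_add. split.
  - apply seg_shift. replace (i + (j - i))%nat with j by lia. auto.
  - replace (i + (j - i))%nat with j by lia. auto.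
Qed.

Lemma Km_in j x : Km j x -> nd x p <= R0.
Proof. intros (y & A & B). rewrite <- B. apply A; lia. Qed.

Lemma Kminus_pred x : Kminus x -> exists y, f y = x /\ Kminus y.
Proof.
  intros H.
  assert (C : forall n, exists y, f y = x /\ Km n y). { intros n; apply Km_pred, H. }
  set (y := fun n => proj1_sig (constructive_indefinite_description _ (C n))).
  assert (Hy : forall n, f (y n) = x /\ Km n (y n)).
  { intros n. unfold y. destruct constructive_indefinite_description; simpl; auto. }
  destruct (BW y p R0) as (s & z & Hs & Hz & Bz). { intros n. apply (Km_in n), Hy. }
  exists z; split.
  - apply cv_unique with (u := fun n => f (y (s n))).
    + apply contat_cv; auto. apply (iso_cont _ _ _ HD); auto.
    + apply cv_ext with (u := fun _ => x). { intros n; symmetry; apply Hy. } apply cv_const.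
  - intros j. apply Km_cv with (1 := Hz). exists j. intros n Hn. apply Km_mono with (s n); [|apply Hy].
    pose proof (incr_ge s Hs n); lia.
Qed.

(** Chosen predecessors and the forward orbit combine to a two-sided orbit in the square, which
    isolation makes trivial. *)
Lemma Kminus_Kplus x : Kminus x -> Kplus x -> x = p.
Proof.
  intros H K.
  assert (C : forall y : {y | Kminus y}, exists z : {z | Kminus z}, f (proj1_sig z) = proj1_sig y).
  { intros [y Hy]. destruct (Kminus_pred y Hy) as (z & A & B). exists (exist _ z B). exact A. }
  set (pr := fun y => proj1_sig (constructive_indefinite_description _ (C y))).
  assert (Hpr : forall y, f (proj1_sig (pr y)) = proj1_sig y).
  { intros y. unfold pr. destruct constructive_indefinite_description; simpl; auto. }
  set (bk := fun n => proj1_sig (Nat.iter n pr (exist _ x H))).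
  set (s := fun z : Z => if (0 <=? z)%Z then fiter f (Z.to_nat z) x else bk (Z.to_nat (- z))).
  change x with (s 0%Z). apply (iso_inv _ _ _ HD).
  - intros n. unfold s. destruct (Z.leb_spec 0 n) as [L|L].
    + destruct (Z.leb_spec 0 (n + 1)); [|lia]. replace (Z.to_nat (n + 1)) with (S (Z.to_nat n)) by lia.
      reflexivity.
    + destruct (Z.leb_spec 0 (n + 1)).
      * replace n with (-1)%Z by lia. simpl. unfold bk; simpl. now rewrite Hpr.
      * replace (Z.to_nat (- n)) with (S (Z.to_nat (- (n + 1)))) by lia. unfold bk. simpl Nat.iter at 1.
        now rewrite Hpr.
  - intros n. unfold s. destruct (0 <=? n)%Z; [apply K|].
    unfold bk. set (q := Nat.iter _ _ _). destruct q as [q Hq]. apply (Km_in O), Hq.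
Qed.

(** Otherwise the midpoints of longer and longer segments accumulate at a point outside the small
    square that is both in [Kminus] and in [Kplus]. *)
Lemma seg_middle s : 0 < s -> exists m, forall y, seg (m + m) y -> nd (fiter f m y) p < s.
Proof.
  intros Hs. apply NNPP; intros N.
  assert (C : forall m, exists y, seg (m + m) y /\ s <= nd (fiter f m y) p).
  { intros m. apply NNPP; intros Q. apply N. exists m. intros y Hy.
    apply Rnot_le_lt; intros L. apply Q; eauto. }
  set (y := fun n => proj1_sig (constructive_indefinite_description _ (C n))).
  assert (Hy : forall n, seg (n + n) (y n) /\ s <= nd (fiter f n (y n)) p).
  { intros n. unfold y. destruct constructive_indefinite_description; simpl; auto. }
  destruct (BW (fun n => fiter f n (y n)) p R0) as (t & z & Ht & Hz & _).
  { intros n. apply (proj1 (Hy n)); lia. }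
  assert (z = p).
  { apply Kminus_Kplus.
    - intros j. apply Km_cv with (1 := Hz). exists j. intros n Hn. pose proof (incr_ge t Ht n).
      apply Km_mono with (t n); [lia|]. exists (y (t n)); split; auto.
      apply seg_mono with (2 := proj1 (Hy (t n))); lia.
    - intros i. apply (seg_cv i _ z Hz); [|lia]. exists i. intros n Hn. pose proof (incr_ge t Ht n).
      apply seg_shift. apply seg_mono with (2 := proj1 (Hy (t n))); lia. }
  subst z. assert (s <= nd p p). { apply cv_ge with (1 := Hz). exists O; intros; apply Hy. }
  rewrite nd_refl in H; lra.
Qed.

Lemma seg_middle_ge s : 0 < s -> exists m, forall k, (m <= k)%nat -> forall y, seg (k + k) y -> nd (fiter f k y) p < s.
Proof.
  intros Hs. destruct (seg_middle s Hs) as [m Hm]. exists m. intros k Hk y Hy.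
  replace k with (m + (k - m))%nat at 1 by lia. rewrite fiter_add. apply Hm. apply seg_shift.
  apply seg_mono with (2 := Hy); lia.
Qed.

(** Produces the small square. An orbit segment with both ends close to p cannot touch the boundary
    of the large one, so points near such a segment can drop out of the block only through their
    final image. *)
Lemma seg_interior : exists s, 0 < s /\ s <= R0 /\ forall k x, nd x p <= s -> seg k x -> nd (fiter f k x) p <= s ->
  forall j, (j <= k)%nat -> nd (fiter f j x) p < R0.
Proof.
  pose proof (iso_pos _ _ _ HD) as HR.
  apply NNPP; intros N.
  assert (C : forall m, exists q : pt * (nat * nat), let '(x, (k, j)) := q in
     nd x p <= R0 * / INR (S m) /\ seg k x /\ nd (fiter f k x) p <= R0 * / INR (S m) /\ (j <= k)%nat /\ R0 <= nd (fiter f j x) p).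
  { intros m. apply NNPP; intros Q. apply N. exists (R0 * / INR (S m)).
    assert (0 < / INR (S m)) by (apply Rinv_0_lt_compat, lt_0_INR; lia).
    assert (/ INR (S m) <= 1). { rewrite <- Rinv_1. apply Rinv_le_contravar; [lra|]. apply (le_INR 1); lia. }
    split; [nra|]. split; [nra|].
    intros k x A B D j Hj. apply Rnot_le_lt; intros L. apply Q. exists (x, (k, j)); auto. }
  set (q := fun n => proj1_sig (constructive_indefinite_description _ (C n))).
  set (x := fun n => fst (q n)). set (k := fun n => fst (snd (q n))). set (j := fun n => snd (snd (q n))).
  assert (Hq : forall m, nd (x m) p <= R0 * / INR (S m) /\ seg (k m) (x m) /\
    nd (fiter f (k m) (x m)) p <= R0 * / INR (S m) /\ (j m <= k m)%nat /\ R0 <= nd (fiter f (j m) (x m)) p).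
  { intros m. unfold x, k, j, q. destruct constructive_indefinite_description as [[? [? ?]] Hh]; simpl; auto. }
  assert (Hn : null (fun n => R0 * / INR (S n))).
  { apply null_mult; [|apply null_inv]. intros n. left. apply Rinv_0_lt_compat, lt_0_INR; lia. }
  assert (Hx : cv x p). { apply cv_near with (fun _ => p) (fun n => R0 * / INR (S n)); auto using cv_const.
    exists O; intros; apply Hq. }
  assert (Hk : cv (fun n => fiter f (k n) (x n)) p).
  { apply cv_near with (fun _ => p) (fun n => R0 * / INR (S n)); auto using cv_const.
    exists O; intros; apply Hq. }
  (* The starting points tend to p, where every fixed iterate is continuous, so contact with the
     boundary comes later and later. *)
  assert (Hj : forall i, ev (fun n => (i <= j n)%nat)).
  { intros i. 
    assert (ev (fun n => forall a, (a < i)%nat -> nd (fiter f a (x n)) p < R0)).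
    { apply ev_fin. intros a _. pose proof (contat_cv _ _ _ (contat_fiter_fix a) Hx) as K.
      rewrite (fiter_fix _ _ _ (iso_fix _ _ _ HD)) in K. apply K; auto. }
    apply ev_imp with (1 := H). intros n Hi. apply Nat.nlt_ge; intros L. specialize (Hi _ L).
    destruct (Hq n) as (_ & _ & _ & _ & L'). lra. }
  set (z := fun n => fiter f (j n) (x n)).
  destruct (BW z p R0) as (t & w & Ht & Hw & _).
  { intros n. destruct (Hq n) as (_ & A & _ & B & _). apply A; auto. }
  assert (E : w = p).
  { apply Kminus_Kplus.
    - intros i. apply Km_cv with (1 := Hw). apply ev_imp with (1 := ev_sub _ t Ht (Hj i)).
      intros n Hi. apply Km_mono with (j (t n)); auto. exists (x (t n)). split; auto.
      apply seg_mono with (k (t n)); apply Hq.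
    - intros i. induction i as [i IH] using lt_wf_ind.
      (* The time left after the contact is either eventually at least i, and then the limit
         inherits a forward segment, or takes one value a < i infinitely often, and then
         [fiter f a w = p]. *)
      destruct (classic (ev (fun n => (i <= k (t n) - j (t n))%nat))) as [A|A].
      + apply (seg_cv i _ w Hw); [|lia]. apply ev_imp with (1 := A). intros n B.
        unfold z. apply seg_shift. apply seg_mono with (k (t n)). 2: apply Hq.
        destruct (Hq (t n)) as (_ & _ & _ & H1 & _). lia.
      + destruct (not_ev _ A) as (s & Hs & B).
        assert (exists a, (a < i)%nat /\ fiter f a w = p) as (a & Ha & Ea).
        { assert (exists a s', (a < i)%nat /\ incr s' /\ forall n, (k (t (s' n)) - j (t (s' n)) = a)%nat) as (a & s' & H1 & H2 & H3).
          { apply NNPP; intros Q.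
            assert (ev (fun n => forall a, (a < i)%nat -> (k (t (s n)) - j (t (s n)) <> a)%nat)).
            { apply ev_fin. intros a Ha. apply NNPP; intros Q'. destruct (not_ev _ Q') as (s' & S1 & S2).
              apply Q. exists a, (fun n => s (s' n)). repeat split; auto using incr_comp.
              intros n. apply NNPP; apply S2. }
            destruct (ev_ex _ H) as [n Hn']. specialize (B n). apply (Hn' (k (t (s n)) - j (t (s n)))%nat); lia. }
          exists a; split; auto. apply cv_unique with (u := fun n => fiter f a (z (t (s' n)))).
          - apply (contat_cv (fiter f a) w (fun n => z (t (s' n)))); [|apply (cv_sub (fun n => z (t n))); auto]. apply contat_fiter. intros b Hb.
            apply (iso_cont _ _ _ HD). apply IH; lia.
          - apply cv_ext with (u := fun n => fiter f (k (t (s' n))) (x (t (s' n)))).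
            + intros n. unfold z. rewrite <- fiter_add. f_equal. specialize (H3 n).
              destruct (Hq (t (s' n))) as (_ & _ & _ & H4 & _). lia.
            + apply (cv_sub _ _ (fun n => t (s' n)) (incr_comp _ _ Ht H2) Hk). }
        replace i with ((i - a) + a)%nat by lia.
        rewrite fiter_add, Ea, (fiter_fix _ _ _ (iso_fix _ _ _ HD)), nd_refl. lra. }
  assert (R0 <= nd w p). { apply cv_ge with (1 := Hw). exists O; intros; apply Hq. }
  rewrite E, nd_refl in H; lra.
Qed.

End Dynamics.

Lemma fchoice {A B : Type} (P : A -> B -> Prop) : (forall a, exists b, P a b) ->
  exists g : A -> B, forall a, P a (g a).
Proof.
  intros H. exists (fun a => proj1_sig (constructive_indefinite_description _ (H a))).
  intros a. destruct constructive_indefinite_description; auto.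
Qed.

(** * Isolating blocks of sources and sinks *)

Lemma int2_nd (N : pt -> Prop) x r : 0 < r -> (forall y, nd x y < r -> N y) -> int2 N x.
Proof.
  intros Hr H. exists r; split; auto. intros y Hy. apply H. pose proof (nd_le_dist2 x y). lra.
Qed.

Lemma seq_compact (N : pt -> Prop) p r : (forall x, N x -> nd x p <= r) ->
  (forall u x, cv u x -> (forall n, N (u n)) -> N x) -> compact2 N.
Proof.
  intros HB HC. split.
  - intros x Hx. apply NNPP; intros Q.
    assert (C : forall n : nat, exists y, N y /\ nd y x <= / INR (S n)).
    { intros n. apply NNPP; intros Q'. apply Q. exists (/ INR (S n)). split.
      { apply Rinv_0_lt_compat, lt_0_INR; lia. }
      intros y Hy Ny. apply Q'. exists y; split; auto. pose proof (nd_le_dist2 x y).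
      rewrite nd_sym. lra. }
    destruct (fchoice _ C) as [u Hu]. apply Hx. apply HC with u; [|apply Hu].
    apply cv_near with (fun _ => x) (fun n => / INR (S n)); auto using cv_const, null_inv.
    exists O; intros; apply Hu.
  - exists (2 * (r + nd p (0, 0))). intros x Hx. pose proof (dist2_le_nd x (0, 0)).
    pose proof (nd_tri x p (0, 0)). specialize (HB x Hx). lra.
Qed.

Lemma isodyn_of_isolated U f p : open2 U -> cont_on2 U f -> U p -> isolated_fixed_set U f p ->
  exists R0, isodyn f p R0 /\ forall x, nd x p <= R0 -> U x.
Proof.
  intros HU Hf Hp [Hfix (N & (HNU & HNc & HNi) & HN)].
  assert (Hpi : int2 N p). { apply HNi. apply HN. reflexivity. }
  destruct Hpi as (e & He & Hb).
  assert (HS : forall x, nd x p <= e / 4 -> N x).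
  { intros x Hx. apply Hb. pose proof (dist2_le_nd p x). rewrite nd_sym in H. lra. }
  exists (e / 4). split; [constructor; auto; try lra|intros; apply HNU; auto].
  - intros x Hx ep Hep. destruct (Hf x (HNU _ (HS x Hx)) ep Hep) as (d & Hd & H).
    destruct (HU x (HNU _ (HS x Hx))) as (d' & Hd' & H').
    exists (Rmin d d' / 2). pose proof (Rmin_l d d'). pose proof (Rmin_r d d').
    assert (0 < Rmin d d') by (apply Rmin_glb_lt; auto). split; [lra|].
    intros y Hy. pose proof (dist2_le_nd x y). pose proof (nd_le_dist2 (f x) (f y)).
    assert (dist2 (f x) (f y) < ep). { apply H; [apply H'|]; lra. } lra.
  - intros s A B. apply HN. split; [apply HS, B|]. exists s. split; auto. 
Qed.

Section Blocks.
Variables (U : pt -> Prop) (f : pt -> pt) (p : pt) (R0 : R).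
Hypothesis HD : isodyn f p R0.
Hypothesis HSU : forall x, nd x p <= R0 -> U x.
Hypothesis Hiso : isolated_fixed_set U f p.

Lemma isolating_block (N : pt -> Prop) r : 0 < r -> (forall y, nd p y < r -> N y) ->
  (forall x, N x -> nd x p <= R0) -> (forall u x, cv u x -> (forall n, N (u n)) -> N x) ->
  isolating_nbhd U f N /\ Inv_is_point f N p.
Proof.
  intros Hr Hi HB HC.
  assert (I : Inv_is_point f N p).
  { intros x. split.
    - intros [_ (s & S0 & S1 & S2)]. rewrite <- S0. apply (iso_inv _ _ _ HD); auto.
    - intros ->. split. { apply Hi. rewrite nd_refl; auto. }
      exists (fun _ => p). split; auto. split. { intros; apply (iso_fix _ _ _ HD). }
      intros; apply Hi. rewrite nd_refl; auto. }
  split; auto. split; [intros x Hx; auto|]. split; [apply seq_compact with p R0; auto|].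
  intros x Hx. apply I in Hx. subst x. apply int2_nd with r; auto.
Qed.

(** Points that start an [eps]-pseudo-orbit of j steps in the square of radius [rho]. Unlike for
    true orbits, the first point can be moved slightly. *)
Fixpoint rep (rho eps : R) (j : nat) (x : pt) : Prop :=
  match j with
  | O => nd x p <= rho
  | S j => nd x p <= rho /\ exists y, rep rho eps j y /\ nd (f x) y <= eps
  end.

Lemma rep_in rho eps j x : rep rho eps j x -> nd x p <= rho.
Proof. destruct j; simpl; tauto. Qed.

Lemma rep_pred rho eps j x : rep rho eps (S j) x -> rep rho eps j x.
Proof.
  revert x; induction j as [|j IH]; intros x [A (y & B & C)]; simpl; auto.
  split; auto. exists y; split; auto.
Qed.

Lemma rep_cv rho eps j u x : rho <= R0 -> cv u x -> (forall n, rep rho eps j (u n)) -> rep rho eps j x.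
Proof.
  intros Hr. revert u x; induction j as [|j IH]; intros u x Hc H.
  { simpl in *. apply cv_le with (1 := Hc). exists O; auto. }
  assert (Hx : nd x p <= rho). { apply cv_le with (1 := Hc). exists O; intros; apply H. }
  split; auto.
  destruct (fchoice (fun n y => rep rho eps j y /\ nd (f (u n)) y <= eps)) as [y Hy].
  { intros n; apply H. }
  destruct (BW y p rho) as (s & z & Hs & Hz & _). { intros n; apply (rep_in _ eps j), Hy. }
  exists z; split. { apply IH with (1 := Hz). intros n; apply Hy. }
  assert (Cf : cv (fun n => f (u (s n))) (f x)).
  { apply contat_cv; [apply (iso_cont _ _ _ HD); lra|]. apply cv_sub; auto. }
  apply Rnot_lt_le; intros L. set (d := nd (f x) z - eps) in *.
  destruct (ev_ex _ (ev_and _ _ (Cf (d / 2) ltac:(unfold d; lra)) (Hz (d / 2) ltac:(unfold d; lra)))) as [n [A B]].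
  pose proof (proj2 (Hy (s n))). pose proof (nd_tri (f x) (f (u (s n))) z).
  pose proof (nd_tri (f (u (s n))) (y (s n)) z). rewrite (nd_sym (f x) (f (u (s n)))) in H1. unfold d in *; lra.
Qed.

(** As the error tends to 0 and the length grows, pseudo-orbits converge to true forward orbits in
    the square, of which only p is left. *)
Lemma rep_small rho : 0 < rho <= R0 -> (forall x, (forall i, nd (fiter f i x) p <= rho) -> x = p) ->
  exists m eps, 0 < eps /\ forall x, rep rho eps m x -> nd x p < rho / 2.
Proof.
  intros Hr HK. apply NNPP; intros Q.
  assert (C : forall m, exists x, rep rho (/ INR (S m)) m x /\ rho / 2 <= nd x p).
  { intros m. apply NNPP; intros Q'. apply Q. exists m, (/ INR (S m)). split.
    { apply Rinv_0_lt_compat, lt_0_INR; lia. }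
    intros x Hx. apply Rnot_le_lt; intros L; apply Q'; eauto. }
  destruct (fchoice _ C) as [u Hu].
  destruct (BW u p rho) as (s & x & Hs & Hx & _). { intros n; apply (rep_in _ (/ INR (S n)) n), Hu. }
  (* Each [fiter f i x] is a limit of points that still start a pseudo-orbit of the remaining length
     [s n - i]. *)
  assert (K : forall i, exists y N, cv y (fiter f i x) /\ forall n, (N <= n)%nat -> rep rho (/ INR (S (s n))) (s n - i) (y n)).
  { induction i as [|i (y & N & IH1 & IH2)].
    - exists (fun n => u (s n)), O. split; auto. intros n _. rewrite Nat.sub_0_r. apply Hu.
    - assert (C' : forall n, exists z, (N + S i <= n)%nat -> rep rho (/ INR (S (s n))) (s n - S i) z /\ nd (f (y n)) z <= / INR (S (s n))).
      { intros n. destruct (Nat.le_gt_cases (N + S i) n) as [L|L]; [|exists p; lia].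
        specialize (IH2 n ltac:(lia)). pose proof (incr_ge s Hs n).
        replace (s n - i)%nat with (S (s n - S i)) in IH2 by lia. destruct IH2 as [_ (z & A & B)]. exists z; auto. }
      destruct (fchoice _ C') as [z Hz]. exists z, (N + S i)%nat. split; [|intros n Hn; apply Hz; auto].
      apply cv_near with (fun n => f (y n)) (fun n => / INR (S (s n))).
      + apply (contat_cv f); auto. apply (iso_cont _ _ _ HD).
        assert (nd (fiter f i x) p <= rho). { apply cv_le with (1 := IH1). exists N. intros n Hn. eapply rep_in; eauto. }
        apply Rle_trans with rho; [exact H|apply Hr].
      + apply (null_sub _ s Hs null_inv).
      + exists (N + S i)%nat. intros n Hn. rewrite nd_sym. apply Hz; auto. }
  assert (x = p).
  { apply HK. intros i. destruct (K i) as (y & N & A & B). apply cv_le with (1 := A).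
    exists N. intros n Hn. eapply rep_in; eauto. }
  assert (rho / 2 <= nd x p). { apply cv_ge with (1 := Hx). exists O; intros; apply Hu. }
  subst x. rewrite nd_refl in H0. lra.
Qed.

(** The neighbourhood is the set of starts of pseudo-orbits, all within [rho / 2] of p. If the image
    of such a point is again in it, the pseudo-orbit can be prolonged backwards to every nearby
    point, so the point is interior. *)
Lemma source_of_Kplus rho : 0 < rho <= R0 -> (forall x, (forall i, nd (fiter f i x) p <= rho) -> x = p) ->
  is_source U f p.
Proof.
  intros Hr HK. destruct (rep_small rho Hr HK) as (m & eps & He & Hm).
  assert (Hint : forall x, nd x p < rho -> rep rho eps m (f x) -> exists d, 0 < d /\ forall y, nd x y < d -> rep rho eps m y).
  { intros x Hx H. destruct (iso_cont _ _ _ HD x ltac:(lra) eps He) as (d & Hd & K).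
    exists (Rmin d (rho - nd x p)). split; [apply Rmin_glb_lt; lra|]. intros y Hy.
    pose proof (Rmin_l d (rho - nd x p)). pose proof (Rmin_r d (rho - nd x p)).
    pose proof (nd_tri y x p). rewrite (nd_sym y x) in H2.
    apply rep_pred. split; [lra|]. exists (f x). split; auto. rewrite nd_sym. left; apply K; lra. }
  assert (Hp : rep rho eps m p).
  { clear - Hr He HD. induction m as [|m IH]; simpl; rewrite nd_refl; [lra|]. split; [lra|]. exists p.
    split; auto. rewrite (iso_fix _ _ _ HD), nd_refl; lra. }
  destruct (Hint p) as (d & Hd & Hdp). { rewrite nd_refl; lra. } { rewrite (iso_fix _ _ _ HD); auto. }
  destruct (isolating_block (rep rho eps m) d) as [I1 I2]; auto.
  { intros x Hx. apply rep_in in Hx; lra. }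
  { intros u x A B. apply rep_cv with u; auto; lra. }
  split; auto. exists (rep rho eps m). split; auto. split; auto. split.
  - intros x [Nx Hx] (e & He' & H). apply Hx.
    destruct (Hint x) as (d' & Hd' & H'). { specialize (Hm x Nx). lra. }
    { apply H. unfold dist2. replace (_ + _) with 0 by ring. rewrite sqrt_0; auto. }
    apply int2_nd with d'; auto.
  - intros x Nx Hx. apply NNPP; intros Q. apply Hx. apply HK. intros i.
    apply (rep_in _ eps m). apply NNPP; intros Q'. apply Q; eauto.
Qed.

(** Dual to [rep]: the ends of [eps]-pseudo-orbits of j steps in the square. *)
Fixpoint att (eps : R) (j : nat) (x : pt) : Prop :=
  match j with
  | O => nd x p <= R0
  | S j => nd x p <= R0 /\ exists y, att eps j y /\ nd (f y) x <= eps
  end.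

Lemma att_in eps j x : att eps j x -> nd x p <= R0.
Proof. destruct j; simpl; tauto. Qed.

Lemma att_pred eps j x : att eps (S j) x -> att eps j x.
Proof.
  revert x; induction j as [|j IH]; intros x [A (y & B & C)]; simpl; auto.
  split; auto. exists y; split; auto.
Qed.

Lemma att_cv eps j u x : cv u x -> (forall n, att eps j (u n)) -> att eps j x.
Proof.
  revert u x; induction j as [|j IH]; intros u x Hc H.
  { simpl in *. apply cv_le with (1 := Hc). exists O; auto. }
  assert (Hx : nd x p <= R0). { apply cv_le with (1 := Hc). exists O; intros; apply H. }
  split; auto.
  destruct (fchoice (fun n y => att eps j y /\ nd (f y) (u n) <= eps)) as [y Hy].
  { intros n; apply H. }
  destruct (BW y p R0) as (s & z & Hs & Hz & Bz). { intros n; apply (att_in eps j), Hy. }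
  exists z; split. { apply IH with (1 := Hz). intros n; apply Hy. }
  assert (Cf : cv (fun n => f (y (s n))) (f z)).
  { apply contat_cv; auto. apply (iso_cont _ _ _ HD); lra. }
  assert (Cu : cv (fun n => u (s n)) x) by (apply cv_sub; auto).
  apply Rnot_lt_le; intros L. set (d := nd (f z) x - eps) in *.
  destruct (ev_ex _ (ev_and _ _ (Cf (d / 2) ltac:(unfold d; lra)) (Cu (d / 2) ltac:(unfold d; lra)))) as [n [A B]].
  pose proof (proj2 (Hy (s n))). pose proof (nd_tri (f z) (f (y (s n))) x).
  pose proof (nd_tri (f (y (s n))) (u (s n)) x). rewrite (nd_sym (f z) (f (y (s n)))) in H1. unfold d in *; lra.
Qed.

Lemma att_lim j : forall u (e : nat -> R) (m : nat -> nat) x, cv u x -> null e -> (forall i, ev (fun n => (i <= m n)%nat)) ->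
  (forall n, att (e n) (m n) (u n)) -> Km f p R0 j x.
Proof.
  induction j as [|j IH]; intros u e m x Hc He Hm H.
  { exists x. split; auto. intros i Hi. replace i with O by lia. apply cv_le with (1 := Hc).
    exists O. intros n _. eapply att_in; eauto. }
  destruct (Hm 1%nat) as [N HN].
  destruct (fchoice (fun n y => att (e (N + n)%nat) (m (N + n)%nat - 1) y /\ nd (f y) (u (N + n)%nat) <= e (N + n)%nat)) as [y Hy].
  { intros n. specialize (H (N + n)%nat). specialize (HN (N + n)%nat ltac:(lia)).
    destruct (m (N + n)%nat) as [|k]; [lia|]. simpl. rewrite Nat.sub_0_r. apply H. }
  destruct (BW y p R0) as (s & z & Hs & Hz & Bz). { intros n; eapply att_in, Hy. }
  set (t := fun n => (N + s n)%nat). assert (Ht : incr t) by (intros n; unfold t; specialize (Hs n); lia).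
  destruct (IH (fun n => y (s n)) (fun n => e (t n)) (fun n => m (t n) - 1)%nat z) as (w & A & B); auto.
  { apply null_sub; auto. }
  { intros i. apply ev_imp with (1 := ev_sub _ t Ht (Hm (S i))). intros; lia. }
  { intros n; apply Hy. }
  assert (E : f z = x).
  { apply cv_unique with (u := fun n => u (t n)); [|apply cv_sub; auto].
    apply cv_near with (fun n => f (y (s n))) (fun n => e (t n)).
    - apply contat_cv; auto. apply (iso_cont _ _ _ HD); auto.
    - apply null_sub; auto.
    - exists O. intros n _. rewrite nd_sym. apply Hy. }
  exists w. split.
  - intros i Hi. destruct (Nat.eq_dec i (S j)) as [->|]; [|apply A; lia].
    change (fiter f (S j) w) with (f (fiter f j w)). rewrite B, E.
    apply cv_le with (1 := Hc). exists O. intros n _. eapply att_in; eauto.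
  - change (fiter f (S j) w) with (f (fiter f j w)). now rewrite B.
Qed.

(** Long accurate pseudo-orbits end so close to p that f keeps their ends in the square; the image
    then ends a pseudo-orbit one step longer, which gives forward invariance. *)
Lemma sink_of_Kminus : (forall x, Kminus f p R0 x -> x = p) -> is_sink U f p.
Proof.
  intros HK. pose proof (iso_pos _ _ _ HD) as HR.
  destruct (iso_cont _ _ _ HD p ltac:(rewrite nd_refl; lra) R0 HR) as (r & Hr & Hf).
  rewrite (iso_fix _ _ _ HD) in Hf.
  assert (exists m eps, 0 < eps /\ forall x, att eps m x -> nd x p < r) as (m & eps & He & Hm).
  { apply NNPP; intros Q.
    assert (C : forall m, exists x, att (/ INR (S m)) m x /\ r <= nd x p).
    { intros m. apply NNPP; intros Q'. apply Q. exists m, (/ INR (S m)). split.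
      { apply Rinv_0_lt_compat, lt_0_INR; lia. }
      intros x Hx. apply Rnot_le_lt; intros L; apply Q'; eauto. }
    destruct (fchoice _ C) as [u Hu].
    destruct (BW u p R0) as (s & x & Hs & Hx & _). { intros n; eapply att_in, Hu. }
    assert (x = p).
    { apply HK. intros j. apply att_lim with (fun n => u (s n)) (fun n => / INR (S (s n))) s; auto.
      apply (null_sub _ s Hs null_inv).
      intros i. exists i. intros n Hn. pose proof (incr_ge s Hs n); lia.
      intros n; apply Hu. }
    assert (r <= nd x p). { apply cv_ge with (1 := Hx). exists O; intros; apply Hu. }
    subst x. rewrite nd_refl in H0. lra. }
  assert (Hp : att eps m p).
  { clear - HR He HD. induction m as [|m IH]; simpl; rewrite nd_refl; [lra|]. split; [lra|]. exists p.
    split; auto. rewrite (iso_fix _ _ _ HD), nd_refl; lra. }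
  destruct (isolating_block (att eps m) (Rmin R0 eps)) as [I1 I2].
  { apply Rmin_glb_lt; lra. }
  { intros y Hy. pose proof (Rmin_l R0 eps). pose proof (Rmin_r R0 eps).
    apply att_pred. split; [rewrite nd_sym; lra|]. exists p. split; auto. rewrite (iso_fix _ _ _ HD); lra. }
  { apply att_in. }
  { intros u x; apply att_cv. }
  split; auto. exists (att eps m). split; auto. split; auto.
  intros x Hx. apply att_pred. split.
  - rewrite nd_sym. left; apply Hf. rewrite nd_sym; auto.
  - exists x; split; auto. rewrite nd_refl; lra.
Qed.

End Blocks.

(** * Deformation of the square path to the circle *)

Definition qk (k : R) (t : R) : R := clamp 0 1 (4 * t - k).
(** Counterclockwise from the lower right corner, side k being traversed while
    [k <= 4 * t <= k + 1]. The saturated parameters [qk] make one continuous formula serve all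
    sides. *)
Definition sq (p : pt) (rho t : R) : pt :=
  (fst p + rho * (1 - 2 * qk 1 t + 2 * qk 3 t), snd p + rho * (-1 + 2 * qk 0 t - 2 * qk 2 t)).

Lemma qk_cont k : continuity (qk k).
Proof.
  apply (continuity_comp (fun t => 4 * t - k) (clamp 0 1)); [|apply clamp_cont].
  intros t; apply derivable_continuous_pt; reg.
Qed.

Lemma qk_0 k t : 4 * t <= k -> qk k t = 0.
Proof. intros h. unfold qk, clamp. rewrite Rmin_right by lra. apply Rmax_left; lra. Qed.
Lemma qk_1 k t : k + 1 <= 4 * t -> qk k t = 1.
Proof. intros h. unfold qk, clamp. rewrite Rmin_left by lra. apply Rmax_right; lra. Qed.
Lemma qk_mid k t : k <= 4 * t <= k + 1 -> qk k t = 4 * t - k.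
Proof. intros h; unfold qk; rewrite clamp_id; lra. Qed.

Lemma sq_0 p rho t : 0 <= 4 * t <= 1 -> sq p rho t = (fst p + rho, snd p + rho * (2 * (4 * t - 0) - 1)).
Proof. intros h; unfold sq. rewrite (qk_mid 0), !qk_0 by lra. f_equal; ring. Qed.
Lemma sq_1 p rho t : 1 <= 4 * t <= 2 -> sq p rho t = (fst p + rho * (1 - 2 * (4 * t - 1)), snd p + rho).
Proof. intros h; unfold sq. rewrite (qk_mid 1), (qk_1 0), !qk_0 by lra. f_equal; ring. Qed.
Lemma sq_2 p rho t : 2 <= 4 * t <= 3 -> sq p rho t = (fst p - rho, snd p + rho * (1 - 2 * (4 * t - 2))).
Proof. intros h; unfold sq. rewrite (qk_mid 2), (qk_1 0), (qk_1 1), !qk_0 by lra. f_equal; ring. Qed.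
Lemma sq_3 p rho t : 3 <= 4 * t <= 4 -> sq p rho t = (fst p + rho * (2 * (4 * t - 3) - 1), snd p - rho).
Proof. intros h; unfold sq. rewrite (qk_mid 3), (qk_1 0), (qk_1 1), (qk_1 2) by lra. f_equal; ring. Qed.

Lemma sq_closed p rho : sq p rho 0 = sq p rho 1.
Proof. rewrite sq_0, sq_3 by lra. f_equal; lra. Qed.

Lemma sq_cpath p rho : cpath (sq p rho).
Proof.
  assert (C : forall a b c k l, continuity (fun t => a + b * (c + 2 * qk k t - 2 * qk l t))).
  { intros a b c k l. apply (continuity_plus (fun _ => a)). { apply continuity_const; intros x y; reflexivity. }
    apply (continuity_scal (fun t => c + 2 * qk k t - 2 * qk l t)).
    apply (continuity_minus (fun t => c + 2 * qk k t) (fun t => 2 * qk l t)).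
    - apply (continuity_plus (fun _ => c)). { apply continuity_const; intros x y; reflexivity. }
      apply (continuity_scal (qk k)), qk_cont.
    - apply (continuity_scal (qk l)), qk_cont. }
  split; unfold sq; simpl.
  - replace (fun t => fst p + rho * (1 - 2 * qk 1 t + 2 * qk 3 t))
      with (fun t => fst p + rho * (1 + 2 * qk 3 t - 2 * qk 1 t)); [apply C|].
    apply functional_extensionality; intros; ring.
  - apply C.
Qed.

Lemma circ_cpath p r : cpath (circ p r).
Proof.
  split; unfold circ; simpl; intros t; apply derivable_continuous_pt; reg.
Qed.

Lemma nd_circ p r t : 0 <= r -> nd (circ p r t) p <= r.
Proof.
  intros Hr. apply nd_le; unfold circ; simpl.
  pose proof (COS_bound (2 * PI * t)). pose proof (SIN_bound (2 * PI * t)).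
  split; apply Rabs_le; nra.
Qed.

Lemma sq_sides p rho t : 0 <= t <= 1 -> 0 <= rho ->
  nd (sq p rho t) p <= rho /\ rho ^ 2 <= (fst (sq p rho t) - fst p) ^ 2 + (snd (sq p rho t) - snd p) ^ 2.
Proof.
  intros Ht Hr.
  assert (A : forall k, k <= 4 * t <= k + 1 -> 0 <= rho * (4 * t - k) <= rho) by (intros; nra).
  assert (B : forall x y c, (x - c) ^ 2 = rho ^ 2 -> rho ^ 2 <= (x - c) ^ 2 + y ^ 2).
  { intros x y c ->. pose proof (pow2_ge_0 y). lra. }
  assert (B' : forall x y c, (x - c) ^ 2 = rho ^ 2 -> rho ^ 2 <= y ^ 2 + (x - c) ^ 2).
  { intros x y c ->. pose proof (pow2_ge_0 y). lra. }
  destruct (Rle_dec (4 * t) 1); [rewrite sq_0 by lra; specialize (A 0 ltac:(lra))|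
  destruct (Rle_dec (4 * t) 2); [rewrite sq_1 by lra; specialize (A 1 ltac:(lra))|
  destruct (Rle_dec (4 * t) 3); [rewrite sq_2 by lra; specialize (A 2 ltac:(lra))
    |rewrite sq_3 by lra; specialize (A 3 ltac:(lra))]]];
  (split; [apply nd_le; simpl; split; apply Rabs_le; lra | simpl fst; simpl snd; (apply B; ring) || (apply B'; ring)]).
Qed.

(** For [8 * u < 1] the angle is at most PI/4, where the cosine dominates the sine; otherwise both
    terms are nonnegative. *)
Lemma angle_ineq u : 0 <= u <= / 4 -> 0 <= cos (2 * PI * u) + (8 * u - 1) * sin (2 * PI * u).
Proof.
  intros Hu. pose proof PI_RGT_0.
  assert (A : 0 <= 2 * PI * u <= PI / 2) by nra.
  assert (0 <= cos (2 * PI * u)) by (apply cos_ge_0; lra).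
  assert (0 <= sin (2 * PI * u)) by (apply sin_ge_0; lra).
  destruct (Rle_dec 1 (8 * u)); [nra|].
  assert (2 * PI * u <= PI / 4) by nra.
  assert (sin (2 * PI * u) <= sin (PI / 4)) by (apply sin_incr_1; lra).
  assert (cos (PI / 4) <= cos (2 * PI * u)) by (apply cos_decr_1; lra).
  rewrite <- sin_cos_PI4 in *. nra.
Qed.

Lemma sq_circ_dot p rho r t : 0 <= t <= 1 -> 0 <= rho -> 0 <= r ->
  0 <= (fst (sq p rho t) - fst p) * (fst (circ p r t) - fst p) + (snd (sq p rho t) - snd p) * (snd (circ p r t) - snd p).
Proof.
  intros Ht Hrho Hr.
  assert (P : 0 <= rho * r) by nra.
  destruct (Rle_dec (4 * t) 1); [rewrite sq_0 by lra|
  destruct (Rle_dec (4 * t) 2); [rewrite sq_1 by lra|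
  destruct (Rle_dec (4 * t) 3); [rewrite sq_2 by lra|rewrite sq_3 by lra]]]; unfold circ; simpl.
  - pose proof (angle_ineq t ltac:(lra)). 
    replace (_ + _) with ((rho * r) * (cos (2 * PI * t) + (8 * t - 1) * sin (2 * PI * t))) by ring. nra.
  - pose proof (angle_ineq (t - / 4) ltac:(lra)).
    replace (2 * PI * t) with (PI / 2 + 2 * PI * (t - / 4)) by field.
    rewrite cos_plus, sin_plus, cos_PI2, sin_PI2. set (c := cos _) in *. set (s := sin _) in *.
    replace (_ + _) with ((rho * r) * (c + (8 * (t - / 4) - 1) * s)) by field. nra.
  - pose proof (angle_ineq (t - / 2) ltac:(lra)).
    replace (2 * PI * t) with (PI + 2 * PI * (t - / 2)) by field.
    rewrite cos_plus, sin_plus, cos_PI, sin_PI. set (c := cos _) in *. set (s := sin _) in *.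
    replace (_ + _) with ((rho * r) * (c + (8 * (t - / 2) - 1) * s)) by field. nra.
  - pose proof (angle_ineq (t - 3 / 4) ltac:(lra)).
    replace (2 * PI * t) with (3 * (PI / 2) + 2 * PI * (t - 3 / 4)) by field.
    rewrite cos_plus, sin_plus, cos_3PI2, sin_3PI2. set (c := cos _) in *. set (s := sin _) in *.
    replace (_ + _) with ((rho * r) * (c + (8 * (t - 3 / 4) - 1) * s)) by field. nra.
Qed.

Definition mixp (s : R) (x y : pt) : pt := ((1 - s) * fst x + s * fst y, (1 - s) * snd x + s * snd y).

Lemma nd_lower x p c : 0 <= c -> 2 * c ^ 2 <= (fst x - fst p) ^ 2 + (snd x - snd p) ^ 2 -> c <= nd x p.
Proof.
  intros Hc H. apply Rnot_lt_le; intros L. apply nd_lt in L. destruct L as [A B].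
  unfold Rabs in *; repeat destruct Rcase_abs; nra.
Qed.

(** The positions on square and circle never make an obtuse angle, so the squared length of a
    mixture is at least [((1 - s)^2 + s^2) * r^2 / 4], hence at least [r^2 / 8], which is twice the
    square of [r / 4]. *)
Lemma mix_annulus p rho r s t : 0 <= t <= 1 -> 0 <= s <= 1 -> 0 < r -> r / 2 <= rho <= r ->
  r / 4 <= nd (mixp s (sq p rho t) (circ p r t)) p <= 2 * r.
Proof.
  intros Ht Hs Hr Hrho. destruct (sq_sides p rho t Ht ltac:(lra)) as [A B].
  pose proof (nd_circ p r t ltac:(lra)) as C. pose proof (sq_circ_dot p rho r t Ht ltac:(lra) ltac:(lra)) as D.
  split.
  - apply nd_lower; [lra|]. unfold mixp; cbn [fst snd].
    assert (E : (fst (circ p r t) - fst p) ^ 2 + (snd (circ p r t) - snd p) ^ 2 = r ^ 2).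
    { unfold circ; simpl. pose proof (cos_sin_1 (2 * PI * t)) as K.
      transitivity (r * r * (cos (2 * PI * t) * cos (2 * PI * t) + sin (2 * PI * t) * sin (2 * PI * t))); [ring|].
      rewrite K; ring. }
    set (x1 := fst (sq p rho t) - fst p) in *. set (x2 := snd (sq p rho t) - snd p) in *.
    set (y1 := fst (circ p r t) - fst p) in *. set (y2 := snd (circ p r t) - snd p) in *.
    replace ((1 - s) * fst (sq p rho t) + s * fst (circ p r t) - fst p) with ((1 - s) * x1 + s * y1) by (unfold x1, y1; ring).
    replace ((1 - s) * snd (sq p rho t) + s * snd (circ p r t) - snd p) with ((1 - s) * x2 + s * y2) by (unfold x2, y2; ring).
    replace (((1 - s) * x1 + s * y1) ^ 2 + ((1 - s) * x2 + s * y2) ^ 2) with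
      ((1 - s) ^ 2 * (x1 ^ 2 + x2 ^ 2) + s ^ 2 * (y1 ^ 2 + y2 ^ 2) + 2 * (s * (1 - s)) * (x1 * y1 + x2 * y2)) by ring.
    assert (0 <= s * (1 - s)) by nra. assert (0 <= 2 * (s * (1 - s)) * (x1 * y1 + x2 * y2)) by nra.
    assert (r ^ 2 / 4 <= x1 ^ 2 + x2 ^ 2) by nra.
    assert (0 <= (1 - s) ^ 2) by nra. assert ((1 - s) ^ 2 * (r ^ 2 / 4) <= (1 - s) ^ 2 * (x1 ^ 2 + x2 ^ 2)) by nra.
    rewrite E. assert (0 <= r ^ 2) by nra. 
    assert (/ 2 <= (1 - s) ^ 2 + s ^ 2) by (pose proof (pow2_ge_0 (2 * s - 1)); nra).
    assert (r ^ 2 / 4 * / 2 <= r ^ 2 / 4 * ((1 - s) ^ 2 + s ^ 2)) by nra.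
    assert (0 <= s ^ 2 * r ^ 2) by (apply Rmult_le_pos; nra). lra.
  - apply nd_le in A, C. apply nd_le. unfold mixp; cbn [fst snd].
    destruct A as [A1 A2], C as [C1 C2].
    split; apply Rabs_le.
    + unfold Rabs in A1, C1; repeat destruct Rcase_abs; nra.
    + unfold Rabs in A2, C2; repeat destruct Rcase_abs; nra.
Qed.

Lemma Rabs_diff2 a b x y e : Rabs (a - x) < e -> Rabs (b - y) < e -> Rabs (a - b - (x - y)) < 2 * e.
Proof. unfold Rabs; repeat destruct Rcase_abs; lra. Qed.

Lemma uniform_dot (G : pt -> pt) p r : 0 < r ->
  (forall x, r / 4 <= nd x p <= 2 * r -> contat G x /\ G x <> x) ->
  exists eta, 0 < eta /\ forall x y, r / 4 <= nd x p <= 2 * r -> r / 4 <= nd y p <= 2 * r -> nd x y < eta ->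
    0 < dot (psub x (G x)) (psub y (G y)).
Proof.
  intros Hr H. apply NNPP; intros Q.
  assert (C : forall n : nat, exists q : pt * pt, (r / 4 <= nd (fst q) p <= 2 * r) /\ (r / 4 <= nd (snd q) p <= 2 * r) /\
     nd (snd q) (fst q) <= / INR (S n) /\ dot (psub (fst q) (G (fst q))) (psub (snd q) (G (snd q))) <= 0).
  { intros n. apply NNPP; intros Q'. apply Q. exists (/ INR (S n)). split.
    { apply Rinv_0_lt_compat, lt_0_INR; lia. }
    intros x y Hx Hy L. apply Rnot_le_lt; intros L'. apply Q'. exists (x, y). cbn [fst snd]. repeat split; try lra; try tauto.
    rewrite nd_sym; lra. }
  destruct (fchoice _ C) as [q Hq]. 
  destruct (BW (fun n => fst (q n)) p (2 * r)) as (s & x & Hs & Hx & Bx). { intros n; apply Hq. }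
  assert (Hy : cv (fun n => snd (q (s n))) x).
  { apply cv_near with (fun n => fst (q (s n))) (fun n => / INR (S (s n))); auto.
    apply (null_sub _ s Hs null_inv). exists O; intros; apply Hq. }
  assert (Lx : r / 4 <= nd x p). { apply cv_ge with (1 := Hx). exists O; intros; apply Hq. }
  destruct (H x ltac:(lra)) as [Cx Nx].
  pose proof (contat_cv _ _ _ Cx Hx) as GX. pose proof (contat_cv _ _ _ Cx Hy) as GY.
  set (d := nd x (G x)). assert (Hd : 0 < d) by (apply nd_neq; auto).
  (* Every coordinate of the two displacements is within [2 * e] of its limit, so their inner
     product stays above [d^2 - 8 * e * d], which is half of [d^2]. *)
  set (e := d / 16). assert (He : 0 < e) by (unfold e; lra).
  destruct (ev_ex _ (ev_and _ _ (ev_and _ _ (Hx e He) (Hy e He)) (ev_and _ _ (GX e He) (GY e He)))) as [n [[A1 A2] [A3 A4]]].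
  destruct (Hq (s n)) as (_ & _ & _ & L).
  apply nd_lt in A1, A2, A3, A4. destruct A1 as [a1 b1], A2 as [a2 b2], A3 as [a3 b3], A4 as [a4 b4].
  set (u := fst (q (s n))) in *. set (v := snd (q (s n))) in *.
  unfold dot, psub in L; simpl in L.
  set (w1 := fst x - fst (G x)) in *. set (w2 := snd x - snd (G x)) in *.
  assert (D : d <= Rabs w1 \/ d <= Rabs w2).
  { unfold d, nd. fold w1 w2. unfold Rmax; destruct Rle_dec; lra. }
  assert (U : Rabs w1 <= d /\ Rabs w2 <= d). { apply nd_le. unfold d; lra. }
  assert (E1 : Rabs (fst u - fst (G u) - w1) < 2 * e). { apply Rabs_diff2; auto. }
  assert (E2 : Rabs (snd u - snd (G u) - w2) < 2 * e). { apply Rabs_diff2; auto. }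
  assert (E3 : Rabs (fst v - fst (G v) - w1) < 2 * e). { apply Rabs_diff2; auto. }
  assert (E4 : Rabs (snd v - snd (G v) - w2) < 2 * e). { apply Rabs_diff2; auto. }
  clear - L D U E1 E2 E3 E4 Hd.
  set (p1 := fst u - fst (G u)) in *. set (p2 := snd u - snd (G u)) in *.
  set (q1 := fst v - fst (G v)) in *. set (q2 := snd v - snd (G v)) in *.
  assert (F : forall a b w, Rabs (a - w) < 2 * e -> Rabs (b - w) < 2 * e -> Rabs w <= d -> w * w - 4 * e * d <= a * b).
  { clear - Hd. intros a b w A B W. unfold e in *. unfold Rabs in *; repeat destruct Rcase_abs; nra. }
  pose proof (F _ _ _ E1 E3 (proj1 U)) as F1. pose proof (F _ _ _ E2 E4 (proj2 U)) as F2.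
  assert (d * d <= w1 * w1 + w2 * w2).
  { destruct D as [D|D]; unfold Rabs in D; destruct Rcase_abs in D; nra. }
  unfold e in *. nra.
Qed.

Lemma mix_cpath s g h : cpath g -> cpath h -> cpath (fun t => mixp s (g t) (h t)).
Proof.
  intros [A B] [C D]. split; unfold mixp; simpl.
  - apply (continuity_plus (fun t => (1 - s) * fst (g t)) (fun t => s * fst (h t))).
    apply (continuity_scal (fun t => fst (g t))); auto. apply (continuity_scal (fun t => fst (h t))); auto.
  - apply (continuity_plus (fun t => (1 - s) * snd (g t)) (fun t => s * snd (h t))).
    apply (continuity_scal (fun t => snd (g t))); auto. apply (continuity_scal (fun t => snd (h t))); auto.
Qed.

Lemma cpath_clamp g : cpath g -> cpath (fun t => g (clamp 0 1 t)).
Proof.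
  intros [A B]. split.
  - apply (continuity_comp (clamp 0 1) (fun t => fst (g t))); auto using clamp_cont.
  - apply (continuity_comp (clamp 0 1) (fun t => snd (g t))); auto using clamp_cont.
Qed.

Lemma cpath_psub (G : pt -> pt) x : cpath x -> (forall t, contat G (x t)) -> cpath (fun t => psub (x t) (G (x t))).
Proof.
  intros [A B] H.
  assert (C : cpath (fun t => G (x t))).
  { assert (P : forall t e, 0 < e -> exists d, 0 < d /\ forall u, Rabs (u - t) < d -> nd (G (x t)) (G (x u)) < e).
    { intros t e He. destruct (H t e He) as (d & Hd & K).
      destruct (A t d Hd) as (d1 & H1 & K1). destruct (B t d Hd) as (d2 & H2 & K2).
      exists (Rmin d1 d2). split; [apply Rmin_glb_lt; auto|]. intros u Hu.
      pose proof (Rmin_l d1 d2). pose proof (Rmin_r d1 d2).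
      destruct (Req_dec t u) as [->|N]. { rewrite nd_refl; auto. }
      apply K. rewrite nd_sym. apply nd_lt; split.
      - apply (K1 u). split; [split; [exact I|auto]|]. simpl. unfold Rdist, R_dist. lra.
      - apply (K2 u). split; [split; [exact I|auto]|]. simpl. unfold Rdist, R_dist. lra. }
    split; intros t e He; destruct (P t e He) as (d & Hd & K); exists d; (split; [auto|]);
      intros u [_ Hu]; simpl in *; unfold Rdist, R_dist in *; specialize (K u Hu);
      rewrite nd_sym in K; apply nd_lt in K; tauto. }
  destruct C as [C D]. split; unfold psub; simpl.
  - apply (continuity_minus (fun t => fst (x t)) (fun t => fst (G (x t)))); auto.
  - apply (continuity_minus (fun t => snd (x t)) (fun t => snd (G (x t)))); auto.
Qed.

Lemma winding_ext g g' k : (forall t, 0 <= t <= 1 -> g t = g' t) -> winding_number g k -> winding_number g' k.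
Proof.
  intros E (C & Hc & Hn & th & Ct & L & D). split; [|split; [|split]].
  - intros t Ht e He. destruct (C t Ht e He) as (d & Hd & K). exists d; split; auto.
    intros s Hs Hst. rewrite <- !E by auto. auto.
  - rewrite <- !E by lra. auto.
  - intros t Ht. rewrite <- E by auto. auto.
  - exists th. split; [|split]; auto. intros t Ht. rewrite <- !E by auto. auto.
Qed.

Lemma winding_sq_circ (G : pt -> pt) p rho r k : 0 < r -> r / 2 <= rho <= r ->
  (forall x, r / 4 <= nd x p <= 2 * r -> contat G x /\ G x <> x) ->
  winding_number (fun t => psub (sq p rho t) (G (sq p rho t))) k ->
  winding_number (fun t => psub (circ p r t) (G (circ p r t))) k.
Proof.
  intros Hr Hrho HG W. destruct (uniform_dot G p r Hr HG) as (eta & He & Hu).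
  (* Square and circle differ by at most [2 * r] in each coordinate, so one of M equal steps of the
     linear homotopy moves each point by less than [eta]. *)
  destruct (archimed_cor1 (eta / (4 * r + 1)) ltac:(apply Rdiv_lt_0_compat; lra)) as [M [HM M0]].
  assert (HMp : 0 < INR M) by (apply lt_0_INR; lia).
  set (X := fun (i : nat) t => mixp (INR i / INR M) (sq p rho (clamp 0 1 t)) (circ p r (clamp 0 1 t))).
  assert (HX : forall i t, (i <= M)%nat -> r / 4 <= nd (X i t) p <= 2 * r).
  { intros i t Hi. apply mix_annulus; auto. apply clamp_in; lra.
    split. apply Rmult_le_pos; [apply pos_INR|left; apply Rinv_0_lt_compat; auto].
    apply (Rmult_le_reg_r (INR M)); auto. unfold Rdiv. rewrite Rmult_assoc, Rinv_l, Rmult_1_r, Rmult_1_l by lra.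
    apply le_INR; auto. }
  assert (CX : forall i, (i <= M)%nat -> cpath (fun t => psub (X i t) (G (X i t)))).
  { intros i Hi. apply cpath_psub.
    - unfold X. apply (cpath_clamp (fun t => mixp (INR i / INR M) (sq p rho t) (circ p r t))).
      apply mix_cpath. apply sq_cpath. apply circ_cpath.
    - intros t. apply HG. auto. }
  assert (Cl : forall i, X i 0 = X i 1).
  { intros i. unfold X. rewrite !clamp_id by lra. rewrite sq_closed. f_equal. unfold circ.
    replace (2 * PI * 1) with (2 * PI) by ring. replace (2 * PI * 0) with 0 by ring.
    now rewrite cos_2PI, sin_2PI, cos_0, sin_0. }
  assert (D : forall i, (i <= M)%nat -> winding_number (fun t => psub (X i t) (G (X i t))) k).
  { induction i as [|i IH]; intros Hi.
    - apply winding_ext with (2 := W). intros t Ht. unfold X. rewrite clamp_id by auto.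
      replace (INR 0 / INR M) with 0 by (simpl; field; lra).
      replace (mixp 0 (sq p rho t) (circ p r t)) with (sq p rho t); auto.
      unfold mixp. rewrite (surjective_pairing (sq p rho t)) at 1. f_equal; ring.
    - apply winding_close with (5 := IH ltac:(lia)); try (apply CX; lia).
      + rewrite Cl; auto.
      + intros t Ht. apply Hu; try (apply HX; lia).
        pose proof (sq_sides p rho (clamp 0 1 t) (clamp_in 0 1 t ltac:(lra)) ltac:(lra)) as [A _].
        pose proof (nd_circ p r (clamp 0 1 t) ltac:(lra)) as B. apply nd_le in A, B.
        assert (E : INR (S i) / INR M = INR i / INR M + / INR M) by (rewrite S_INR; field; lra).
        assert (F : / INR M * (4 * r + 1) < eta).
        { apply (Rmult_lt_compat_r (4 * r + 1)) in HM; [|lra].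
          replace (eta / (4 * r + 1) * (4 * r + 1)) with eta in HM by (field; lra). auto. }
        assert (0 < / INR M) by (apply Rinv_0_lt_compat; auto).
        unfold X. rewrite E. apply nd_lt. unfold mixp; cbn [fst snd].
        destruct A as [A1 A2], B as [B1 B2].
        set (mu := / INR M) in *. set (la := INR i / INR M) in *.
        set (x := sq p rho (clamp 0 1 t)) in *. set (y := circ p r (clamp 0 1 t)) in *.
        replace ((1 - la) * fst x + la * fst y - ((1 - (la + mu)) * fst x + (la + mu) * fst y)) with (mu * ((fst x - fst p) - (fst y - fst p))) by ring.
        replace ((1 - la) * snd x + la * snd y - ((1 - (la + mu)) * snd x + (la + mu) * snd y)) with (mu * ((snd x - snd p) - (snd y - snd p))) by ring.
        rewrite !Rabs_mult, !(Rabs_pos_eq mu) by lra.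
        assert (Rabs ((fst x - fst p) - (fst y - fst p)) <= 2 * r) by (unfold Rabs in *; repeat destruct Rcase_abs; lra).
        assert (Rabs ((snd x - snd p) - (snd y - snd p)) <= 2 * r) by (unfold Rabs in *; repeat destruct Rcase_abs; lra).
        split; nra. }
  apply winding_ext with (2 := D M (le_n M)). intros t Ht. unfold X. rewrite clamp_id by auto.
  replace (INR M / INR M) with 1 by (field; lra).
  replace (mixp 1 (sq p rho t) (circ p r t)) with (circ p r t); auto.
  unfold mixp. rewrite (surjective_pairing (circ p r t)) at 1. f_equal; ring.
Qed.

Module Grid.
From mathcomp Require Import all_boot all_algebra finfield.
From mathcomp Require Import zify ssrZ ring.
Set Implicit Arguments. Unset Strict Implicit. Unset Printing Implicit Defensive.
Import GRing.Theory.

Local Open Scope ring_scope.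

(** * Traces of chain maps *)

Lemma mx_addE m n (A B : 'M[Z]_(m, n)) i j : (A + B) i j = A i j + B i j.
Proof. by rewrite mxE. Qed.
Lemma mx_subE m n (A B : 'M[Z]_(m, n)) i j : (A - B) i j = A i j - B i j.
Proof. by rewrite !mxE. Qed.

Section Proj.
Variable n : nat.
Implicit Types (A : pred 'I_n).

Definition pj A : 'M[Z]_n := \matrix_(i, j) ((i == j) && A i)%:R.

Lemma mul_pjl A m (X : 'M[Z]_(n, m)) i j : (pj A *m X) i j = (A i)%:R * X i j.
Proof.
rewrite mxE (bigD1 i) //= big1 ?addr0; first by rewrite mxE eqxx.
by move=> k /negPf ki; rewrite mxE eq_sym ki mul0r.
Qed.

Lemma mul_pjr A m (X : 'M[Z]_(m, n)) i j : (X *m pj A) i j = X i j * (A j)%:R.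
Proof.
rewrite mxE (bigD1 j) //= big1 ?addr0; first by rewrite mxE eqxx.
by move=> k /negPf kj; rewrite mxE kj mulr0.
Qed.

Lemma pj_idem A : pj A *m pj A = pj A.
Proof. by apply/matrixP=> i j; rewrite mul_pjl mxE; case: (A i); rewrite ?andbF ?mul0r ?mul1r. Qed.

Lemma pjC A : pj (predC A) = 1%:M - pj A.
Proof. by apply/matrixP=> i j; rewrite !mxE /=; case: (i == j); case: (A i); rewrite ?subrr ?subr0. Qed.

Lemma pj_expl A (X : 'M[Z]_n) k : pj A *m X *m pj A = X *m pj A ->
  X ^+ k *m pj A = (pj A *m X *m pj A) ^+ k *m pj A.
Proof.
move=> H; elim: k => [|k IH]; first by rewrite !expr0.
rewrite !exprSr -!mulmxE -[LHS]mulmxA -H mulmxA mulmxA IH -!mulmxA pj_idem.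
by [].
Qed.

Lemma pj_expr A (X : 'M[Z]_n) k : pj A *m X *m pj A = pj A *m X ->
  pj A *m X ^+ k = pj A *m (pj A *m X *m pj A) ^+ k.
Proof.
move=> H; elim: k => [|k IH]; first by rewrite !expr0.
rewrite !exprS -!mulmxE [LHS]mulmxA -H -[LHS]mulmxA IH !mulmxA pj_idem -(mulmxA _ (pj A) (pj A)) pj_idem.
by [].
Qed.

(* [X] maps the complement of [A] into itself, so it is block triangular. *)
Lemma trace_block A (X : 'M[Z]_n) k : pj (predC A) *m X *m pj A = 0 ->
  \tr (X ^+ k.+1) = \tr ((pj A *m X *m pj A) ^+ k.+1) +
                    \tr ((pj (predC A) *m X *m pj (predC A)) ^+ k.+1).
Proof.
move=> H0; set P := pj A; set Q := pj _.
have PQ : P + Q = 1%:M by rewrite /P /Q pjC addrC subrK.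
have H1 : P *m X *m P = X *m P.
  by rewrite -[in RHS](mul1mx X) -PQ mulmxDl mulmxDl H0 addr0.
have H2 : Q *m X *m Q = Q *m X.
  by rewrite -[in RHS](mulmx1 (Q *m X)) -PQ mulmxDr H0 add0r.
have tP Y : \tr (Y ^+ k.+1) = \tr (Y ^+ k.+1 *m P) + \tr (Q *m Y ^+ k.+1).
  by rewrite (mxtrace_mulC Q) -raddfD -mulmxDr PQ mulmx1.
rewrite tP (pj_expl _ H1) (pj_expr _ H2).
congr (_ + _).
  by rewrite exprSr -mulmxE -!mulmxA pj_idem.
by rewrite exprS -mulmxE !mulmxA pj_idem.
Qed.

(** Chains are row vectors and maps act from the right, so products of matrices compose from left to
    right. *)
Definition fmx (a : 'I_n -> 'I_n) : 'M[Z]_n := \matrix_(i, j) (j == a i)%:R.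

Lemma mul_fmx a m (X : 'M[Z]_(n, m)) i j : (fmx a *m X) i j = X (a i) j.
Proof.
rewrite mxE (bigD1 (a i)) //= big1 ?addr0; first by rewrite mxE eqxx mul1r.
by move=> k /negPf ki; rewrite mxE ki mul0r.
Qed.

End Proj.

(** * Lefschetz numbers on a two-dimensional complex contracted to a vertex *)

Section Complex.
Variables (v e s : nat).
Variables (d1 : 'M[Z]_(e, v)) (d2 : 'M[Z]_(s, e)) (h0 : 'M[Z]_(v, e)) (h1 : 'M[Z]_(e, s)).
Variable v0 : 'I_v.
Hypothesis d21 : d2 *m d1 = 0.
Hypothesis hh0 : h0 *m d1 = 1%:M - \matrix_(i, j) (j == v0)%:R.
Hypothesis hh1 : h1 *m d2 + d1 *m h0 = 1%:M.
Hypothesis hh2 : d2 *m h1 = 1%:M.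

Definition chain_map (F0 : 'M[Z]_v) (F1 : 'M[Z]_e) := F1 *m d1 = d1 *m F0.

Lemma h1d2 : h1 *m d2 = 1%:M - d1 *m h0. Proof. by rewrite -hh1 addrK. Qed.

(** [d2] is injective with one-sided inverse [h1], so a chain map has no freedom in degree two: it
    must be [d2 *m F1 *m h1]. *)
Lemma chain_map2 F0 F1 : chain_map F0 F1 -> (d2 *m F1 *m h1) *m d2 = d2 *m F1.
Proof.
move=> H; rewrite -mulmxA h1d2 mulmxBr mulmx1 !mulmxA -(mulmxA d2 F1) H !mulmxA d21 !mul0mx.
by rewrite subr0.
Qed.

Lemma chain_map_exp F0 F1 k : chain_map F0 F1 -> chain_map (F0 ^+ k) (F1 ^+ k).
Proof.
move=> H; elim: k => [|k IH]; first by rewrite /chain_map !expr0 mul1mx mulmx1.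
by rewrite /chain_map !exprS -!mulmxE -mulmxA IH !mulmxA H.
Qed.

Lemma chain_exp2 F0 F1 k : chain_map F0 F1 -> (d2 *m F1 *m h1) ^+ k = d2 *m F1 ^+ k *m h1.
Proof.
move=> H; elim: k => [|k IH]; first by rewrite !expr0 mulmx1.
by rewrite !exprS -!mulmxE IH !mulmxA (chain_map2 H).
Qed.

(** The Hopf trace formula: the contraction pairs the contributions of adjacent degrees, and only
    the vertex [v0], weighted by row sums 1, remains. *)
Lemma alt_trace F0 F1 : chain_map F0 F1 -> (forall i, \sum_j F0 i j = 1) ->
  \tr F0 - \tr F1 + \tr (d2 *m F1 *m h1) = 1.
Proof.
move=> H R.
have E1 : \tr F1 = \tr (d2 *m F1 *m h1) + \tr (F0 *m h0 *m d1).
  rewrite -[in LHS](mulmx1 F1) -hh1 mulmxDr raddfD /=; congr (_ + _).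
    by rewrite mulmxA mxtrace_mulC mulmxA.
  by rewrite mulmxA H -mulmxA mxtrace_mulC.
have E0 : \tr F0 = \tr (F0 *m h0 *m d1) + 1.
  rewrite -mulmxA hh0 mulmxBr mulmx1 raddfB /=; set c := \matrix_(_, _) _.
  suff -> : \tr (F0 *m c) = 1 by rewrite subrK.
  rewrite /mxtrace (bigD1 v0) //= big1 ?addr0.
    by rewrite mxE -[RHS](R v0); apply: eq_bigr => j _; rewrite mxE eqxx mulr1.
  by move=> i /negPf iv; rewrite mxE big1 // => j _; rewrite mxE iv mulr0.
rewrite E0 E1; lia.
Qed.

Lemma rowsum_exp (F0 : 'M[Z]_v) k : (forall i, \sum_j F0 i j = 1) -> forall i, \sum_j (F0 ^+ k) i j = 1.
Proof.
move=> R; elim: k => [|k IH] i.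
  rewrite expr0 (bigD1 i) //= big1 ?addr0 ?mxE ?eqxx // => j /negPf ji.
  by rewrite mxE eq_sym ji.
rewrite exprS -mulmxE.
under eq_bigr do rewrite mxE.
rewrite exchange_big /= -[RHS](R i); apply: eq_bigr => j _.
by rewrite -mulr_sumr IH mulr1.
Qed.

(* Exit sets: [F] is replaced by the vertex map [psi] on the subcomplex L; [K i] is a chain of L
   from [a i] to [psi i], which repairs the boundary of [F1] next to L. *)
Section Exit.
Variables (LV : pred 'I_v) (LE : pred 'I_e) (LS : pred 'I_s).
Variables (a psi : 'I_v -> 'I_v) (F1 : 'M[Z]_e) (K : 'M[Z]_(v, e)).
Let psi' i := if LV i then psi i else a i.
Let F0 := fmx a.
Let F2 := d2 *m F1 *m h1.
Let PV := pj (predC LV).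
Let PE := pj (predC LE).
Let PS := pj (predC LS).
Hypothesis chF : chain_map F0 F1.
Hypothesis psiL : forall i, LV i -> LV (psi i).
Hypothesis psiE : forall i, LE i -> forall j, (d1 *m fmx psi') i j = 0.
Hypothesis LSE : forall i j, LS i -> d2 i j != 0 -> LE j.
Hypothesis KE : forall i j, K i j != 0 -> LE j.
Hypothesis Kbd : forall i j k, ~~ LE i -> d1 i j != 0 -> (F0 + K *m d1) j k = fmx psi' j k.
Hypothesis frontE : forall i j k, ~~ LS i -> d2 i j != 0 -> LE j -> F1 j k != 0 -> LE k.
Hypothesis cyc_const : forall z : 'rV[Z]_e, z *m d1 = 0 -> (forall j, z 0 j != 0 -> LE j) ->
  exists t, forall i, ~~ LS i -> (z *m h1) 0 i = t.

Let G0 := fmx psi'.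
(** In degree one the modified map kills the edges of L, along which psi is constant, and elsewhere
    repairs the ends by the chains [K]. *)
Let G1 := PE *m (F1 + d1 *m K).
Let G2 := d2 *m G1 *m h1.

Let chG : chain_map G0 G1.
Proof.
rewrite /chain_map /G1 -mulmxA mulmxDl chF -mulmxA -mulmxDr.
apply/matrixP=> i j; rewrite mul_pjl /=; case Li : (LE i).
  by rewrite mul0r psiE.
rewrite mul1r !mxE; apply: eq_bigr => k _.
case: (eqVneq (d1 i k) 0) => [->|nz]; first by rewrite !mul0r.
by rewrite (Kbd _ _ nz) ?Li.
Qed.

Let G1L i j : LE i -> G1 i j = 0.
Proof. by move=> L; rewrite /G1 mul_pjl /= L mul0r. Qed.

Let G2L i j : LS i -> G2 i j = 0.
Proof.
move=> L; rewrite /G2 mxE big1 // => k _; rewrite mxE big1 ?mul0r // => l _.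
case: (eqVneq (d2 i l) 0) => [->|nz]; first by rewrite mul0r.
by rewrite G1L ?mulr0 //; apply: LSE nz.
Qed.

Let KP : K *m PE = 0.
Proof.
apply/matrixP=> i j; rewrite mul_pjr mxE /=.
case: (eqVneq (K i j) 0) => [->|nz]; first by rewrite mul0r.
by rewrite (KE nz) mulr0.
Qed.

Let trunc1 : PE *m G1 *m PE = PE *m F1 *m PE.
Proof. by rewrite /G1 !mulmxA pj_idem mulmxDr mulmxDl !mulmxA -(mulmxA _ K) KP mulmx0 addr0. Qed.

Let trunc0 : PV *m G0 *m PV = PV *m F0 *m PV.
Proof.
apply/matrixP=> i j; rewrite !mul_pjr !mul_pjl /G0 /F0 !mxE /psi' /=.
by case: (LV i); rewrite ?mul0r.
Qed.

(** The images of the boundary of square i under the modified and the original map differ by this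
    cycle. For a square off L it is carried by L, and [h1] turns it into the difference of the two
    maps in degree two. *)
Let z_ i : 'rV[Z]_e := row i (d2 *m G1 - d2 *m F1).

Let z_cyc i : z_ i *m d1 = 0.
Proof.
rewrite /z_ -row_mul mulmxBl -(mulmxA d2 G1) -(mulmxA d2 F1) chG chF 2!(mulmxA d2 d1) d21 !mul0mx subr0.
by apply/rowP=> j; rewrite !mxE.
Qed.

Let z_supp i j : ~~ LS i -> z_ i 0 j != 0 -> LE j.
Proof.
move=> Li; apply: contraR => Lj; apply/eqP; rewrite /z_ !mxE.
rewrite -sumrB big1 // => k _; rewrite -mulrBr.
case: (eqVneq (d2 i k) 0) => [->|nz]; first by rewrite mul0r.
rewrite /G1 mul_pjl /= mx_addE.
have -> : (d1 *m K) k j = 0.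
  rewrite mxE big1 // => l _; case: (eqVneq (K l j) 0) => [->|nz2]; first by rewrite mulr0.
  by move: Lj; rewrite (KE nz2).
case Lk : (LE k) => /=; last by rewrite mul1r addr0 subrr mulr0.
case: (eqVneq (F1 k j) 0) => [->|nz2]; first by rewrite mul0r subr0 mulr0.
by move: Lj; rewrite (frontE Li nz Lk nz2).
Qed.

Let zh i j : (z_ i *m h1) 0 j = G2 i j - F2 i j.
Proof. by rewrite /z_ -row_mul mulmxBl mxE mx_subE. Qed.

Let fixpts n : \tr ((pj (predC (predC LV)) *m G0 *m pj (predC (predC LV))) ^+ n.+1) =
  #|[pred i | LV i && (iter n.+1 psi i == i)]|%:R.
Proof.
have E k i j : LV i -> ((pj (predC (predC LV)) *m G0 *m pj (predC (predC LV))) ^+ k) i j = (j == iter k psi i)%:R.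
  elim: k i j => [|k IH] i j Li; first by rewrite expr0 mxE eq_sym.
  rewrite exprS -mulmxE mxE (bigD1 (psi i)) //= big1 ?addr0 => [|l /negPf lp].
    by rewrite mul_pjr mul_pjl /= !negbK Li psiL // mxE /psi' Li eqxx !mul1r IH ?psiL // -iterSr.
  by rewrite mul_pjr mul_pjl mxE /psi' Li lp mulr0 !mul0r.
have E' i j : ~~ LV i -> ((pj (predC (predC LV)) *m G0 *m pj (predC (predC LV))) ^+ n.+1) i j = 0.
  by move=> Li; rewrite exprS -mulmxE mxE big1 // => l _; rewrite mul_pjr mul_pjl /= negbK (negPf Li) !mul0r.
rewrite -sum1_card natr_sum [in RHS]big_mkcond /mxtrace; apply: eq_bigr => i _ /=.
case Li : (LV i); last by rewrite E' ?Li // unfold_in /= Li.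
by rewrite E ?Li // eq_sym unfold_in /= Li /=; case: (psi _ == _).
Qed.

(** The Lefschetz number 1 of the modified map, with each trace split along L. The L part is zero in
    degrees one and two and counts fixed points of psi in degree zero. *)
Lemma exit_trace_G n :
  \tr ((PV *m F0 *m PV) ^+ n.+1) - \tr ((PE *m F1 *m PE) ^+ n.+1) + \tr ((PS *m G2 *m PS) ^+ n.+1)
  = 1 - #|[pred i | LV i && (iter n.+1 psi i == i)]|%:R.
Proof.
have R i : \sum_j G0 i j = 1.
  rewrite (bigD1 (psi' i)) //= big1 ?addr0; first by rewrite mxE eqxx.
  by move=> j /negPf ji; rewrite mxE ji.
have := alt_trace (chain_map_exp n.+1 chG) (rowsum_exp n.+1 R).
rewrite -(chain_exp2 _ chG) -/G2.
rewrite (@trace_block _ (predC LV) G0); last first.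
  apply/matrixP=> i j; rewrite mul_pjr mul_pjl !mxE /= negbK /psi'.
  case Li : (LV i); last by rewrite !mul0r.
  case: eqP => [->|_]; last by rewrite mulr0 mul0r.
  by rewrite psiL // mulr0.
rewrite (@trace_block _ (predC LE) G1); last first.
  apply/matrixP=> i j; rewrite mul_pjr mul_pjl [RHS]mxE /= negbK.
  by case Li : (LE i); [rewrite G1L // mulr0 mul0r | rewrite !mul0r].
rewrite (@trace_block _ (predC LS) G2); last first.
  apply/matrixP=> i j; rewrite mul_pjr mul_pjl [RHS]mxE /= negbK.
  by case Li : (LS i); [rewrite G2L // mulr0 mul0r | rewrite !mul0r].
have -> : \tr ((pj (predC (predC LE)) *m G1 *m pj (predC (predC LE))) ^+ n.+1) = 0.
  rewrite (_ : _ *m _ *m _ = 0) ?exprS ?mul0r ?raddf0 //.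
  apply/matrixP=> i j; rewrite mul_pjr mul_pjl [RHS]mxE /= negbK.
  by case Li : (LE i); [rewrite G1L // mulr0 mul0r | rewrite !mul0r].
have -> : \tr ((pj (predC (predC LS)) *m G2 *m pj (predC (predC LS))) ^+ n.+1) = 0.
  rewrite (_ : _ *m _ *m _ = 0) ?exprS ?mul0r ?raddf0 //.
  apply/matrixP=> i j; rewrite mul_pjr mul_pjl [RHS]mxE /= negbK.
  by case Li : (LS i); [rewrite G2L // mulr0 mul0r | rewrite !mul0r].
rewrite fixpts -/PV -/PE -/PS trunc0 trunc1; lia.
Qed.

(** By [cyc_const] each row of the correction is constant on the squares off L, so the whole
    correction is an outer product with the row of ones. *)
Let rank1 : exists t : 'cV[Z]_s, PS *m G2 *m PS = PS *m F2 *m PS + t *m (\row_i (~~ LS i)%:R).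
Proof.
have H i : exists t, ~~ LS i -> forall k, ~~ LS k -> (z_ i *m h1) 0 k = t.
  case Li : (LS i); first by exists 0.
  by have [t Ht] := cyc_const (z_cyc i) (@z_supp i ^~ (negbT Li)); exists t.
have [t Ht] := fin_all_exists H.
exists (\col_i ((~~ LS i)%:R * t i)).
apply/matrixP=> i j; rewrite mx_addE !mul_pjr !mul_pjl [X in _ + X]mxE big_ord1 [X in _ + X * _]mxE [X in _ + _ * X]mxE /=.
case Li : (LS i); first by rewrite !mul0r addr0.
case Lj : (LS j); first by rewrite !mulr0 addr0.
have := Ht i (negbT Li) j (negbT Lj); rewrite zh => <-.
by rewrite !mul1r !mulr1 [RHS]addrC subrK.
Qed.

Lemma exit_trace_touch n :
  (forall z : 'rV[Z]_e, z *m d1 = 0 -> (forall j, z 0 j != 0 -> LE j) ->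
     forall i, ~~ LS i -> (z *m h1) 0 i = 0) ->
  \tr ((PV *m F0 *m PV) ^+ n.+1) - \tr ((PE *m F1 *m PE) ^+ n.+1) + \tr ((PS *m F2 *m PS) ^+ n.+1)
  = 1 - #|[pred i | LV i && (iter n.+1 psi i == i)]|%:R.
Proof.
move=> H0; rewrite -(exit_trace_G n).
suff -> : PS *m G2 *m PS = PS *m F2 *m PS by [].
apply/matrixP=> i j; rewrite !mul_pjr !mul_pjl /=.
case Li : (LS i); first by rewrite !mul0r.
case Lj : (LS j); first by rewrite !mulr0.
have := H0 _ (z_cyc i) (@z_supp i ^~ (negbT Li)) j (negbT Lj); rewrite zh => /eqP.
by rewrite subr_eq0 => /eqP ->.
Qed.

(** The sum [one] of the squares off L is a cycle modulo L, so [one *m Y = 0] and [one] is an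
    eigenvector of X with eigenvalue -d. The zero column of [X ^+ N] forces d = 0, after which the
    rank-one term contributes no trace to any power. *)
Lemma exit_trace_inner n N (q : 'I_s) :
  (forall j, ~~ LE j -> \sum_(i | ~~ LS i) d2 i j = 0) -> ~~ LS q ->
  (forall i, ((PS *m F2 *m PS) ^+ N) i q = 0) ->
  \tr ((PV *m F0 *m PV) ^+ n.+1) - \tr ((PE *m F1 *m PE) ^+ n.+1) + \tr ((PS *m F2 *m PS) ^+ n.+1)
  = 1 - #|[pred i | LV i && (iter n.+1 psi i == i)]|%:R.
Proof.
move=> Hd Lq HN; rewrite -(exit_trace_G n).
have [t Ht] := rank1; set one := \row_ _ _ in Ht.
set X := PS *m F2 *m PS in HN Ht *; set Y := PS *m G2 *m PS in Ht *.
have oneP : one *m PS = one.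
  by apply/matrixP=> i j; rewrite mul_pjr !mxE /=; case: (LS j).
have oneY : one *m Y = 0.
  suff oG : one *m G2 = 0 by rewrite /Y (mulmxA one) (mulmxA one) oneP oG mul0mx.
  rewrite /G2 (mulmxA one) (mulmxA one); apply/matrixP=> i j.
  rewrite mxE big1 ?mxE // => k _.
  rewrite mxE big1 ?mul0r // => l _.
  case Ll : (LE l); first by rewrite G1L ?mulr0.
  suff -> : (one *m d2) i l = 0 by rewrite mul0r.
  rewrite mxE -[RHS](Hd l (negbT Ll)) [in RHS]big_mkcond; apply: eq_bigr => m _.
  by rewrite mxE; case: (LS m); rewrite ?mul0r ?mul1r.
set d := (one *m t) 0 0.
have oneX : one *m X = (- d) *: one.
  have := oneY; rewrite Ht mulmxDr mulmxA => /eqP; rewrite addr_eq0 => /eqP ->.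
  by rewrite [one *m t]mx11_scalar mul_scalar_mx scaleNr.
have oneXk k : one *m X ^+ k = (- d) ^+ k *: one.
  elim: k => [|k IH]; first by rewrite !expr0 mulmx1 scale1r.
  by rewrite exprS -mulmxE mulmxA oneX -scalemxAl IH scalerA -exprS.
have d0 : d = 0.
  have := oneXk N => /matrixP /(_ 0 q); rewrite [RHS]mxE [X in _ = _ * X]mxE (negPf Lq) mulr1.
  rewrite mxE big1 => [|i _]; last by rewrite HN mulr0.
  move/esym => /eqP; clear; elim: N => [|N IH]; first by rewrite expr0.
  by rewrite exprS mulf_eq0 oppr_eq0 => /orP [/eqP|/IH].
have X0 : one *m X = 0 by rewrite oneX d0 oppr0 scale0r.
have t0 : one *m t = 0 by rewrite [one *m t]mx11_scalar -/d d0; apply/matrixP=> i j; rewrite !mxE mul0rn.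
suff -> : \tr (Y ^+ n.+1) = \tr (X ^+ n.+1) by [].
have Yk k : Y ^+ k.+1 = X ^+ k.+1 + X ^+ k *m t *m one.
  elim: k => [|k IH]; first by rewrite !expr1 expr0 mul1mx.
  have z1 : X ^+ k *m t *m one *m X = 0 by rewrite -mulmxA X0 mulmx0.
  have z2 : X ^+ k *m t *m one *m (t *m one) = 0 by rewrite mulmxA -(mulmxA _ one t) t0 mulmx0 mul0mx.
  rewrite exprSr -mulmxE IH Ht mulmxDr !mulmxDl z1 z2 !addr0 mulmxA; congr (_ + _).
  by rewrite [in RHS]exprSr -mulmxE.
rewrite Yk raddfD /=.
suff -> : \tr (X ^+ n *m t *m one) = 0 by rewrite addr0.
rewrite mxtrace_mulC mulmxA oneXk d0 oppr0; case: (n) => [|k].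
  by rewrite expr0 scale1r t0 raddf0.
by rewrite exprS mul0r scale0r mul0mx raddf0.
Qed.

End Exit.
End Complex.

(** * Powers of matrices and walks *)

Section Walks.
Variable n : nat.
Implicit Types X : 'M[Z]_n.

Definition walk X (k : nat) (w : nat -> 'I_n) := forall t, (t < k)%N -> X (w t) (w t.+1) != 0.

Lemma exp_walk X k i j : (X ^+ k) i j != 0 -> exists w, [/\ w 0%N = i, w k = j & walk X k w].
Proof.
elim: k i j => [|k IH] i j.
  rewrite expr0 mxE; case: (eqVneq i j) => [-> _|//]; by exists (fun _ => j).
rewrite exprS -mulmxE mxE => nz.
have /existsP [l /andP [n1 n2]] : [exists l, (X i l != 0) && ((X ^+ k) l j != 0)].
  apply: contraNT nz; rewrite negb_exists => /forallP H; apply/eqP; apply: big1 => l _.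
  by have := H l; rewrite negb_and !negbK => /orP [/eqP ->|/eqP ->]; rewrite ?mul0r ?mulr0.
have [w [w0 wk ww]] := IH _ _ n2.
exists (fun t => if t is t'.+1 then w t' else i); split => // -[|t] ht /=; first by rewrite w0.
exact: ww.
Qed.

Lemma walk_cat X k l w w' : walk X k w -> walk X l w' -> w k = w' 0%N ->
  walk X (k + l) (fun t => if (t <= k)%N then w t else w' (t - k)%N).
Proof.
move=> H H' E t ht; case: (ltngtP t k) => tk.
- exact: H.
- rewrite subSn 1?ltnW //; apply: H'; lia.
- rewrite tk E; have -> : (k.+1 - k = 1)%N by lia.
  apply: H'; lia.
Qed.

(** Both sides are weighted counts of closed walks, based in [Om] on the left and contained in [A]
    on the right; the hypotheses say that these are the same walks. *)
Lemma trace_walk X (A Om : pred 'I_n) k :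
  (forall w, walk X k.+1 w -> w k.+1 = w 0%N -> Om (w 0%N) -> forall t, (t <= k.+1)%N -> A (w t)) ->
  (forall w, walk X k.+1 w -> w k.+1 = w 0%N -> (forall t, (t <= k.+1)%N -> A (w t)) -> Om (w 0%N)) ->
  \sum_(i | Om i) (X ^+ k.+1) i i = \tr ((pj A *m X *m pj A) ^+ k.+1).
Proof.
move=> Ha Hb; set P := pj A; set T := P *m X.
have Tw l w : walk T l w -> walk X l w.
  by move=> H t /H; apply: contraNN => /eqP E; rewrite mul_pjl E mulr0.
have TA l w : walk T l w -> forall t, (t < l)%N -> A (w t).
  by move=> H t /H; apply: contraNT => /negPf E; rewrite mul_pjl E mul0r.
(* The factors X are replaced by T one at a time; each replacement discards only closed walks from c
   through a state outside A, and there are none. *)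
have Z c m : Om c -> (m <= k.+1)%N -> (X ^+ (k.+1 - m) *m T ^+ m) c c = (X ^+ k.+1) c c.
  move=> Oc; elim: m => [|m IH] hm; first by rewrite subn0 expr0 mulmx1.
  rewrite -IH 1?ltnW //; have -> : (k.+1 - m = (k.+1 - m.+1).+1)%N by lia.
  rewrite [T ^+ _]exprS [X ^+ _.+1]exprSr -!mulmxE -(mulmxA _ X).
  apply/eqP; rewrite -subr_eq0 -mx_subE -mulmxBr mxE.
  apply/eqP; apply: big1 => x _; apply/eqP; case: eqP => // /eqP; rewrite mulf_eq0 negb_or => /andP [n1].
  rewrite mx_subE {1}/T -mulmxA mul_pjl; case Ax : (A x); first by rewrite mul1r subrr eqxx.
  rewrite mul0r sub0r oppr_eq0 mxE => nz.
  have /existsP [y /andP [n2 n3]] : [exists y, (X x y != 0) && ((T ^+ m) y c != 0)].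
    apply: contraNT nz; rewrite negb_exists => /forallP H; apply/eqP; apply: big1 => l _.
    by have := H l; rewrite negb_and !negbK => /orP [/eqP ->|/eqP ->]; rewrite ?mul0r ?mulr0.
  have [w [w0 wk ww]] := exp_walk n1.
  have [w' [w0' wk' ww']] := exp_walk n3.
  have W1 : walk X m.+1 (fun t => if t is t'.+1 then w' t' else x).
    by case=> [|t] ht /=; [rewrite w0'|apply: (Tw _ _ ww')].
  have W := walk_cat ww W1 wk.
  have E : (k.+1 - m.+1 + m.+1 = k.+1)%N by lia.
  rewrite E in W.
  have := Ha _ W; rewrite leq0n w0 => /(_ _ Oc (k.+1 - m.+1)%N).
  rewrite leqnn wk Ax => /(_ _ _)-> //; last by lia.
  have -> : (k.+1 <= k.+1 - m.+1)%N = false by lia.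
  by have -> : (k.+1 - (k.+1 - m.+1) = m.+1)%N by lia.
have PT : P *m T = T by rewrite /T mulmxA pj_idem.
have -> : \tr ((T *m P) ^+ k.+1) = \tr (T ^+ k.+1).
  have E m : (T *m P) ^+ m.+1 = T ^+ m.+1 *m P.
    elim: m => [|m IH]; first by rewrite !expr1.
    by rewrite exprSr IH -mulmxE -mulmxA (mulmxA P) PT mulmxA [in RHS]exprSr -mulmxE.
  by rewrite E mxtrace_mulC exprS -mulmxE (mulmxA P) PT.
rewrite /mxtrace [RHS](bigID Om) /= [X in _ = _ + X]big1 ?addr0.
  by apply: eq_bigr => i Oi; rewrite -(Z i k.+1 Oi) // subnn expr0 mul1mx.
move=> i Oi; apply/eqP; apply: contraNT Oi => /exp_walk [w [w0 wk ww]].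
rewrite -w0; apply: Hb; rewrite ?wk //; first exact: Tw.
move=> t; rewrite leq_eqVlt => /orP [/eqP ->|/(TA _ _ ww) //].
by rewrite wk -w0; apply: (TA _ _ ww).
Qed.

End Walks.

(** * Prime powers of matrices *)

(* In characteristic q, (X - A)^q = X^q - A^q, so A and A^q have the same characteristic
   polynomial. *)
Lemma trace_Frobenius q n (A : 'M['F_q]_n) : prime q -> \tr (A ^+ q) = \tr A.
Proof.
case: n A => [|n] A pq; first by rewrite /mxtrace !big_ord0.
have chq : q \in [pchar {poly 'F_q}] by rewrite (pchar_poly _) pchar_Fp.
have chM : q \in [pchar 'M[{poly 'F_q}]_n.+1].
  rewrite inE pq /=; apply/eqP/matrixP=> i j.
  have -> : (q%:R : 'M[{poly 'F_q}]_n.+1) = (q%:R)%:M by rewrite rmorph_nat.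
  by rewrite !mxE (pcharf0 chq) mul0rn.
set B := map_mx polyC A.
have E : (char_poly_mx A) ^+ q = ('X^q)%:M - map_mx polyC (A ^+ q).
  rewrite /char_poly_mx -/B.
  have cB : GRing.comm ('X%:M : 'M_n.+1) B by rewrite /GRing.comm -!mulmxE scalar_mxC.
  have := pFrobenius_autB_comm chM cB; rewrite !pFrobenius_autE => ->.
  by congr (_ - _); rewrite ?rmorphXn.
have P1 : (char_poly A) ^+ q = char_poly (A ^+ q) \Po 'X^q.
  have dX k (M : 'M[{poly 'F_q}]_n.+1) : \det (M ^+ k) = \det M ^+ k.
    by elim: k => [|k IH]; rewrite ?expr0 ?det1 // !exprS -mulmxE det_mulmx IH.
  rewrite /char_poly -dX E.
  have -> : \det (char_poly_mx (A ^+ q)) \Po 'X^q = \det (map_mx (comp_poly 'X^q) (char_poly_mx (A ^+ q))).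
    by rewrite det_map_mx.
  congr (\det _).
  by apply/matrixP=> i j; rewrite !mxE /= rmorphB /= rmorphMn /= comp_polyX comp_polyC.
(* The coefficients lie in the prime field and are fixed by Frobenius, which therefore moves only
   the indeterminate. *)
have P2 : (char_poly A) ^+ q = char_poly A \Po 'X^q.
  set P := char_poly A; have -> : P = \poly_(i < size P) P`_i by rewrite coefK.
  rewrite poly_def rmorph_sum /=.
  have := pFrobenius_autE chq => F.
  rewrite -F rmorph_sum /=; apply: eq_bigr => i _.
  rewrite F exprZn linearZ /= comp_Xn_poly -exprM mulnC exprM.
  congr (_ *: _).
  by rewrite -[X in _ ^+ X](card_Fp pq) expf_card.
have E' : char_poly (A ^+ q) = char_poly A.
  move: (char_poly (A ^+ q)) (char_poly A) (etrans (esym P1) P2) => P Q PQ.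
  apply/polyP=> i; have := congr1 (fun P : {poly _} => P`_(i * q)) PQ.
  have q0 := prime_gt0 pq.
  by rewrite !(coef_comp_poly_Xn _ _ q0) dvdn_mull // mulnK.
have := congr1 (fun P : {poly _} => P`_n) E'.
have T (M : 'M['F_q]_n.+1) : (char_poly M)`_n = - \tr M by exact: (char_poly_trace M (ltn0Sn n)).
rewrite (T (A ^+ q)) (T A) => H; exact: (oppr_inj H).
Qed.

Lemma trace_prime_mod q n (A : 'M[Z]_n) : prime q ->
  exists k : Z, \tr (A ^+ q) = \tr A + k * Z.of_nat q.
Proof.
move=> pq; pose ph (z : Z) : 'F_q := (int_of_Z z)%:~R.
pose PH : {rmorphism Z -> 'F_q} := intr \o int_of_Z.
have phE z : ph z = PH z by [].
have : ph (\tr (A ^+ q) - \tr A) = 0.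
  rewrite phE rmorphB -!phE.
  have tE (M : 'M[Z]_n) : ph (\tr M) = \tr (map_mx PH M).
    by rewrite phE /mxtrace rmorph_sum; apply: eq_bigr => i _; rewrite mxE.
  have eE k : map_mx PH (A ^+ k) = (map_mx PH A) ^+ k.
    elim: k => [|k IH]; first by rewrite !expr0 map_mx1.
    by rewrite !exprS -!mulmxE map_mxM IH.
  by rewrite !tE eE trace_Frobenius // subrr.
rewrite /ph; set D := _ - _ => H.
have : (q%:Z %| int_of_Z D)%Z.
  move: H; case: (intP (int_of_Z D)) => [|m|m]; first by rewrite dvdz0.
    by rewrite dvdzE /= => /eqP; rewrite -pmulrn -(dvdn_pcharf (pchar_Fp pq)).
  rewrite rmorphN /= => /eqP; rewrite oppr_eq0 dvdzE abszN /=.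
  by rewrite -pmulrn -(dvdn_pcharf (pchar_Fp pq)).
case/dvdzP => k E; exists (Z_of_int k).
have -> : \tr (A ^+ q) = \tr A + D by rewrite /D addrC subrK.
congr (_ + _).
have := congr1 Z_of_int E; rewrite int_of_ZK => ->.
by rewrite rmorphM.
Qed.

(** * The square grid *)

Notation bz := Z.b2z.

Lemma sum_ind m k (f : nat -> Z) : \sum_(i < m) bz (i == k :> nat) * f i = if (k < m)%N then f k else 0.
Proof.
case: ifP => [hk|hk].
  rewrite (bigD1 (Ordinal hk)) //= eqxx big1 ?addr0 => [|i].
    by rewrite -[bz true]/(1 : Z) mul1r.
  by rewrite -val_eqE /= => /negPf ->; rewrite -[bz false]/(0 : Z) mul0r.
rewrite big1 // => i _; case: eqP => [E|_]; last by rewrite -[bz false]/(0 : Z) mul0r.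
by move: hk; rewrite -E ltn_ord.
Qed.

Lemma sum_ind2 m m' k l (f : nat -> nat -> Z) :
  \sum_(i < m) \sum_(j < m') bz ((i == k :> nat) && (j == l :> nat)) * f i j
  = if (k < m)%N && (l < m')%N then f k l else 0.
Proof.
transitivity (\sum_(i < m) bz (i == k :> nat) * (if (l < m')%N then f i l else 0)).
  apply: eq_bigr => i _; rewrite -(sum_ind m' l (f i)) mulr_sumr; apply: eq_bigr => j _.
  by rewrite mulrA; congr (_ * _); case: (_ == _); case: (_ == _).
by rewrite (sum_ind m k (fun i => if (l < m')%N then f i l else 0)); case: ifP.
Qed.

Section Grid.
Variable m : nat.
(** The number of squares per side, in successor form so that the index types are inhabited and
    [inord] applies. *)
Let n := m.+1.

Definition Vt := ('I_n.+1 * 'I_n.+1)%type.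
Definition Et := ('I_n * 'I_n.+1 + 'I_n.+1 * 'I_n)%type.
Definition St := ('I_n * 'I_n)%type.

Definition vv (v : Vt) : nat * nat := (val v.1, val v.2).
Definition ss (s : St) : nat * nat := (val s.1, val s.2).
(* Edges by direction (true: horizontal) and lower left end. *)
Definition ee (e : Et) : bool * (nat * nat) :=
  match e with inl x => (true, (val x.1, val x.2)) | inr x => (false, (val x.1, val x.2)) end.
Definition mkv (p : nat * nat) : Vt := (inord p.1, inord p.2).
Definition eh i j : Et := inl (inord i, inord j).
Definition eu i j : Et := inr (inord i, inord j).
Definition mks (p : nat * nat) : St := (inord p.1, inord p.2).

Definition inV (p : nat * nat) := (p.1 <= n)%N && (p.2 <= n)%N.

Lemma vv_mkv p : inV p -> vv (mkv p) = p.
Proof. by case: p => i j /andP [/= hi hj]; rewrite /vv /= !inordK. Qed.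
Lemma mkv_vv v : mkv (vv v) = v.
Proof. by case: v => i j; rewrite /mkv /= !inord_val. Qed.
Lemma vv_inj : injective vv. Proof. exact: can_inj mkv_vv. Qed.
Lemma inV_vv v : inV (vv v). Proof. by case: v => -[i hi] [j hj]; rewrite /inV /=; lia. Qed.
Lemma ee_inj : injective ee.
Proof. by move=> [[i j]|[i j]] [[k l]|[k l]] //= [] /val_inj -> /val_inj ->. Qed.
Lemma ss_inj : injective ss.
Proof. by move=> [i j] [k l] [] /val_inj /= -> /val_inj ->. Qed.
Lemma ee_eh i j : (i < n)%N -> (j <= n)%N -> ee (eh i j) = (true, (i, j)).
Proof. by move=> hi hj; rewrite /= !inordK. Qed.
Lemma ee_eu i j : (i <= n)%N -> (j < n)%N -> ee (eu i j) = (false, (i, j)).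
Proof. by move=> hi hj; rewrite /= !inordK. Qed.

Definition nsrc (r : bool * (nat * nat)) := r.2.
Definition ntgt (r : bool * (nat * nat)) := if r.1 then (r.2.1.+1, r.2.2) else (r.2.1, r.2.2.+1).
Definition src e := nsrc (ee e).
Definition tgt e := ntgt (ee e).

Lemma inV_src e : inV (src e).
Proof. by case: e => -[[i hi] [j hj]]; rewrite /inV /src /=; lia. Qed.
Lemma inV_tgt e : inV (tgt e).
Proof. by case: e => -[[i hi] [j hj]]; rewrite /inV /tgt /=; lia. Qed.

Definition kd1 (e : Et) (w : Vt) : Z := bz (vv w == tgt e) - bz (vv w == src e).
(** The counterclockwise boundary: bottom and right positive, top and left negative. *)
Definition nd2 (s : nat * nat) (e : bool * (nat * nat)) : Z :=
  if e.1 then bz ((e.2.1 == s.1) && (e.2.2 == s.2)) - bz ((e.2.1 == s.1) && (e.2.2 == s.2.+1))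
  else bz ((e.2.1 == s.1.+1) && (e.2.2 == s.2)) - bz ((e.2.1 == s.1) && (e.2.2 == s.2)).
Definition kd2 (s : St) (e : Et) : Z := nd2 (ss s) (ee e).
(** Minus the path from v along its row to the last column and then up to the corner (n, n). *)
Definition nh0 (v : nat * nat) (e : bool * (nat * nat)) : Z :=
  if e.1 then - bz ((e.2.2 == v.2) && (v.1 <= e.2.1)%N)
  else - bz ((e.2.1 == n) && (v.2 <= e.2.2)%N).
Definition kh0 (v : Vt) (e : Et) : Z := nh0 (vv v) (ee e).
(** A vertical edge sweeps out, with a minus sign, the strip of squares to its right; a horizontal
    edge moves along itself and sweeps out nothing. *)
Definition nh1 (e : bool * (nat * nat)) (s : nat * nat) : Z :=
  if e.1 then 0 else - bz ((s.2 == e.2.2) && (e.2.1 <= s.1)%N).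
Definition kh1 (e : Et) (s : St) : Z := nh1 (ee e) (ss s).

Lemma sumE (f : Et -> Z) : \sum_e f e =
  \sum_(i < n) \sum_(j < n.+1) f (inl (i, j)) + \sum_(i < n.+1) \sum_(j < n) f (inr (i, j)).
Proof. by rewrite big_sumType /= !pair_big /=; congr (_ + _); apply: eq_bigr => -[]. Qed.

Lemma sumV (f : Vt -> Z) : \sum_v f v = \sum_(i < n.+1) \sum_(j < n.+1) f (i, j).
Proof. by rewrite pair_big /=; apply: eq_bigr => -[]. Qed.

Lemma sumS (f : St -> Z) : \sum_v f v = \sum_(i < n) \sum_(j < n) f (i, j).
Proof. by rewrite pair_big /=; apply: eq_bigr => -[]. Qed.

Lemma sum_vertex (g : nat * nat -> Z) p : inV p -> \sum_w bz (vv w == p) * g (vv w) = g p.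
Proof.
case: p => k l /andP [/= hk hl]; rewrite sumV (sum_ind2 _ _ k l (fun i j => g (i, j))).
by rewrite !ltnS hk hl.
Qed.

Lemma sum_kd1 e (g : nat * nat -> Z) : \sum_w kd1 e w * g (vv w) = g (tgt e) - g (src e).
Proof.
under eq_bigr do rewrite mulrBl.
by rewrite sumrB !sum_vertex ?inV_tgt ?inV_src.
Qed.

Lemma op_d1 (z : bool * (nat * nat) -> Z) w : \sum_e z (ee e) * kd1 e w =
  (if (0 < (vv w).1)%N then z (true, ((vv w).1.-1, (vv w).2)) else 0)
  - (if ((vv w).1 < n)%N then z (true, vv w) else 0)
  + (if (0 < (vv w).2)%N then z (false, ((vv w).1, (vv w).2.-1)) else 0)
  - (if ((vv w).2 < n)%N then z (false, vv w) else 0).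
Proof.
have [k [l Ew]] : exists k l, vv w = (k, l) by case: (vv w) => k l; exists k, l.
have := inV_vv w; rewrite Ew => /andP [/= hk hl].
rewrite sumE.
have -> : \sum_(i < n) \sum_(j < n.+1) z (ee (inl (i, j))) * kd1 (inl (i, j)) w =
  (if (0 < k)%N then z (true, (k.-1, l)) else 0) - (if (k < n)%N then z (true, (k, l)) else 0).
  have -> : (if (0 < k)%N then z (true, (k.-1, l)) else 0) = if (k.-1 < n)%N && (l < n.+1)%N then (if (0 < k)%N then z (true, (k.-1, l)) else 0) else 0.
    by case: ifP => //; case: ifP => // k0; lia.
  have -> : (if (k < n)%N then z (true, (k, l)) else 0) = if (k < n)%N && (l < n.+1)%N then z (true, (k, l)) else 0.
    by rewrite ltnS hl andbT.
  rewrite -(sum_ind2 n n.+1 k.-1 l (fun i j => if (0 < k)%N then z (true, (i, j)) else 0)).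
  rewrite -(sum_ind2 n n.+1 k l (fun i j => z (true, (i, j)))).
  rewrite -sumrB; apply: eq_bigr => i _; rewrite -sumrB; apply: eq_bigr => j _.
  rewrite /kd1 Ew /tgt /src /= !xpair_eqE [(k == i)]eq_sym [(l == j)]eq_sym mulrBr ![z _ * _]mulrC.
  congr (_ - _); case: (ltnP 0 k) => k0; last first.
    by rewrite mulr0 (_ : k == i.+1 = false) ?mul0r //; lia.
  by rewrite (_ : k == i.+1 = (i == k.-1 :> nat)) //; lia.
have -> : \sum_(i < n.+1) \sum_(j < n) z (ee (inr (i, j))) * kd1 (inr (i, j)) w =
  (if (0 < l)%N then z (false, (k, l.-1)) else 0) - (if (l < n)%N then z (false, (k, l)) else 0).
  have -> : (if (0 < l)%N then z (false, (k, l.-1)) else 0) = if (k < n.+1)%N && (l.-1 < n)%N then (if (0 < l)%N then z (false, (k, l.-1)) else 0) else 0.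
    by case: ifP => //; case: ifP => // l0; lia.
  have -> : (if (l < n)%N then z (false, (k, l)) else 0) = if (k < n.+1)%N && (l < n)%N then z (false, (k, l)) else 0.
    by rewrite ltnS hk.
  rewrite -(sum_ind2 n.+1 n k l.-1 (fun i j => if (0 < l)%N then z (false, (i, j)) else 0)).
  rewrite -(sum_ind2 n.+1 n k l (fun i j => z (false, (i, j)))).
  rewrite -sumrB; apply: eq_bigr => i _; rewrite -sumrB; apply: eq_bigr => j _.
  rewrite /kd1 Ew /tgt /src /= !xpair_eqE [(k == i)]eq_sym [(l == j)]eq_sym mulrBr ![z _ * _]mulrC.
  congr (_ - _); case: (ltnP 0 l) => l0; last first.
    by rewrite mulr0 (_ : l == j.+1 = false) ?andbF ?mul0r //; lia.
  by rewrite (_ : l == j.+1 = (j == l.-1 :> nat)) //; lia.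
by rewrite addrA.
Qed.

Lemma sum_kd2 s (g : bool * (nat * nat) -> Z) : \sum_e kd2 s e * g (ee e) =
  g (true, ss s) - g (true, ((ss s).1, (ss s).2.+1)) + g (false, ((ss s).1.+1, (ss s).2)) - g (false, ss s).
Proof.
have [k [l [Es hk hl]]] : exists k l, [/\ ss s = (k, l), (k < n)%N & (l < n)%N].
  by case: s => i j; exists i, j; rewrite !ltn_ord.
rewrite sumE Es /=.
have -> : \sum_(i < n) \sum_(j < n.+1) kd2 s (inl (i, j)) * g (true, (val i, val j)) =
  g (true, (k, l)) - g (true, (k, l.+1)).
  have H l' : (l' < n.+1)%N -> g (true, (k, l')) = \sum_(i < n) \sum_(j < n.+1) bz ((i == k :> nat) && (j == l' :> nat)) * g (true, (val i, val j)).
    by move=> h; rewrite (sum_ind2 n n.+1 k l' (fun i j => g (true, (i, j)))) hk h.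
  rewrite !H ?ltnS // 1?ltnW // -sumrB; apply: eq_bigr => i _; rewrite -sumrB; apply: eq_bigr => j _.
  by rewrite /kd2 Es /nd2 /= mulrBl.
have -> : \sum_(i < n.+1) \sum_(j < n) kd2 s (inr (i, j)) * g (false, (val i, val j)) =
  g (false, (k.+1, l)) - g (false, (k, l)).
  have H k' : (k' < n.+1)%N -> g (false, (k', l)) = \sum_(i < n.+1) \sum_(j < n) bz ((i == k' :> nat) && (j == l :> nat)) * g (false, (val i, val j)).
    by move=> h; rewrite (sum_ind2 n.+1 n k' l (fun i j => g (false, (i, j)))) hl h.
  rewrite !H ?ltnS // 1?ltnW // -sumrB; apply: eq_bigr => i _; rewrite -sumrB; apply: eq_bigr => j _.
  by rewrite /kd2 Es /nd2 /= mulrBl.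
by rewrite addrA.
Qed.

Lemma op_d2 (y : nat * nat -> Z) e : \sum_s y (ss s) * kd2 s e =
  if (ee e).1 then (if ((ee e).2.2 < n)%N then y (ee e).2 else 0) - (if (0 < (ee e).2.2)%N then y ((ee e).2.1, (ee e).2.2.-1) else 0)
  else (if (0 < (ee e).2.1)%N then y ((ee e).2.1.-1, (ee e).2.2) else 0) - (if ((ee e).2.1 < n)%N then y (ee e).2 else 0).
Proof.
rewrite sumS.
have H k l : (if (k < n)%N && (l < n)%N then y (k, l) else 0) = \sum_(i < n) \sum_(j < n) bz ((i == k :> nat) && (j == l :> nat)) * y (val i, val j).
  by rewrite (sum_ind2 n n k l (fun i j => y (i, j))).
case: e => -[[k hk] [l hl]] /=.
  have -> : (if (l < n)%N then y (k, l) else 0) = (if (k < n)%N && (l < n)%N then y (k, l) else 0) by rewrite hk.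
  have -> : (if (0 < l)%N then y (k, l.-1) else 0) = \sum_(i < n) \sum_(j < n) bz ((i == k :> nat) && (j.+1 == l :> nat)) * y (val i, val j).
    case: ltnP => l0.
      have := H k l.-1; rewrite hk (_ : (l.-1 < n)%N = true); last lia.
      move=> /= ->; apply: eq_bigr => i _; apply: eq_bigr => j _; congr (bz (_ && _) * _); lia.
    rewrite big1 // => i _; rewrite big1 // => j _; rewrite (_ : _ && _ = false) ?mul0r //; lia.
  rewrite H -sumrB; apply: eq_bigr => i _; rewrite -sumrB; apply: eq_bigr => j _.
  by rewrite /kd2 /nd2 /= -mulrBl mulrC; congr (_ * _); lia.
have -> : (if (k < n)%N then y (k, l) else 0) = (if (k < n)%N && (l < n)%N then y (k, l) else 0) by rewrite hl andbT.
have -> : (if (0 < k)%N then y (k.-1, l) else 0) = \sum_(i < n) \sum_(j < n) bz ((i.+1 == k :> nat) && (j == l :> nat)) * y (val i, val j).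
  case: ltnP => l0.
    have := H k.-1 l; rewrite hl (_ : (k.-1 < n)%N = true); last lia.
    move=> /= ->; apply: eq_bigr => i _; apply: eq_bigr => j _; congr (bz (_ && _) * _); lia.
  rewrite big1 // => i _; rewrite big1 // => j _; rewrite (_ : _ && _ = false) ?mul0r //; lia.
rewrite H -sumrB; apply: eq_bigr => i _; rewrite -sumrB; apply: eq_bigr => j _.
by rewrite /kd2 /nd2 /= -mulrBl mulrC; congr (_ * _); lia.
Qed.

Lemma kd21 s w : \sum_e kd2 s e * kd1 e w = 0.
Proof.
rewrite (sum_kd2 s (fun r => bz (vv w == ntgt r) - bz (vv w == nsrc r))) /ntgt /nsrc /=.
case: (ss s) (vv w) => i j [k l] /=; rewrite !xpair_eqE; lia.
Qed.

Lemma kh0d1 v w : \sum_e kh0 v e * kd1 e w = bz (v == w) - bz (vv w == (n, n)).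
Proof.
rewrite (op_d1 (nh0 (vv v))) -(inj_eq vv_inj) /nh0.
have := inV_vv v; have := inV_vv w; case: (vv v) (vv w) => i j [k l] /= /andP [/= a b] /andP [/= c d].
rewrite !xpair_eqE; repeat (case: ifP => ?); lia.
Qed.

Lemma kd2h1 s s' : \sum_e kd2 s e * kh1 e s' = bz (s == s').
Proof.
rewrite (sum_kd2 s (fun r => nh1 r (ss s'))) /nh1 -(inj_eq ss_inj).
case: (ss s) (ss s') => i j [k l] /=; rewrite !xpair_eqE; lia.
Qed.

Lemma khh1 e e' : \sum_s kh1 e s * kd2 s e' + \sum_w kd1 e w * kh0 w e' = bz (e == e').
Proof.
rewrite (op_d2 (nh1 (ee e))) (sum_kd1 e (fun v => nh0 v (ee e'))) -(inj_eq ee_inj).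
have := inV_tgt e; have := inV_src e; have := inV_tgt e'; have := inV_src e'.
rewrite /src /tgt; case: (ee e) => [[] [i j]]; case: (ee e') => [[] [k l]];
  rewrite /inV /nh1 /nh0 /ntgt /nsrc /= ?xpair_eqE => /andP [? ?] /andP [? ?] /andP [? ?] /andP [? ?];
  repeat (case: ifP => ?); lia.
Qed.
End Grid.

Section Kernels.
Variables (A B C : finType).

Definition mx (X : A -> B -> Z) : 'M[Z]_(#|A|, #|B|) := \matrix_(i, j) X (enum_val i) (enum_val j).

Lemma mxEr X a b : mx X (enum_rank a) (enum_rank b) = X a b.
Proof. by rewrite mxE !enum_rankK. Qed.

Lemma sum_rank (f : 'I_#|A| -> Z) : \sum_i f i = \sum_a f (enum_rank a).
Proof. by rewrite (reindex _ (onW_bij _ (@enum_rank_bij A))). Qed.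
Lemma sum_val (f : A -> Z) : \sum_(i < #|A|) f (enum_val i) = \sum_a f a.
Proof. by rewrite sum_rank; apply: eq_bigr => a _; rewrite enum_rankK. Qed.
End Kernels.

Lemma mx_mul (A B C : finType) (X : A -> B -> Z) (Y : B -> C -> Z) :
  mx X *m mx Y = mx (fun a c => \sum_b X a b * Y b c).
Proof.
apply/matrixP=> i j; rewrite !mxE -(sum_val (fun b => X (enum_val i) b * Y b (enum_val j))).
by apply: eq_bigr => k _; rewrite !mxE.
Qed.

Lemma tel2 lo hi (f g : nat -> Z) : (lo <= hi)%N ->
  \sum_(lo <= i < hi.+1) (f i - g i) + \sum_(lo <= i < hi) (g i.+1 - f i) = f hi - g lo.
Proof.
elim: hi => [|hi IH]; first by rewrite leqn0 => /eqP ->; rewrite big_nat1 big_geq // addr0.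
rewrite leq_eqVlt => /orP [/eqP ->|h]; first by rewrite big_nat1 big_geq // addr0.
have E1 : \sum_(lo <= i < hi.+2) (f i - g i) = \sum_(lo <= i < hi.+1) (f i - g i) + (f hi.+1 - g hi.+1).
  by rewrite big_nat_recr //= ltnW.
have E2 : \sum_(lo <= i < hi.+1) (g i.+1 - f i) = \sum_(lo <= i < hi) (g i.+1 - f i) + (g hi.+1 - f hi).
  by rewrite big_nat_recr.
rewrite E1 E2; have := IH h; lia.
Qed.

Section GridMaps.
Variable m : nat.
Let n := m.+1.
Local Notation V := (Vt m).
Local Notation E := (Et m).
Local Notation S := (St m).

Definition D1 := mx (@kd1 m).
Definition D2 := mx (@kd2 m).
Definition H0 := mx (@kh0 m).
Definition H1 := mx (@kh1 m).
Definition vtop : 'I_#|{: V}| := enum_rank (mkv m (n, n)).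

Lemma D21 : D2 *m D1 = 0.
Proof. by rewrite mx_mul; apply/matrixP=> i j; rewrite !mxE kd21. Qed.

Lemma H0D1 : H0 *m D1 = 1%:M - \matrix_(i, j) (j == vtop)%:R.
Proof.
rewrite mx_mul; apply/matrixP=> i j; rewrite !mxE kh0d1.
rewrite (inj_eq enum_val_inj) (_ : (vv _ == _) = (j == vtop)); first by case: (i == j); case: (j == vtop).
rewrite -(inj_eq (@enum_val_inj _ _)) enum_rankK -(inj_eq (@vv_inj m)) vv_mkv //.
by rewrite /inV /= leqnn.
Qed.

Lemma H1D2 : H1 *m D2 + D1 *m H0 = 1%:M.
Proof.
rewrite !mx_mul; apply/matrixP=> i j; rewrite !mxE khh1 (inj_eq enum_val_inj).
by case: (i == j).
Qed.

Lemma D2H1 : D2 *m H1 = 1%:M.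
Proof.
rewrite !mx_mul; apply/matrixP=> i j; rewrite !mxE kd2h1 (inj_eq enum_val_inj).
by case: (i == j).
Qed.

Variable a : nat * nat -> nat * nat.
Hypothesis aV : forall p, inV m (a p).

Definition av (v : V) : V := mkv m (a (vv v)).
Definition F0 : 'M[Z]_#|{: V}| := fmx (fun i => enum_rank (av (enum_val i))).

(* The coefficients of the path from [p] to [q] that is first horizontal and then vertical. *)
Definition lch (p q : nat * nat) (e : bool * (nat * nat)) : Z :=
  if e.1 then bz ((e.2.2 == p.2) && (p.1 <= e.2.1 < q.1)%N) - bz ((e.2.2 == p.2) && (q.1 <= e.2.1 < p.1)%N)
  else bz ((e.2.1 == q.1) && (p.2 <= e.2.2 < q.2)%N) - bz ((e.2.1 == q.1) && (q.2 <= e.2.2 < p.2)%N).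

Definition kF1 (e e' : E) : Z := lch (a (src e)) (a (tgt e)) (ee e').
Definition F1 := mx kF1.
Definition F2 := D2 *m F1 *m H1.

Lemma vv_av v : vv (av v) = a (vv v). Proof. by rewrite vv_mkv. Qed.

Lemma segment_bd i i' k : (i <= n)%N -> (i' <= n)%N -> (k <= n)%N ->
  (if (0 < k)%N then bz (i <= k.-1 < i')%N - bz (i' <= k.-1 < i)%N else 0)
  - (if (k < n)%N then bz (i <= k < i')%N - bz (i' <= k < i)%N else 0) = bz (k == i') - bz (k == i).
Proof.
(* The signed indicator of an interval is a difference of two half line indicators, whichever end is
   larger. *)
have seg_ind x : bz (i <= x < i')%N - bz (i' <= x < i)%N = bz (x < i')%N - bz (x < i)%N.
  by clear; lia.
by move=> hi hi' hk; rewrite !seg_ind; case: (ltnP 0 k) => k0; case: (ltnP k n) => kn; lia.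
Qed.

Lemma lch_d1 p q w : inV m p -> inV m q ->
  \sum_(e : E) lch p q (ee e) * kd1 e w = bz (vv w == q) - bz (vv w == p).
Proof.
move=> /andP [p1 p2] /andP [q1 q2]; rewrite op_d1 /lch.
have := inV_vv w; case: p q (vv w) p1 p2 q1 q2 => i j [i' j'] [k l] /= a1 a2 a3 a4 /andP [/= hk hl].
have e1 := segment_bd a1 a3 hk; have e2 := segment_bd a2 a4 hl; rewrite !xpair_eqE.
rewrite -[_ + _ - _]addrA.
have -> : (if (0 < k)%N then bz ((l == j) && (i <= k.-1 < i')%N) - bz ((l == j) && (i' <= k.-1 < i)%N) else 0)
  - (if (k < n)%N then bz ((l == j) && (i <= k < i')%N) - bz ((l == j) && (i' <= k < i)%N) else 0)
  = bz ((k == i') && (l == j)) - bz ((k == i) && (l == j)).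
  case: (l == j); rewrite ?andbT ?andbF //=; by do 2 case: ifP.
have -> : (if (0 < l)%N then bz ((k == i') && (j <= l.-1 < j')%N) - bz ((k == i') && (j' <= l.-1 < j)%N) else 0)
  - (if (l < n)%N then bz ((k == i') && (j <= l < j')%N) - bz ((k == i') && (j' <= l < j)%N) else 0)
  = bz ((k == i') && (l == j')) - bz ((k == i') && (l == j)).
  case: (k == i'); rewrite ?andbT ?andbF //=; by do 2 case: ifP.
by clear; lia.
Qed.

Lemma F_chain : chain_map D1 F0 F1.
Proof.
rewrite /chain_map /F1 mx_mul; apply/matrixP=> i j; rewrite !mxE.
rewrite lch_d1 //.
rewrite -[in RHS](enum_valK i) -[in RHS](enum_valK j); move: (enum_val i) (enum_val j) => e w.
rewrite sum_rank.
under eq_bigr => v _ do rewrite mxEr mxE !enum_rankK (inj_eq enum_rank_inj).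
transitivity (\sum_v kd1 e v * bz (vv w == a (vv v))).
  by rewrite (sum_kd1 e (fun v => bz (vv w == a v))).
apply: eq_bigr => v _; congr (_ * _); rewrite -vv_av (inj_eq (@vv_inj m)).
by case: (_ == _).
Qed.

End GridMaps.

(** * A discrete argument principle for local Lefschetz numbers *)

Section Lefschetz.
Variable m : nat.
Let n := m.+1.
Local Notation V := (Vt m).
Local Notation E := (Et m).
Variables (b : nat * nat -> nat * nat) (Ph : E -> E -> Z).
Hypothesis bV : forall p, inV m (b p).
Hypothesis chP : forall (e : E) (w : V), \sum_e' Ph e e' * kd1 e' w = bz (vv w == b (tgt e)) - bz (vv w == b (src e)).

(* [XX a r z]: crossings of [z] with the half line going left from the square [(a-1, r)];
   [YY a j y] is the analogous count for vertices. *)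
Definition XX (x r : nat) (z : E -> Z) : Z := \sum_(0 <= i < x) z (eu m i r).
Definition YY (x j : nat) (y : nat * nat) : Z := bz ((y.2 == j) && (y.1 < x)%N).

Let ne (z : E -> Z) (r : bool * (nat * nat)) : Z := if r.1 then z (eh m r.2.1 r.2.2) else z (eu m r.2.1 r.2.2).
Let neE (z : E -> Z) e : z e = ne z (ee e).
Proof. by case: e => -[i j]; rewrite /ne /eh /eu /= !inord_val. Qed.

Let bd_expand e k l : (k <= n)%N -> (l <= n)%N ->
  bz ((k, l) == b (tgt e)) - bz ((k, l) == b (src e)) =
  (if (0 < k)%N then Ph e (eh m k.-1 l) else 0) - (if (k < n)%N then Ph e (eh m k l) else 0)
  + (if (0 < l)%N then Ph e (eu m k l.-1) else 0) - (if (l < n)%N then Ph e (eu m k l) else 0).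
Proof.
move=> hk hl; have kl : inV m (k, l) by rewrite /inV /= hk hl.
have := chP e (mkv m (k, l)); rewrite vv_mkv // => <-.
by under eq_bigr do rewrite (neE (Ph e)); rewrite op_d1 vv_mkv.
Qed.

(** Conservation of the chain [Ph e] on the left part of row j: its end points there are balanced by
    what passes through the edge at the right end and through the vertical edges below and above. *)
Lemma YY_flux e x j : (x < n)%N -> (0 < j < n)%N ->
  YY x.+1 j (b (tgt e)) - YY x.+1 j (b (src e)) =
  - Ph e (eh m x j) + XX x.+1 j.-1 (Ph e) - XX x.+1 j (Ph e).
Proof.
move=> hx /andP [j0 jn]; elim: x hx => [|x IH] hx.
  have := bd_expand e (k := 0) (l := j) (leq0n _) (ltnW jn); rewrite j0 jn /= /YY /XX !big_nat1.
  by case: (b (tgt e)) (b (src e)) => i1 j1 [i2 j2] /=; rewrite !xpair_eqE; lia.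
have := bd_expand e (k := x.+1) (l := j) (ltnW hx) (ltnW jn); rewrite j0 jn hx /=.
have := IH (ltnW hx); rewrite /XX ![\sum_(0 <= i < x.+2) _]big_nat_recr //=.
set s1 := \sum_(0 <= i < x.+1) _; set s2 := \sum_(0 <= i < x.+1) _.
rewrite /YY; case: (b (tgt e)) (b (src e)) => i1 j1 [i2 j2] /=; rewrite !xpair_eqE; lia.
Qed.

(** A chain crosses the full horizontal line between two rows as often as the heights of its two
    ends require. *)
Lemma XX_full e r : (r < n)%N -> XX n.+1 r (Ph e) = bz (r < (b (tgt e)).2)%N - bz (r < (b (src e)).2)%N.
Proof.
have row l : (l <= n)%N -> bz ((b (tgt e)).2 == l) - bz ((b (src e)).2 == l) =
    (if (0 < l)%N then XX n.+1 l.-1 (Ph e) else 0) - (if (l < n)%N then XX n.+1 l (Ph e) else 0).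
  move=> hl.
  have P x : (x <= n)%N -> bz (((b (tgt e)).2 == l) && ((b (tgt e)).1 <= x)%N) - bz (((b (src e)).2 == l) && ((b (src e)).1 <= x)%N) =
     - (if (x < n)%N then Ph e (eh m x l) else 0) + (if (0 < l)%N then XX x.+1 l.-1 (Ph e) else 0) - (if (l < n)%N then XX x.+1 l (Ph e) else 0).
    elim: x => [|x IH] hx.
      have := bd_expand e (k := 0) (leq0n _) hl; rewrite /XX !big_nat1 /=.
      by case: (b (tgt e)) (b (src e)) => i1 j1 [i2 j2] /=; rewrite !xpair_eqE; repeat (case: ifP => ?); lia.
    have stepI (y : nat * nat) : bz ((y.2 == l) && (y.1 <= x.+1)%N) = bz ((y.2 == l) && (y.1 <= x)%N) + bz ((x.+1, l) == y).
      by case: y => i1 j1 /=; rewrite xpair_eqE; lia.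
    rewrite !stepI opprD addrACA (IH (ltnW hx)) (bd_expand e hx hl) hx /= /XX ![\sum_(0 <= i < x.+2) _]big_nat_recr //=.
    clear; case: ifP => _; case: ifP => _; case: ifP => _; ring.
  have := P n (leqnn n); rewrite ltnn.
  have /andP [-> _] := bV (tgt e); have /andP [-> _] := bV (src e).
  by rewrite !andbT => ->; lia.
elim: r => [|r IH] hr.
  by have := row 0%N (leq0n _); rewrite hr /=; move: (XX n.+1 0 (Ph e)) => X0; lia.
by have := row r.+1 (ltnW hr); rewrite hr /= (IH (ltnW hr)); move: (XX n.+1 r.+1 (Ph e)) => X0; lia.
Qed.

Lemma XX_left e x r : (r < n)%N -> (x <= n.+1)%N -> (forall i, (x <= i <= n)%N -> Ph e (eu m i r) = 0) ->
  XX x r (Ph e) = bz (r < (b (tgt e)).2)%N - bz (r < (b (src e)).2)%N.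
Proof.
move=> hr hx H; rewrite -(XX_full e hr) /XX (big_cat_nat (n := x) (p := n.+1)) //=.
rewrite [X in _ = _ + X]big_nat_cond [X in _ = _ + X]big1 ?addr0 // => i /andP [/andP [xi i_n] _].
by apply: H; rewrite xi.
Qed.

Lemma XX_none e x r : (forall i, (i < x)%N -> Ph e (eu m i r) = 0) -> XX x r (Ph e) = 0.
Proof. by move=> H; rewrite /XX big_nat_cond big1 // => i /andP [/andP [_ /H]]. Qed.

Variables lo hi : nat.
Hypothesis lohi : (0 < lo)%N /\ (lo <= hi < n)%N.

(** A diagonal entry in degree two: [h1] takes the coefficient of a square to be minus a half line
    count, here summed over the four sides of the square. *)
Definition Ph2 (i j : nat) : Z :=
  - (XX i.+1 j (Ph (eh m i j)) - XX i.+1 j (Ph (eh m i j.+1)) + XX i.+1 j (Ph (eu m i.+1 j)) - XX i.+1 j (Ph (eu m i j))).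

Definition inner_sum : Z :=
  \sum_(lo <= j < hi.+1) \sum_(lo <= i < hi.+1) bz (b (i, j) == (i, j))
  - \sum_(lo <= j < hi.+1) \sum_(lo <= i < hi) Ph (eh m i j) (eh m i j)
  - \sum_(lo <= j < hi) \sum_(lo <= i < hi.+1) Ph (eu m i j) (eu m i j)
  + \sum_(lo <= j < hi) \sum_(lo <= i < hi) Ph2 i j.

Definition right_sum : Z := \sum_(lo <= j < hi.+1) YY hi.+1 j (b (hi, j)) - \sum_(lo <= j < hi) XX hi.+1 j (Ph (eu m hi j)).
Definition top_sum : Z := \sum_(lo <= i < hi) XX i.+1 hi (Ph (eh m i hi)).
Definition left_sum : Z := \sum_(lo <= j < hi) XX lo j (Ph (eu m lo j)) - \sum_(lo <= j < hi.+1) YY lo j (b (lo, j)).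
Definition bottom_sum : Z := - \sum_(lo <= i < hi) XX i.+1 lo.-1 (Ph (eh m i lo)).

(** Each diagonal entry is a difference of neighbouring half line counts. The sums telescope along
    the rows, and what remains telescopes across the rows, so only terms on the boundary of the
    window survive. *)
Lemma Lefschetz_grid : inner_sum = right_sum + top_sum + left_sum + bottom_sum.
Proof.
case: lohi => lo0 /andP [lh hn].
(* [A j] and [B j] count how the images of the horizontal edges of row j cross the half lines just
   above and just below that row. *)
pose A j := \sum_(lo <= i < hi) XX i.+1 j (Ph (eh m i j)).
pose B j := \sum_(lo <= i < hi) XX i.+1 j.-1 (Ph (eh m i j)).
have R1 j : (lo <= j < hi.+1)%N ->
   \sum_(lo <= i < hi.+1) bz (b (i, j) == (i, j)) - \sum_(lo <= i < hi) Ph (eh m i j) (eh m i j)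
   = YY hi.+1 j (b (hi, j)) - YY lo j (b (lo, j)) + (A j - B j).
  move=> /andP [lj jh].
  rewrite -(@tel2 lo hi (fun i => YY i.+1 j (b (i, j))) (fun i => YY i j (b (i, j)))) // /A /B -sumrB -addrA -big_split /=.
  congr (_ + _).
    apply: eq_bigr => i _; rewrite /YY; case: (b (i, j)) => k l /=; rewrite xpair_eqE; lia.
  rewrite -sumrN; apply: eq_big_nat => i /andP [li ih].
  have := @YY_flux (eh m i j) i j; rewrite /tgt /src ee_eh /=; try lia.
  move=> H; have h1 : (i < n)%N by lia. have h2 : (0 < j < n)%N by lia.
  by have := H h1 h2; rewrite /ntgt /nsrc /=; lia.
have R2 j : (lo <= j < hi)%N ->
   - \sum_(lo <= i < hi.+1) Ph (eu m i j) (eu m i j) + \sum_(lo <= i < hi) Ph2 i j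
   = XX lo j (Ph (eu m lo j)) - XX hi.+1 j (Ph (eu m hi j)) + (B j.+1 - A j).
  move=> /andP [lj jh].
  have := @tel2 lo hi (fun i => XX i.+1 j (Ph (eu m i j))) (fun i => XX i j (Ph (eu m i j))) lh.
  have -> : \sum_(lo <= i < hi.+1) (XX i.+1 j (Ph (eu m i j)) - XX i j (Ph (eu m i j))) = \sum_(lo <= i < hi.+1) Ph (eu m i j) (eu m i j).
    by apply: eq_bigr => i _; rewrite /XX big_nat_recr //=; ring.
  have -> : \sum_(lo <= i < hi) Ph2 i j = - \sum_(lo <= i < hi) (XX i.+1 j (Ph (eu m i.+1 j)) - XX i.+1 j (Ph (eu m i j))) + (B j.+1 - A j).
    rewrite /A /B -sumrB -sumrN -big_split /=; apply: eq_bigr => i _; rewrite /Ph2; lia.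
  lia.
have T := @tel2 lo hi A B lh.
have -> : inner_sum =
  \sum_(lo <= j < hi.+1) (\sum_(lo <= i < hi.+1) bz (b (i, j) == (i, j)) - \sum_(lo <= i < hi) Ph (eh m i j) (eh m i j))
  + \sum_(lo <= j < hi) (- \sum_(lo <= i < hi.+1) Ph (eu m i j) (eu m i j) + \sum_(lo <= i < hi) Ph2 i j).
  by rewrite /inner_sum sumrB big_split /= sumrN addrA.
rewrite (eq_big_nat _ _ R1) (eq_big_nat _ _ R2) !big_split /= !sumrN.
rewrite !big_split /= !sumrN in T.
rewrite /right_sum /top_sum /left_sum /bottom_sum -/(A hi) -/(B lo).
move/eqP: T; rewrite -subr_eq0 => /eqP T; apply/eqP; rewrite -subr_eq0 -[X in _ == X]T; apply/eqP; ring.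
Qed.

End Lefschetz.

Lemma nat_window N lo hi (f : nat -> Z) : (hi <= N)%N ->
  \sum_(lo <= i < hi) f i = \sum_(i < N) if (lo <= i < hi)%N then f i else 0.
Proof.
move=> hN; rewrite -(big_mkord xpredT (fun i => if (lo <= i < hi)%N then f i else 0)).
case: (leqP lo hi) => lh; last first.
  rewrite [LHS]big_geq; last exact: ltnW.
  by rewrite big1 // => i _; case: ifP => //; lia.
rewrite [RHS](big_cat_nat (n := lo)) ?(leq_trans lh) //= [X in _ = X + _]big_nat_cond [X in _ = X + _]big1 ?add0r; last first.
  move=> i /andP [/andP [_ h] _]; case: ifP => //; lia.
rewrite (big_cat_nat (n := hi) lh hN) /= [X in _ = _ + X]big_nat_cond [X in _ = _ + X]big1 ?addr0; last first.
  move=> i /andP [/andP [h _] _]; case: ifP => //; lia.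
by apply: eq_big_nat => i ->.
Qed.

Ltac ordlia := exfalso; repeat match goal with x : ordinal _ |- _ => destruct x end; simpl in *; lia.

(** * Local traces of powers of the grid map *)

Section Local.
Variable m : nat.
Let n := m.+1.
Local Notation V := (Vt m).
Local Notation E := (Et m).
Local Notation S := (St m).
Variable a : nat * nat -> nat * nat.
Hypothesis aV : forall p, inV m (a p).

Definition inW (lo hi : nat) (p : nat * nat) := (lo <= p.1 <= hi)%N && (lo <= p.2 <= hi)%N.
Definition oV lo hi (v : V) := inW lo hi (vv v).
Definition oE lo hi (e : E) := inW lo hi (src e) && inW lo hi (tgt e).
Definition oS lo hi (s : S) := inW lo hi (ss s) && inW lo hi ((ss s).1.+1, (ss s).2.+1).

(** The power is taken on the whole grid before the diagonal is restricted to the window; this is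
    the quantity to which [Lefschetz_grid] applies. *)
Definition ltr N lo hi : Z :=
  \sum_(i | oV lo hi (enum_val i)) (F0 m a ^+ N) i i
  - \sum_(i | oE lo hi (enum_val i)) (F1 m a ^+ N) i i
  + \sum_(i | oS lo hi (enum_val i)) (F2 m a ^+ N) i i.

Lemma fmx_exp k (g : 'I_k -> 'I_k) N : fmx g ^+ N = fmx (iter N g).
Proof.
elim: N => [|N IH]; first by apply/matrixP=> i j; rewrite !mxE eq_sym.
by rewrite exprSr IH -mulmxE; apply/matrixP=> i j; rewrite mul_fmx !mxE.
Qed.

Lemma iter_av N (v : V) : vv (iter N (av a) v) = iter N a (vv v).
Proof. by elim: N => //= N IH; rewrite vv_av // IH. Qed.

Lemma F0_exp N (v w : V) : (F0 m a ^+ N) (enum_rank v) (enum_rank w) = bz (vv w == iter N a (vv v)).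
Proof.
rewrite fmx_exp mxE (_ : iter _ _ _ = enum_rank (iter N (av a) v)).
  by rewrite (inj_eq enum_rank_inj) -(inj_eq (@vv_inj m)) iter_av; case: (_ == _).
by elim: N => //= N ->; rewrite enum_rankK.
Qed.

Definition Ph N (e e' : E) : Z := (F1 m a ^+ N) (enum_rank e) (enum_rank e').

Lemma Ph_chain N e w : \sum_e' Ph N e e' * kd1 e' w = bz (vv w == iter N a (tgt e)) - bz (vv w == iter N a (src e)).
Proof.
have := chain_map_exp N (F_chain aV) => /matrixP /(_ (enum_rank e) (enum_rank w)).
rewrite !mxE !sum_rank => H.
transitivity (\sum_e' (F1 m a ^+ N) (enum_rank e) (enum_rank e') * D1 m (enum_rank e') (enum_rank w)).
  by apply: eq_bigr => e' _; rewrite /D1 mxEr.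
rewrite H -(sum_kd1 e (fun v => bz (vv w == iter N a v))).
by apply: eq_bigr => v _; rewrite F0_exp /D1 mxEr.
Qed.

Lemma sum_h1 (z : E -> Z) s : \sum_e z e * kh1 e s = - XX (ss s).1.+1 (ss s).2 z.
Proof.
rewrite sumE [X in X + _]big1 ?add0r; last by move=> i _; rewrite big1 // => j _; rewrite /kh1 /= mulr0.
case: s => -[k hk] [l hl] /=.
transitivity (\sum_(i < n.+1) - (if (0 <= i < k.+1)%N then z (eu m i l) else 0)).
  apply: eq_bigr => i _.
  transitivity (\sum_(j < n) bz (j == l :> nat) * (if (0 <= i < k.+1)%N then - z (eu m i j) else 0)).
    apply: eq_bigr => j _; rewrite /kh1 /nh1 /= /eu !inord_val [l == j]eq_sym ltnS.
    by case: (val j == l); case: (i <= k)%N; rewrite ?mul0r ?mulr0 ?oppr0 //=; ring.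
  rewrite (sum_ind n l (fun j => if (0 <= i < k.+1)%N then - z (eu m i j) else 0)) hl.
  by case: ifP => _; rewrite ?oppr0.
rewrite sumrN -(@nat_window n.+1 0 k.+1 (fun i => z (eu m i l))) //.
by rewrite ltnS ltnW.
Qed.

Lemma F2_exp N (s : S) : (F2 m a ^+ N) (enum_rank s) (enum_rank s) = Ph2 (@Ph N) (ss s).1 (ss s).2.
Proof.
rewrite (chain_exp2 (D21 m) (H1D2 m) (D2H1 m) N (F_chain aV)) mxE sum_rank.
transitivity (\sum_e' (\sum_e kd2 s e * Ph N e e') * kh1 e' s).
  apply: eq_bigr => e' _; rewrite mxE sum_rank /H1 mxEr; congr (_ * _).
  by apply: eq_bigr => e _; rewrite /D2 mxEr.
under eq_bigr do rewrite mulr_suml.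
rewrite exchange_big /=.
transitivity (\sum_e kd2 s e * - XX (ss s).1.+1 (ss s).2 (Ph N e)).
  by apply: eq_bigr => e _; rewrite -sum_h1 mulr_sumr; apply: eq_bigr => e' _; rewrite mulrA.
pose g (r : bool * (nat * nat)) := - XX (ss s).1.+1 (ss s).2 (Ph N (if r.1 then eh m r.2.1 r.2.2 else eu m r.2.1 r.2.2)).
transitivity (\sum_e kd2 s e * g (ee e)).
  by apply: eq_bigr => e _; congr (_ * _); rewrite /g; case: e => -[i j]; rewrite /eh /eu /= !inord_val.
rewrite sum_kd2 /g /Ph2 /=; ring.
Qed.

Lemma ltrE N lo hi : (hi < n)%N -> ltr N lo hi = inner_sum (iter N a) (@Ph N) lo hi.
Proof.
move=> hn; rewrite /ltr /inner_sum.
have -> : \sum_(i | oV lo hi (enum_val i)) (F0 m a ^+ N) i i =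
   \sum_(lo <= j < hi.+1) \sum_(lo <= i < hi.+1) bz (iter N a (i, j) == (i, j)).
  rewrite big_mkcond sum_rank sumV exchange_big /= (@nat_window n.+1); last lia.
  apply: eq_bigr => j _; case: ifP => hj.
    rewrite (@nat_window n.+1); last lia.
    apply: eq_bigr => i _; rewrite enum_rankK F0_exp /oV /inW /= eq_sym.
    by rewrite -[(j <= hi)%N]ltnS hj andbT ltnS.
  rewrite big1 // => i _; rewrite enum_rankK /oV /inW /= -[(j <= hi)%N]ltnS hj andbF //.
have -> : \sum_(i | oE lo hi (enum_val i)) (F1 m a ^+ N) i i =
   \sum_(lo <= j < hi.+1) \sum_(lo <= i < hi) Ph N (eh m i j) (eh m i j) +
   \sum_(lo <= j < hi) \sum_(lo <= i < hi.+1) Ph N (eu m i j) (eu m i j).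
  rewrite big_mkcond sum_rank sumE; congr (_ + _).
    rewrite exchange_big /= (@nat_window n.+1); last lia.
    apply: eq_bigr => j _; case: ifP => hj.
      rewrite (@nat_window n); last lia.
      apply: eq_bigr => i _; rewrite enum_rankK /oE /src /tgt /inW /= /Ph /eh !inord_val.
      by case: ifP => h1; case: ifP => h2 //; ordlia.
    rewrite big1 // => i _; rewrite enum_rankK /oE /src /tgt /inW /=; case: ifP => // h1; ordlia.
  rewrite exchange_big /= (@nat_window n); last lia.
  apply: eq_bigr => j _; case: ifP => hj.
    rewrite (@nat_window n.+1); last lia.
    apply: eq_bigr => i _; rewrite enum_rankK /oE /src /tgt /inW /= /Ph /eu !inord_val.
    by case: ifP => h1; case: ifP => h2 //; ordlia.
  rewrite big1 // => i _; rewrite enum_rankK /oE /src /tgt /inW /=; case: ifP => // h1; ordlia.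
have -> : \sum_(i | oS lo hi (enum_val i)) (F2 m a ^+ N) i i =
   \sum_(lo <= j < hi) \sum_(lo <= i < hi) Ph2 (@Ph N) i j.
  rewrite big_mkcond sum_rank sumS exchange_big /= (@nat_window n); last lia.
  apply: eq_bigr => j _; case: ifP => hj.
    rewrite (@nat_window n); last lia.
    apply: eq_bigr => i _; rewrite enum_rankK /oS /inW /= F2_exp /=.
    by case: ifP => h1; case: ifP => h2 //; ordlia.
  rewrite big1 // => i _; rewrite enum_rankK /oS /inW /=; case: ifP => // h1; ordlia.
ring.
Qed.

Lemma ltr_boundary N lo hi : (0 < lo)%N -> (lo <= hi < n)%N ->
  ltr N lo hi = right_sum (iter N a) (@Ph N) lo hi + top_sum (@Ph N) lo hi
     + left_sum (iter N a) (@Ph N) lo hi + bottom_sum (@Ph N) lo hi.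
Proof.
move=> lo0 /andP [lh hn]; rewrite ltrE // (@Lefschetz_grid m (iter N a) (@Ph N) (@Ph_chain N)) //.
by rewrite lh hn.
Qed.
End Local.

(** * Regions of the grid *)

Definition corner (x w : nat * nat) : bool := [&& x.1 <= w.1 <= x.1.+1 & x.2 <= w.2 <= x.2.+1]%N.

Section Region.
Variable m : nat.
Let n := m.+1.
Local Notation V := (Vt m).
Local Notation E := (Et m).
Local Notation S := (St m).
Variable M : pred S.

Definition adj4 (s s' : S) : bool :=
  (ss s' == ((ss s).1.+1, (ss s).2)) || (ss s' == ((ss s).1, (ss s).2.+1)).
(** Connectedness of M, in the form used below: a locally constant function on its squares is
    constant. *)
Hypothesis Mind : forall ph : S -> Z, (forall s s', M s -> M s' -> adj4 s s' -> ph s = ph s') ->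
  forall s s', M s -> M s' -> ph s = ph s'.

(* L is the union of the closed squares outside M. *)
Definition LE (e : E) := [exists s, ~~ M s && (kd2 s e != 0)].
Definition ME (e : E) := [exists s, M s && (kd2 s e != 0)].
Definition LV (v : V) := [exists s : S, ~~ M s && corner (ss s) (vv v)].
Definition MV (v : V) := [exists s : S, M s && corner (ss s) (vv v)].
Definition front v := LV v && MV v.

Lemma ss_lt (s : S) : ((ss s).1 < n)%N /\ ((ss s).2 < n)%N.
Proof. by case: s => i j /=. Qed.

Lemma ss_mks q : (q.1 < n)%N -> (q.2 < n)%N -> ss (mks m q) = q.
Proof. by case: q => i j /= hi hj; rewrite /ss /= !inordK. Qed.

Lemma face_corner (s : S) (e : E) : kd2 s e != 0 -> corner (ss s) (src e) && corner (ss s) (tgt e).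
Proof.
rewrite /kd2 /nd2 /corner /src /tgt /nsrc /ntgt; case: (ss s) (ee e) => i j [[] [k l]] /=; lia.
Qed.

Lemma edge_face (e : E) : exists s, kd2 s e != 0.
Proof.
have := inV_src e; have := inV_tgt e; rewrite /inV /src /tgt /nsrc /ntgt.
case Ee: (ee e) => [[] [k l]] /= /andP [a b] /andP [c d].
- exists (mks m (k, l - (l == n))%N); rewrite /kd2 ss_mks /= ?Ee /nd2 /=; lia.
- exists (mks m (k - (k == n), l)%N); rewrite /kd2 ss_mks /= ?Ee /nd2 /=; lia.
Qed.

Lemma LE_LV e : LE e -> LV (mkv m (src e)) /\ LV (mkv m (tgt e)).
Proof.
case/existsP=> s /andP [Ms /face_corner /andP [a b]]; split; apply/existsP; exists s; rewrite Ms vv_mkv ?inV_src ?inV_tgt //.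
Qed.

Lemma ME_MV e : ME e -> MV (mkv m (src e)) /\ MV (mkv m (tgt e)).
Proof.
case/existsP=> s /andP [Ms /face_corner /andP [a b]]; split; apply/existsP; exists s; rewrite Ms vv_mkv ?inV_src ?inV_tgt //.
Qed.

Lemma notLE_ME e : ~~ LE e -> ME e.
Proof.
move=> /existsPn H; have [s hs] := edge_face e; apply/existsP; exists s.
by rewrite hs andbT; move: (H s); rewrite hs andbT negbK.
Qed.

Lemma MV_const (ph : nat * nat -> Z) : (forall e, ME e -> ph (tgt e) = ph (src e)) ->
  forall v w, MV v -> MV w -> ph (vv v) = ph (vv w).
Proof.
move=> H.
have edges s : M s -> ph ((ss s).1.+1, (ss s).2) = ph (ss s) /\ ph ((ss s).1, (ss s).2.+1) = ph (ss s)
     /\ ph ((ss s).1.+1, (ss s).2.+1) = ph (ss s).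
  move=> Ms; have [a b] := ss_lt s.
  have hE k l (hk : (k < n)%N) (hl : (l <= n)%N) : kd2 s (eh m k l) != 0 -> ph (k.+1, l) = ph (k, l).
    move=> f; have := H (eh m k l); rewrite /tgt /src ee_eh //; apply.
    by apply/existsP; exists s; rewrite Ms.
  have hU k l (hk : (k <= n)%N) (hl : (l < n)%N) : kd2 s (eu m k l) != 0 -> ph (k, l.+1) = ph (k, l).
    move=> f; have := H (eu m k l); rewrite /tgt /src ee_eu //; apply.
    by apply/existsP; exists s; rewrite Ms.
  have e1 := @hE (ss s).1 (ss s).2 a (ltnW b).
  have e2 := @hU (ss s).1 (ss s).2 (ltnW a) b.
  have e3 := @hE (ss s).1 (ss s).2.+1 a b.
  move: e1 e2 e3; rewrite /kd2 !ee_eh ?ee_eu ?(ltnW a) ?(ltnW b) // /nd2; case: (ss s) => i j /= e1 e2 e3.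
  by rewrite e3 ?e1 ?e2 //; lia.
have C s (v : V) : M s -> corner (ss s) (vv v) -> ph (vv v) = ph (ss s).
  move=> /edges; rewrite /corner; case: (ss s) (vv v) => i j [k l] /= [e1 [e2 e3]] /andP [/andP [a b] /andP [c d]].
  have [->|->] : k = i \/ k = i.+1 by lia.
    by have [->|->] : l = j \/ l = j.+1 by lia.
  by have [->|->] : l = j \/ l = j.+1 by lia.
move=> v w /existsP [s /andP [Ms cs]] /existsP [s' /andP [Ms' cs']].
rewrite (C _ _ Ms cs) (C _ _ Ms' cs').
apply: (Mind (ph := fun s => ph (ss s))) => // t t' Mt Mt' /orP [] /eqP ->; by have [e1 [e2 _]] := edges t Mt.
Qed.

Definition lrel := [rel v w : V | [exists e : E, LE e && (((vv v == src e) && (vv w == tgt e)) || ((vv w == src e) && (vv v == tgt e)))]].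

Lemma lrel_sym : symmetric lrel.
Proof. by move=> v w; apply: eq_existsb => e; rewrite orbC. Qed.

Lemma lconn_sym : connect_sym lrel.
Proof. exact: sym_connect_sym lrel_sym. Qed.

Lemma lrel_edge e : LE e -> lrel (mkv m (src e)) (mkv m (tgt e)).
Proof. by move=> Le; apply/existsP; exists e; rewrite Le !vv_mkv ?inV_src ?inV_tgt // !eqxx. Qed.

Lemma lrel_LV v w : lrel v w -> LV v && LV w.
Proof.
case/existsP=> e /andP [/LE_LV [a b] /orP [] /andP [/eqP h1 /eqP h2]];
 by rewrite -(mkv_vv v) -(mkv_vv w) h1 h2 a b.
Qed.

Lemma lconn_LV v w : connect lrel v w -> LV v -> LV w.
Proof.
case/connectP=> q; elim: q v => [|x q IH] v /=; first by move=> _ ->.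
by move=> /andP [/lrel_LV /andP [_ Lx] /IH H] /H {}H _; apply: H.
Qed.

Lemma lconn_chain v w : connect lrel v w -> exists z : E -> Z, (forall e, z e != 0 -> LE e) /\
  forall u, \sum_e z e * kd1 e u = bz (u == w) - bz (u == v).
Proof.
case/connectP=> q; elim: q v => [|x q IH] v /=.
  by move=> _ ->; exists (fun _ => 0); split=> [e|u]; rewrite ?eqxx // subrr big1 // => e _; rewrite mul0r.
move=> /andP [vx pq] wl; have [z [z1 z2]] := IH x pq wl.
have {vx}[e [c [Le He]]] : exists e (c : Z), LE e /\ forall u, c * kd1 e u = bz (u == x) - bz (u == v).
  case/existsP: vx => e /andP [Le /orP [] /andP [/eqP h1 /eqP h2]]; exists e.
    by exists 1; split=> // u; rewrite mul1r /kd1 -h1 -h2 !(inj_eq (@vv_inj m)).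
  by exists (-1); split=> // u; rewrite mulN1r /kd1 -h1 -h2 !(inj_eq (@vv_inj m)) opprB.
exists (fun e' => z e' + c * bz (e' == e)); split.
  move=> e' nz; case: (eqVneq e' e) nz => [-> //|_]; rewrite -[bz false]/(0 : Z) mulr0 addr0; exact: z1.
move=> u; under eq_bigr do rewrite mulrDl.
rewrite big_split /= z2 (bigD1 e) //= eqxx -[bz true]/(1 : Z) mulr1 He big1 ?addr0; first by lia.
by move=> e' /negPf ->; rewrite -[bz false]/(0 : Z) mulr0 mul0r.
Qed.

(* The grid has no first cohomology, so a locally constant function on the frontier of M
   is the difference of locally constant functions on L and on M. *)
Lemma front_const (u : V -> Z) :
  (forall e, LE e -> ME e -> u (mkv m (src e)) = u (mkv m (tgt e))) ->
  forall v w, front v -> front w -> connect lrel v w -> u v = u w.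
Proof.
move=> Hu.
(* Extend u by 0, take the coboundary, and cut it off outside the edges of M. *)
pose ut (x : nat * nat) := if front (mkv m x) then u (mkv m x) else 0.
pose be (r : bool * (nat * nat)) := ut (ntgt r) - ut (nsrc r).
pose be' (e : E) : Z := if ME e then be (ee e) else 0.
have beL e : LE e -> be' e = 0.
  move=> Le; rewrite /be'; case: ifP => // Me; rewrite /be /ut.
  have [a b] := LE_LV Le; have [c d] := ME_MV Me.
  by rewrite -/(tgt e) -/(src e) /front a b c d /= Hu // subrr.
(* The cut-off cochain is closed: on squares of M it is an exact coboundary, and on squares of L it
   vanishes because u agrees along edges common to L and M. *)
have cl s : \sum_e kd2 s e * be' e = 0.
  case Ms: (M s); last first.
    rewrite big1 // => e _; case: (eqVneq (kd2 s e) 0) => [->|nz]; first by rewrite mul0r.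
    by rewrite beL ?mulr0 //; apply/existsP; exists s; rewrite Ms.
  transitivity (\sum_e kd2 s e * be (ee e)).
    apply: eq_bigr => e _; case: (eqVneq (kd2 s e) 0) => [->|nz]; first by rewrite !mul0r.
    rewrite /be' ifT //; apply/existsP; exists s; by rewrite Ms.
  rewrite sum_kd2 /be /ntgt /nsrc; case: (ss s) => i j /=.
  lia.
(* The transposed contraction gives a primitive W. It is constant on components of L, while [W - ut]
   is constant on M. *)
pose W (v : V) := \sum_e kh0 v e * be' e.
have dW e : \sum_w kd1 e w * W w = be' e.
  have : \sum_e' (\sum_s kh1 e s * kd2 s e' + \sum_w kd1 e w * kh0 w e') * be' e' = be' e.
    rewrite (bigD1 e) //= khh1 eqxx -[bz true]/(1 : Z) mul1r big1 ?addr0 // => e' ne.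
    by rewrite khh1 eq_sym (negPf ne) -[bz false]/(0 : Z) mul0r.
  under eq_bigr do rewrite mulrDl.
  rewrite big_split /= => H; rewrite -[RHS]H.
  have -> : \sum_i (\sum_s kh1 e s * kd2 s i) * be' i = 0.
    under eq_bigr do rewrite mulr_suml.
    rewrite exchange_big /= big1 // => s _.
    under eq_bigr do rewrite -mulrA.
    by rewrite -mulr_sumr cl mulr0.
  rewrite add0r /W; under eq_bigr do rewrite mulr_sumr.
  rewrite exchange_big /=; apply: eq_bigr => e' _; rewrite mulr_suml; apply: eq_bigr => w _.
  by rewrite mulrA.
pose nW (x : nat * nat) := W (mkv m x).
have dW' e : nW (tgt e) - nW (src e) = be' e.
  rewrite -dW -(sum_kd1 e nW); apply: eq_bigr => w _; by rewrite /nW mkv_vv.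
have WL v w : connect lrel v w -> W v = W w.
  case/connectP=> q; elim: q v => [|x q IH] v /=; first by move=> _ ->.
  move=> /andP [vx pq] wl; rewrite -(IH x pq wl); case/existsP: vx => e /andP [Le].
  have := dW' e; rewrite (beL _ Le) => /eqP; rewrite subr_eq0 => /eqP.
  by rewrite /nW => Ee /orP [] /andP [/eqP h1 /eqP h2]; rewrite -(mkv_vv v) -(mkv_vv x) h1 h2 Ee.
have WM := @MV_const (fun x => nW x - ut x).
have {}WM : forall v w, MV v -> MV w -> nW (vv v) - ut (vv v) = nW (vv w) - ut (vv w).
  apply: WM => e Me; have := dW' e; rewrite /be' Me /be -/(tgt e) -/(src e); lia.
move=> v w fv fw vw; have := WL _ _ vw.
have /andP [_ mv] := fv; have /andP [_ mw] := fw.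
have := WM v w mv mw; rewrite /nW /ut !mkv_vv fv fw; lia.
Qed.
End Region.

(** * Exit maps *)

Section ExitMap.
Variable m : nat.
Let n := m.+1.
Local Notation V := (Vt m).
Local Notation E := (Et m).
Local Notation S := (St m).
Variable M : pred S.
Hypothesis Mind : forall ph : S -> Z, (forall s s', M s -> M s' -> adj4 s s' -> ph s = ph s') ->
  forall s s', M s -> M s' -> ph s = ph s'.
Variables (a : nat * nat -> nat * nat) (d0 : V).
Hypothesis aV : forall p, inV m (a p).
Hypothesis hd0 : LV M d0.
Hypothesis frontV : forall v, front M v -> LV M (av a v).
Hypothesis frontF : forall e e' : E, LE M e -> ME M e -> kF1 a e e' != 0 -> LE M e'.

(** The indicator of a component of L is constant along edges of L. Evaluating it on the boundary of
    the image chain, which is carried by L, shows that both ends lie in the same component. *)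
Lemma front_edge (e : E) : LE M e -> ME M e -> connect (lrel M) (av a (mkv m (src e))) (av a (mkv m (tgt e))).
Proof.
move=> Le Me; set v0 := av a _.
pose ph (x : nat * nat) := bz (connect (lrel M) v0 (mkv m x)).
have phL e' : LE M e' -> ph (tgt e') = ph (src e').
  move=> Le'; have H : connect (lrel M) (mkv m (src e')) (mkv m (tgt e')) by apply: connect1; apply: lrel_edge.
  rewrite /ph; congr bz; apply/idP/idP => K.
    by apply: connect_trans K _; rewrite lconn_sym.
  exact: connect_trans K H.
have E1 : \sum_w (\sum_e' kF1 a e e' * kd1 e' w) * ph (vv w) = ph (a (tgt e)) - ph (a (src e)).
  under eq_bigr => w _ do rewrite lch_d1 // mulrBl.
  by rewrite sumrB !sum_vertex.
have E2 : \sum_w (\sum_e' kF1 a e e' * kd1 e' w) * ph (vv w) = 0.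
  under eq_bigr do rewrite mulr_suml.
  rewrite exchange_big /= big1 // => e' _.
  under eq_bigr do rewrite -mulrA.
  rewrite -mulr_sumr sum_kd1; case: (eqVneq (kF1 a e e') 0) => [->|nz]; first by rewrite mul0r.
  by rewrite phL ?subrr ?mulr0 //; apply: frontF nz.
have : ph (a (tgt e)) = ph (a (src e)) by apply/eqP; rewrite -subr_eq0 -E1 E2.
rewrite /ph (_ : mkv m (a (src e)) = v0); last by rewrite /v0 /av vv_mkv ?inV_src.
rewrite connect0 (_ : mkv m (a (tgt e)) = av a (mkv m (tgt e))); last by rewrite /av vv_mkv ?inV_tgt.
by case: connect.
Qed.

(** [front_const] is applied to the indicator of the component of [av a v]. This makes psi well
    defined: frontier pieces separated along M may still bound one component of L. *)
Lemma front_conn v w : front M v -> front M w -> connect (lrel M) v w -> connect (lrel M) (av a v) (av a w).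
Proof.
move=> fv fw vw.
have := @front_const m M Mind (fun x => bz (connect (lrel M) (av a v) (av a x))) _ v w fv fw vw.
rewrite connect0 => H; have {}H := H _; case: connect H => // H; suff: bz true = bz false by [].
apply: H => e Le Me; congr bz; have K := front_edge Le Me; apply/idP/idP => K'.
  exact: connect_trans K' K.
by apply: connect_trans K' _; rewrite lconn_sym.
Qed.

(* A component of L goes to the component that contains the images of its frontier vertices. *)
Definition psi (v : V) : V := if [pick v' | front M v' && connect (lrel M) v v'] is Some v' then fingraph.root (lrel M) (av a v') else d0.

Lemma psi_LV v : LV M (psi v).
Proof.
rewrite /psi; case: pickP => [v' /andP [fv _]|_] //.
exact: lconn_LV (connect_root _ _) (frontV fv).
Qed.

Lemma psi_lrel v w : lrel M v w -> psi v = psi w.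
Proof.
move=> vw; rewrite /psi; congr (if _ is Some v' then _ else d0); apply: eq_pick => x /=; congr (_ && _).
apply: same_connect => //; [exact: lconn_sym | exact: connect1].
Qed.

Lemma psi_front v : front M v -> connect (lrel M) (av a v) (psi v).
Proof.
move=> fv; rewrite /psi; case: pickP => [v' /andP [fv' vv']|/(_ v)]; last by rewrite fv connect0.
exact: connect_trans (front_conn fv fv' vv') (connect_root _ _).
Qed.

(** A value of psi is the root of the component of some frontier image, and the bucket of that image
    determines the component; the extra value is the default [d0]. *)
Lemma psi_count C (bk : V -> 'I_C) :
  (forall v w, front M v -> front M w -> bk (av a v) = bk (av a w) -> connect (lrel M) (av a v) (av a w)) ->
  (#|[set psi v | v : V]| <= C.+1)%N.
Proof.
move=> H; pose co (c : option 'I_C) : V := if c is Some c then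
  (if [pick v' | front M v' && (bk (av a v') == c)] is Some v' then fingraph.root (lrel M) (av a v') else d0) else d0.
have -> : C.+1 = #|[set: option 'I_C]| by rewrite cardsT card_option card_ord.
apply: leq_trans (leq_imset_card co _); apply/subset_leq_card/subsetP => x /imsetP [v _ ->] {x}.
rewrite /psi; case: pickP => [v' /andP [fv _]|_]; last by apply/imsetP; exists None; rewrite ?inE.
apply/imsetP; exists (Some (bk (av a v'))); rewrite ?inE //= .
case: pickP => [w /andP [fw /eqP bw]|/(_ v')]; last by rewrite fv eqxx.
by apply/eqP; rewrite root_connect; [apply: H | apply: lconn_sym].
Qed.

Definition psiI (i : 'I_#|{: V}|) : 'I_#|{: V}| := enum_rank (psi (enum_val i)).
Definition LVi (i : 'I_#|{: V}|) : bool := LV M (enum_val i).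
Definition LEi (i : 'I_#|{: E}|) : bool := LE M (enum_val i).
Definition LSi (i : 'I_#|{: S}|) : bool := ~~ M (enum_val i).
Let aI (i : 'I_#|{: V}|) : 'I_#|{: V}| := enum_rank (av a (enum_val i)).

Lemma notLE_M (e : E) s : ~~ LE M e -> kd2 s e != 0 -> M s.
Proof. by move=> /existsPn /(_ s) H nz; move: H; rewrite nz andbT negbK. Qed.

Definition bdE (e : E) : bool := if (ee e).1 then ((ee e).2.2 == 0%N) || ((ee e).2.2 == n) else ((ee e).2.1 == 0%N) || ((ee e).2.1 == n).

Let ny (y : 'rV[Z]_#|{: S}|) q := y 0 (enum_rank (mks m q)).

Let y_edge (y : 'rV[Z]_#|{: S}|) e : (y *m D2 m) 0 (enum_rank e) = 
  if (ee e).1 then (if ((ee e).2.2 < n)%N then ny y (ee e).2 else 0) - (if (0 < (ee e).2.2)%N then ny y ((ee e).2.1, (ee e).2.2.-1) else 0)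
  else (if (0 < (ee e).2.1)%N then ny y ((ee e).2.1.-1, (ee e).2.2) else 0) - (if ((ee e).2.1 < n)%N then ny y (ee e).2 else 0).
Proof.
rewrite -op_d2 mxE sum_rank; apply: eq_bigr => s _; rewrite mxEr /ny; congr (y _ (enum_rank _) * _).
by case: s => i j; rewrite /mks /= !inord_val.
Qed.

Let cyc_y (z : 'rV[Z]_#|{: E}|) : z *m D1 m = 0 -> (z *m H1 m) *m D2 m = z.
Proof. by move=> hz; rewrite -mulmxA -[in RHS](mulmx1 z) -(H1D2 m) mulmxDr (mulmxA z (D1 m)) hz mul0mx addr0. Qed.

Let ny_ss y s : ny y (ss s) = y 0 (enum_rank s).
Proof. by case: s => i j; rewrite /ny /mks /= !inord_val. Qed.

(** The cycle z is the boundary of [z *m H1]. Across the common edge of two adjacent squares of M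
    this 2-chain cannot change, since z vanishes on that edge. *)
Lemma region_cyc_const (z : 'rV[Z]_#|{: E}|) : z *m D1 m = 0 -> (forall j, z 0 j != 0 -> LEi j) ->
  exists t, forall i, ~~ LSi i -> (z *m H1 m) 0 i = t.
Proof.
move=> hz supp; have yE := cyc_y hz; set y := z *m H1 m in yE *.
have H : forall s s', M s -> M s' -> y 0 (enum_rank s) = y 0 (enum_rank s').
  apply: (Mind (ph := fun s => y 0 (enum_rank s))) => s s' Ms Ms' hss.
  (* The common edge of two squares of M is a face of no other square, hence not an edge of L. *)
  have [e [E1 E2]] : exists e, ((y *m D2 m) 0 (enum_rank e) = ny y (ss s) - ny y (ss s') \/
     (y *m D2 m) 0 (enum_rank e) = ny y (ss s') - ny y (ss s)) /\ forall t, kd2 t e != 0 -> t = s \/ t = s'.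
    have := ss_lt s; have := ss_lt s'; move: hss; rewrite /adj4.
    case Es: (ss s) => [i j]; case Es': (ss s') => [i' j'] /= hss [b1 b2] [a1 a2].
    case/orP: hss => /eqP [hi hj]; rewrite {}hi {}hj in b1 b2 Es' *.
      exists (eu m i.+1 j); rewrite y_edge /kd2 ee_eu //= b1; split; first by left.
      move=> t nz.
      have : ss t = ss s \/ ss t = ss s'.
        rewrite Es Es'; move: nz; rewrite /nd2; case: (ss t) => k l /= nz.
        have [[-> ->]|[-> ->]] : (k = i /\ l = j) \/ (k = i.+1 /\ l = j); [lia | by left | by right].
      by case=> /ss_inj; auto.
    exists (eh m i j.+1); rewrite y_edge /kd2 ee_eh //= b2; split; first by right.
    move=> t nz.
    have : ss t = ss s \/ ss t = ss s'.
      rewrite Es Es'; move: nz; rewrite /nd2; case: (ss t) => k l /= nz.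
      have [[-> ->]|[-> ->]] : (k = i /\ l = j) \/ (k = i /\ l = j.+1); [lia | by left | by right].
    by case=> /ss_inj; auto.
  have z0 : z 0 (enum_rank e) = 0.
    apply/eqP; apply: contraT => /supp; rewrite /LEi enum_rankK => /existsP [t /andP [Mt /E2]].
    by case=> te; move: Mt; rewrite te ?Ms ?Ms'.
  by case: E1; rewrite yE z0 !ny_ss => /esym /eqP; rewrite subr_eq0 => /eqP ->.
case: (pickP M) => [s0 Ms0|M0].
  exists (y 0 (enum_rank s0)) => i; rewrite /LSi negbK => Mi.
  by rewrite -[i in LHS]enum_valK; apply: H.
by exists 0 => i; rewrite /LSi negbK M0.
Qed.

(** An edge on the border of the grid has a single square. If the edge is off L, that square is in M
    and its coefficient is up to sign that of the edge in z, which is 0. *)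
Lemma region_touch (z : 'rV[Z]_#|{: E}|) : z *m D1 m = 0 -> (forall j, z 0 j != 0 -> LEi j) ->
  (exists e, ~~ LE M e && bdE e) -> forall i, ~~ LSi i -> (z *m H1 m) 0 i = 0.
Proof.
move=> hz supp [e /andP [Le bd]] i Mi.
have [t Ht] := region_cyc_const hz supp; rewrite (Ht i Mi).
have yE := cyc_y hz; set y := z *m H1 m in yE Ht *.
have z0 : z 0 (enum_rank e) = 0.
  by apply/eqP; apply: contraT => /supp; rewrite /LEi enum_rankK => H; rewrite H in Le.
have Hn q : (q.1 < n)%N -> (q.2 < n)%N -> nd2 q (ee e) != 0 -> ny y q = t.
  move=> q1 q2 hq; apply: Ht; rewrite /LSi negbK enum_rankK; apply: notLE_M Le _.
  by rewrite /kd2 ss_mks.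
have := y_edge y e; rewrite yE z0.
have := inV_tgt e; rewrite /inV /tgt /ntgt.
move: bd Hn; rewrite /bdE; case: (ee e) => [[] [k l]] /= bd Hn /andP [hk hl].
- case: (ltnP l n) => ln.
    have l0 : (0 < l)%N = false by lia.
    have -> : ny y (k, l) = t by apply: Hn; rewrite /nd2 /=; lia.
    by rewrite l0 subr0 => /esym.
  have l0 : (0 < l)%N by rewrite /n in ln *; lia.
  have -> : ny y (k, l.-1) = t by apply: Hn; rewrite /nd2 /=; lia.
  by rewrite l0 sub0r => /esym /eqP; rewrite oppr_eq0 => /eqP.
- case: (ltnP k n) => ln.
    have l0 : (0 < k)%N = false by lia.
    have -> : ny y (k, l) = t by apply: Hn; rewrite /nd2 /=; lia.
    by rewrite l0 sub0r => /esym /eqP; rewrite oppr_eq0 => /eqP.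
  have l0 : (0 < k)%N by rewrite /n in ln *; lia.
  have -> : ny y (k.-1, l) = t by apply: Hn; rewrite /nd2 /=; lia.
  by rewrite l0 subr0 => /esym.
Qed.

(** An edge off L is now interior to the grid and has squares of M on both sides, whose
    contributions cancel. *)
Lemma region_inner : ~ (exists e, ~~ LE M e && bdE e) -> forall j, ~~ LEi j -> \sum_(i | ~~ LSi i) (D2 m) i j = 0.
Proof.
move=> nb j Lj; set e := enum_val j in Lj; rewrite -(enum_valK j) -/e.
have nbe : ~~ bdE e by apply/negP => be; apply: nb; exists e; rewrite be andbT.
transitivity ((\row_i bz (~~ LSi i) *m D2 m) 0 (enum_rank e)).
  rewrite mxE big_mkcond; apply: eq_bigr => i _; rewrite [X in _ = X * _]mxE.
  by case: (LSi i); rewrite /= ?mul1r -?[bz false]/(0 : Z) ?mul0r //.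
rewrite y_edge.
have Hn q : (q.1 < n)%N -> (q.2 < n)%N -> nd2 q (ee e) != 0 -> ny (\row_i bz (~~ LSi i)) q = 1.
  move=> q1 q2 hq; rewrite /ny mxE /LSi negbK enum_rankK (@notLE_M e) //.
  by rewrite /kd2 ss_mks.
have := inV_tgt e; rewrite /inV /tgt /ntgt.
move: nbe Hn; rewrite /bdE; case: (ee e) => [[] [k l]] /= bd Hn /andP [hk hl].
- have [-> ->] : (l < n)%N = true /\ (0 < l)%N = true by lia.
  rewrite !Hn /nd2 /= ?subrr //; lia.
- have [-> ->] : (k < n)%N = true /\ (0 < k)%N = true by lia.
  rewrite !Hn /nd2 /= ?subrr //; lia.
Qed.

Lemma region_trace N (q : S) : M q ->
  (forall i, ((pj (predC LSi) *m F2 m a *m pj (predC LSi)) ^+ N) i (enum_rank q) = 0) -> forall k,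
  \tr ((pj (predC LVi) *m F0 m a *m pj (predC LVi)) ^+ k.+1) - \tr ((pj (predC LEi) *m F1 m a *m pj (predC LEi)) ^+ k.+1)
   + \tr ((pj (predC LSi) *m F2 m a *m pj (predC LSi)) ^+ k.+1)
  = 1 - #|[pred i | LVi i && (iter k.+1 psiI i == i)]|%:R.
Proof.
move=> Mq hN k.
(* For a frontier vertex, [front_conn] provides a path inside L from its image to its value under
   psi; these paths are the rows of K. *)
have HK v : exists z : E -> Z, (forall e, z e != 0 -> LE M e) /\
   forall u, \sum_e z e * kd1 e u = if front M v then bz (u == psi v) - bz (u == av a v) else 0.
  case fv: (front M v); first exact: lconn_chain (psi_front fv).
  by exists (fun _ => 0); split=> // u; rewrite big1 // => e _; rewrite mul0r.
have [Kf HKf] := fin_all_exists HK.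
pose K : 'M[Z]_(#|{: V}|, #|{: E}|) := mx Kf.
have psiL i : LVi i -> LVi (psiI i) by move=> _; rewrite /LVi /psiI enum_rankK psi_LV.
pose psi' i := if LVi i then psiI i else aI i.
have d1row e (phi : 'I_#|{: V}| -> 'I_#|{: V}|) j : (D1 m *m fmx phi) (enum_rank e) j =
   bz (j == phi (enum_rank (mkv m (tgt e)))) - bz (j == phi (enum_rank (mkv m (src e)))).
  rewrite mxE sum_rank; under eq_bigr => v _ do rewrite mxEr mxE.
  rewrite -(sum_kd1 e (fun x => bz (j == phi (enum_rank (mkv m x))))).
  by apply: eq_bigr => v _; rewrite mkv_vv; case: (_ == _).
have psiE i : LEi i -> forall j, (D1 m *m fmx psi') i j = 0.
  rewrite -[i]enum_valK /LEi enum_rankK => Le j; rewrite d1row /psi' /LVi !enum_rankK.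
  have [l1 l2] := LE_LV Le; rewrite l1 l2 /psiI !enum_rankK (psi_lrel (lrel_edge Le)) subrr //.
have LSE i j : LSi i -> D2 m i j != 0 -> LEi j.
  by rewrite mxE /LSi => Ms nz; apply/existsP; exists (enum_val i); rewrite Ms.
have KE i j : K i j != 0 -> LEi j by rewrite mxE => /(proj1 (HKf _)).
have Kbd i j l : ~~ LEi i -> D1 m i j != 0 -> (F0 m a + K *m D1 m) j l = fmx psi' j l.
  move=> Li; rewrite mxE => nz; rewrite mx_addE.
  have Mj : MV M (enum_val j).
    have [h1 h2] := ME_MV (notLE_ME Li).
    move: nz; rewrite /kd1 -[in MV M _](mkv_vv (enum_val j)).
    by case: (_ =P tgt _) => [-> //|_]; case: (_ =P src _) => [-> //|_].
  rewrite -[j]enum_valK -[l]enum_valK; set v := enum_val j in Mj *; set w := enum_val l.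
  have -> : (K *m D1 m) (enum_rank v) (enum_rank w) = if front M v then bz (w == psi v) - bz (w == av a v) else 0.
    rewrite -(proj2 (HKf v)) mxE sum_rank; apply: eq_bigr => e _; by rewrite !mxEr.
  rewrite !mxE /psi' /LVi !enum_rankK /front Mj andbT; case Lv: (LV M v); last by rewrite addr0 /aI enum_rankK.
  rewrite /psiI enum_rankK !(inj_eq enum_rank_inj); by case: (w == av a v); case: (w == psi v).
have frontE i j l : ~~ LSi i -> D2 m i j != 0 -> LEi j -> F1 m a j l != 0 -> LEi l.
  rewrite /LSi negbK !mxE => Mi nz Lj; apply: frontF => //.
  by apply/existsP; exists (enum_val i); rewrite Mi.
have cc := region_cyc_const.
(* Either M reaches the border of the grid, and the constant in [region_cyc_const] is 0, or the
   rank-one correction is removed by the zero column at q. *)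
case: (pickP [pred e | ~~ LE M e && bdE e]) => [e He|He].
  apply: (exit_trace_touch (D21 m) (H0D1 m) (H1D2 m) (D2H1 m) (F_chain aV) psiL psiE LSE KE Kbd frontE) => z hz supp.
  by apply: region_touch => //; exists e.
apply: (exit_trace_inner (D21 m) (H0D1 m) (H1D2 m) (D2H1 m) (F_chain aV) psiL psiE LSE KE Kbd frontE cc) _ _ hN.
- by apply: region_inner => -[e]; have := He e => /= ->.
- by rewrite /LSi enum_rankK negbK.
Qed.
End ExitMap.

Local Open Scope nat_scope.

(** * Periodic points of finite maps *)

Section Cycles.
Variables (T : finType) (psi : T -> T).

Definition cyc x := iter (order psi x) psi x == x.

Lemma cycP x : reflect (exists2 n, 0 < n & iter n psi x = x) (cyc x).
Proof.
apply: (iffP eqP) => [H|[n n0 H]]; first by exists (order psi x) => //; apply: order_gt0.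
by apply: (all_iffLR (@orbitPcycle T psi x) 3 4); exists n.-1; rewrite prednK.
Qed.

Lemma iter_order_mul x k : cyc x -> iter (k * order psi x) psi x = x.
Proof. by move/eqP=> H; elim: k => [|k IH] //; rewrite mulSn iterD IH H. Qed.

Lemma iter_fixE x n : cyc x -> (iter n psi x == x) = (order psi x %| n).
Proof.
move=> cx; have [q [r [E hr]]] : exists q r, n = q * order psi x + r /\ r < order psi x.
  by exists (n %/ order psi x), (n %% order psi x); rewrite -divn_eq ltn_mod order_gt0.
rewrite E addnC iterD iter_order_mul // dvdn_addl ?dvdn_mull //.
case: r hr {E} => [|r] hr; first by rewrite eqxx dvdn0.
rewrite gtnNdvd //; apply/negbTE/eqP => Er.
by have := findex_iter hr; rewrite Er findex0.
Qed.

Lemma cyc_psi x : cyc x -> cyc (psi x) /\ order psi (psi x) = order psi x.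
Proof.
move=> cx; split; last by apply: (all_iffLR (@orbitPcycle T psi x) 4 1); apply/eqP.
by apply/cycP; exists (order psi x); rewrite ?order_gt0 // -iterSr iterS (eqP cx).
Qed.

Lemma cyc_iter n x : cyc x -> cyc (iter n psi x) /\ order psi (iter n psi x) = order psi x.
Proof.
move=> cx; elim: n => [|n [IH1 IH2]] //=.
by have [-> ->] := cyc_psi IH1.
Qed.

Lemma cyc_sym x y : cyc x -> fconnect psi x y -> fconnect psi y x.
Proof.
move=> cx /iter_findex <-; set k := findex _ _ _.
have kl : k <= k.+1 * order psi x by apply: leq_trans (leqnSn k) _; rewrite leq_pmulr // order_gt0.
by rewrite -{2}(iter_order_mul k.+1 cx) -(subnK kl) iterD fconnect_iter.
Qed.

Variable L : pred T.
Hypothesis Lpsi : forall x, L x -> L (psi x).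

Let Liter n x : L x -> L (iter n psi x).
Proof. by move=> Lx; elim: n => //= n; apply: Lpsi. Qed.

Definition cyc_set d := [set x | L x && cyc x && (order psi x == d)].

(** The points of period d are partitioned into orbits of exactly d elements. *)
Lemma cyc_set_dvd d : d %| #|cyc_set d|.
Proof.
set D := cyc_set d; pose R := [rel x y | fconnect psi x y].
have eqR : {in D & &, equivalence_rel R}.
  move=> x y z; rewrite !inE => /andP [/andP [_ cx] _] /andP [/andP [_ cy] _] _ /=.
  split=> // xy; apply/idP/idP; apply: connect_trans => //; exact: cyc_sym.
have P := equivalence_partitionP eqR.
rewrite (@card_uniform_partition _ d _ _ _ P) ?dvdn_mull // => B /imsetP [x xD ->].
move: (xD); rewrite !inE => /andP [/andP [Lx cx] /eqP dx].
rewrite -[RHS]dx /order; apply: eq_card => y; rewrite !inE /=.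
case xy : (fconnect psi x y); last by rewrite andbF.
rewrite andbT; move/iter_findex: (xy) => <-.
by have [-> ->] := cyc_iter (findex psi x y) cx; rewrite dx eqxx Liter.
Qed.

Lemma count_fix C n : #|[set x | L x && cyc x]| <= C -> 0 < n ->
  #|[pred x | L x && (iter n psi x == x)]| =
  \sum_(1 <= d < C.+1 | d %| n) d * (#|cyc_set d| %/ d).
Proof.
move=> hC n0.
(* The orbit of a periodic point of L consists of such points, so its length is at most C. *)
have ordC x : L x -> cyc x -> 1 <= order psi x < C.+1.
  move=> Lx cx; rewrite order_gt0 ltnS; apply: leq_trans hC.
  apply: subset_leq_card; apply/subsetP => y; rewrite !inE => xy.
  by move/iter_findex: xy => <-; rewrite Liter //; have [-> _] := cyc_iter (findex psi x y) cx.
under eq_bigr do rewrite mulnC divnK ?cyc_set_dvd //.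
rewrite -sum1_card.
transitivity (\sum_(x | L x && cyc x && (order psi x %| n)) 1).
  apply: eq_bigl => x; rewrite inE.
  case Lx : (L x) => //=; case cx : (cyc x) => /=; first by rewrite iter_fixE.
  by apply/negbTE; apply: contraFN cx => /eqP H; apply/cycP; exists n.
under [RHS]eq_bigr do rewrite -sum1_card.
rewrite [RHS](exchange_big_dep (fun x => L x && cyc x && (order psi x %| n))) /=; last first.
  by move=> d x dn; rewrite !inE => /andP [-> /eqP ->].
apply: eq_bigr => x /andP [/andP [Lx cx] on].
rewrite (big_rem (order psi x)) /= ?mem_index_iota ?ordC //.
rewrite on inE Lx cx eqxx /= big1_seq // => d /andP [/andP [_ xd]].
move: xd; rewrite inE => /andP [_ /eqP <-].
by rewrite mem_rem_uniq ?iota_uniq // inE eqxx.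
Qed.

Lemma cyc_exists x : L x -> exists2 y, L y & cyc y.
Proof.
move=> Lx; exists (iter (order psi x) psi x); first exact: Liter.
have /loopingP H := looping_order psi x.
have := H (order psi x) => /trajectP [i hi E].
apply/cycP; exists (order psi x - i); first by rewrite subn_gt0.
by rewrite {1}E -iterD subnK // ltnW.
Qed.
End Cycles.

End Grid.

Module Plane.
From mathcomp Require Import all_boot ssralg zmodp matrix.
From mathcomp Require Import zify ssrZ.
Import Grid.
Set Implicit Arguments. Unset Strict Implicit. Unset Printing Implicit Defensive.
Import GRing.Theory.
Local Open Scope nat_scope.

(** * Divisor sums *)

Definition dsum (C : nat) (al : nat -> nat) n := \sum_(1 <= d < C.+1 | d %| n) d * al d.
Definition posal (C : nat) (al : nat -> nat) := exists d, 0 < d <= C /\ 0 < al d.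

Lemma dsum_split C al n : 0 < n <= C -> dsum C al n = n * al n + \sum_(1 <= d < n | d %| n) d * al d.
Proof.
move=> /andP [n0 nC]; rewrite /dsum (big_cat_nat (n := n)) //=; last exact: leqW.
rewrite addnC (big_ltn_cond (m := n)) ?ltnS // dvdnn big_nat_cond big1 ?addn0 // => d.
by move=> /andP [/andP [nd _] /(dvdn_leq n0)]; lia.
Qed.

(** The system is triangular: the value at n determines [al n] once the coefficients at smaller
    indices are known. *)
Lemma dsum_inj C al al' : (forall n, 0 < n <= C -> dsum C al n = dsum C al' n) -> forall d, 0 < d <= C -> al d = al' d.
Proof.
move=> H d; elim/ltn_ind: d => n IH hn; have := H n hn; rewrite !dsum_split //.
have -> : \sum_(1 <= d < n | d %| n) d * al d = \sum_(1 <= d < n | d %| n) d * al' d.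
  rewrite big_nat_cond [RHS]big_nat_cond; apply: eq_bigr => d /andP [/andP [d1 d2] _].
  by rewrite IH //; lia.
by move/addIn/eqP; rewrite eqn_pmul2l; [move/eqP | lia].
Qed.

Lemma dsum_full C al n : C`! %| n -> dsum C al n = \sum_(1 <= d < C.+1) d * al d.
Proof.
move=> hn; rewrite /dsum big_mkcond big_nat_cond [RHS]big_nat_cond; apply: eq_bigr => d /andP [/andP [d1 d2] _].
by rewrite (dvdn_trans (dvdn_fact _) hn) // d1.
Qed.

Lemma dsum_le C al n : dsum C al n <= \sum_(1 <= d < C.+1) d * al d.
Proof. by rewrite /dsum big_mkcond; apply: leq_sum => d _; case: ifP. Qed.

Section Arithmetic.
Variables (b : nat -> Z) (k0 : nat).
Hypothesis k00 : 0 < k0.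
Hypothesis block : forall k, k0 <= k -> exists C, forall nmax, exists al, posal C al /\
  forall n, 0 < n <= nmax -> b (n * k) = Z.of_nat (dsum C al n).
Hypothesis congr_b : forall q m, prime q -> 0 < m -> exists c, b (q * m) = (b m + c * Z.of_nat q)%Z.

(** The coefficients may depend on [nmax], but C does not, and the first C values already determine
    all of them. So the coefficients found for [nmax = C] work for every n. *)
Lemma block_all k : k0 <= k -> exists C al, posal C al /\ forall n, 0 < n -> b (n * k) = Z.of_nat (dsum C al n).
Proof.
move=> hk; have [C H] := block hk; have [al [pa Ha]] := H C; exists C, al; split=> // n n0.
have [al' [_ Ha']] := H (maxn C n).
rewrite Ha'; last by rewrite n0 leq_maxr.
congr Z.of_nat; rewrite /dsum big_nat_cond [RHS]big_nat_cond; apply: eq_bigr => d /andP [/andP [d1 d2] _].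
congr (_ * _); apply: (@dsum_inj C) => [j hj|]; last by rewrite d1.
by apply: Nat2Z.inj; rewrite -Ha // -Ha' //; lia.
Qed.

(** For a sufficiently divisible argument [dsum] equals its full coefficient sum. Evaluating b at a
    common multiple of m and k0 shows that the sums for k = m and k = k0 coincide. *)
Lemma block_bound : exists P, forall m, k0 <= m -> (0 <= b m <= Z.of_nat P)%Z.
Proof.
have [C [al [_ H]]] := block_all (leqnn k0).
exists (\sum_(1 <= d < C.+1) d * al d) => m hm.
have [C' [al' [_ H']]] := block_all hm.
have m0 : 0 < m by lia.
have E := H' 1%N isT; rewrite mul1n in E; rewrite E.
suff <- : \sum_(1 <= d < C'.+1) d * al' d = \sum_(1 <= d < C.+1) d * al d by have := dsum_le C' al' 1; lia.
(* Divisible by every index that occurs in either sum. *)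
pose X := C`! * C'`!; have X0 : 0 < X by rewrite muln_gt0 !fact_gt0.
rewrite -(@dsum_full C' al' (k0 * X)); last by rewrite /X !dvdn_mull.
rewrite -(@dsum_full C al (m * X)); last by rewrite /X dvdn_mull // dvdn_mulr.
have p1 : 0 < k0 * X by rewrite muln_gt0 k00.
have p2 : 0 < m * X by rewrite muln_gt0 m0.
apply: Nat2Z.inj; rewrite -(H' _ p1) -(H _ p2).
by rewrite mulnAC (mulnC k0 m) (mulnAC m).
Qed.

Lemma periodic_count : exists C al, posal C al /\ forall n, 0 < n -> b n = Z.of_nat (dsum C al n).
Proof.
have [P HP] := block_bound.
have bP n : 0 < n -> (0 <= b n <= Z.of_nat P)%Z.
  (* The prime is so large that a nonzero multiple of it would carry [b n] out of [0, P], whereas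
     [b (q * n)] lies in that interval. *)
  move=> n0; have [q hq pq] := prime_above (k0 + Z.abs_nat (b n) + P + P).
  have [c Hc] := congr_b pq n0.
  have qn : k0 <= q * n by have := leq_pmulr q n0; lia.
  have := HP _ qn; rewrite Hc => B.
  have c0 : c = 0%Z by nia.
  by move: B; rewrite c0 Z.mul_0_l Z.add_0_r.
(* Now that all values lie in [0, P], one prime above P serves all n simultaneously, and it is also
   an admissible k. *)
have [q hq pq] := prime_above (k0 + P).
have [C [al [pa H]]] := @block_all q ltac:(lia).
exists C, al; split=> // n n0; rewrite -H // mulnC.
have [c Hc] := congr_b pq n0.
have B1 := bP n n0; have B2 := bP (q * n) ltac:(by rewrite muln_gt0 prime_gt0).
rewrite Hc in B2 *.
have -> : c = 0%Z by nia.
by lia.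
Qed.
End Arithmetic.

Local Open Scope R_scope.

(** * From crossings to winding numbers *)

Lemma turn_refl g t w k : cpath g -> (k < 4)%N -> snd w <> 0 -> 0 < hp k w -> 0 < hp k (g t) -> turn g t w t w 0.
Proof.
move=> hg /ltP hk hw h1 h2.
have H := turn_step g t w t w k hg (Rle_refl t) hk hw hw h1 h1.
have -> : 0%Z = crossing k w w by rewrite /crossing; case: k {hk h1 h2 H} => // ; rewrite Z.sub_diag.
by apply: H => s hs; have -> : s = t by lra.
Qed.

Lemma turn_seq g (t : nat -> R) (W : nat -> pt) (c : nat -> Z) lo hi : (lo <= hi)%N ->
  turn g (t lo) (W lo) (t lo) (W lo) 0 ->
  (forall i, (lo <= i < hi)%N -> turn g (t i) (W i) (t i.+1) (W i.+1) (c i)) ->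
  turn g (t lo) (W lo) (t hi) (W hi) (\sum_(lo <= i < hi) c i)%R.
Proof.
move=> lh T0 H; elim: hi lh H => [|hi IH].
  by rewrite leqn0 => /eqP lo0 _; subst lo; rewrite big_geq.
rewrite leq_eqVlt => /orP [/eqP <- _|lh H]; first by rewrite big_geq.
rewrite big_nat_recr //=; apply: turn_trans (IH lh _) _; last by apply: H; rewrite -ltnS lh /=.
by move=> i /andP [li ih]; apply: H; rewrite li ltnW.
Qed.

(* The position of [x] relative to [v] as seen from the half plane number [k], with a margin. *)
Definition off (k : nat) (v x : nat * nat) : bool :=
  match k with
  | 0 => x.1 + 2 <= v.1 | 1 => x.2 + 2 <= v.2 | 2 => v.1 + 2 <= x.1 | _ => v.2 + 2 <= x.2
  end%N.
Definition adj (v w : nat * nat) : bool :=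
  [&& v.1 <= w.1.+1, w.1 <= v.1.+1, v.2 <= w.2.+1 & w.2 <= v.2.+1]%N.

(** The displacement v - y in grid units, moved up or down by a quarter of a step so that it never
    meets the cut. The sign is -1 on the bottom and right sides of the square and 1 on the top and
    left sides. *)
Definition nodeW (s : R) (v y : nat * nat) : pt := (INR v.1 - INR y.1, INR v.2 + s / 4 - INR y.2).

Lemma INR_leq a b : (a <= b)%N -> INR a <= INR b.
Proof. by move=> h; apply: le_INR; lia. Qed.

Lemma nodeW_snd s v y : s = 1 \/ s = -1 -> snd (nodeW s v y) <> 0.
Proof.
move=> hs /=; case: (leqP y.2 v.2) => h; case: (leqP v.2 y.2) => h'.
- have -> : v.2 = y.2 by lia. case: hs => ->; lra.
- have := @INR_leq y.2.+1 v.2 h'; rewrite S_INR; case: hs => ->; lra.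
- have := @INR_leq v.2.+1 y.2 h; rewrite S_INR; case: hs => ->; lra.
- by lia.
Qed.

Lemma upz_nodeW_minus v y : upz (nodeW (-1) v y) = bz (y.2 < v.2)%N.
Proof.
rewrite /upz /=; case: Rlt_dec => h; case: ltnP => h' //=.
- have := INR_leq h'; lra.
- have := INR_leq h'; rewrite S_INR; lra.
Qed.
Lemma upz_nodeW_plus v y : upz (nodeW 1 v y) = bz (y.2 <= v.2)%N.
Proof.
rewrite /upz /=; case: Rlt_dec => h; case: leqP => h' //=.
- have := INR_leq h'; rewrite S_INR; lra.
- have := INR_leq h'; lra.
Qed.

Lemma hp_nodeW s k v w y : s = 1 \/ s = -1 -> adj v w -> off k v y -> 0 < hp k (nodeW s w y).
Proof.
move=> hs /and4P [a1 a2 a3 a4]; case: k => [|[|[|k]]] /= h.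
- have : (y.1.+1 <= w.1)%N by lia. move=> /INR_leq; rewrite S_INR; lra.
- have : (y.2.+1 <= w.2)%N by lia. move=> /INR_leq; rewrite S_INR; case: hs => ->; lra.
- have : (w.1.+1 <= y.1)%N by lia. move=> /INR_leq; rewrite S_INR; lra.
- have : (w.2.+1 <= y.2)%N by lia. move=> /INR_leq; rewrite S_INR; case: hs => ->; lra.
Qed.

Section Boundary.
Variable m : nat.
Local Notation n := m.+1.
Local Notation E := (Et m).
Variables (b : nat * nat -> nat * nat) (Ph : E -> E -> Z).
Hypothesis bV : forall p, inV m (b p).
Hypothesis chP : forall (e : E) (w : Vt m), (\sum_e' Ph e e' * kd1 e' w)%R = (bz (vv w == b (tgt e)) - bz (vv w == b (src e)))%Z.
Variables (k : nat) (v : nat * nat).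
Hypothesis offb : forall w, adj v w -> off k v (b w).
Hypothesis offP : forall e e', adj v (src e) -> Ph e e' != 0%R -> off k v (src e').

Let supp_u e i j : (i <= n)%N -> (j < n)%N -> adj v (src e) -> ~~ off k v (i, j) -> Ph e (eu m i j) = 0%R.
Proof.
move=> hi hj ae; apply: contraNeq => /(offP ae); rewrite /src ee_eu //.
Qed.

(** In half plane 0 all images lie to the left, so the half line count equals that of the whole line
    and depends only on end heights. In the other half planes the images avoid the half line. *)
Lemma cross_right j : v = (v.1, j) -> (v.1 < n)%N -> (j < n)%N ->
  (YY v.1.+1 j (b v) - XX v.1.+1 j (Ph (eu m v.1 j)))%Z
  = crossing k (nodeW (-1) v (b v)) (nodeW (-1) (v.1, j.+1) (b (v.1, j.+1))).
Proof.
move=> Ev hv hj.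
have av : adj v v by rewrite /adj; lia.
have av' : adj v (v.1, j.+1) by rewrite Ev /adj /=; lia.
have o := offb av; have o' := offb av'.
have se : src (eu m v.1 j) = v by rewrite /src ee_eu //= 1?ltnW // -Ev.
have te : tgt (eu m v.1 j) = (v.1, j.+1) by rewrite /tgt ee_eu //= ltnW.
have sup i : (i <= n)%N -> ~~ off k v (i, j) -> Ph (eu m v.1 j) (eu m i j) = 0%R.
  by move=> hi; apply: supp_u => //; rewrite se.
have V2 : v.2 = j by rewrite Ev.
rewrite /crossing; case: k o o' sup => [|[|[|k']]] /= o o' sup.
- rewrite (XX_left bV chP) //; first 1 last.
  + by lia.
  + by move=> i hi; apply: sup; lia.
  rewrite !upz_nodeW_minus se te /YY /= V2; lia.
- rewrite XX_none; last by move=> i hi; apply: sup; lia.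
  by rewrite /YY (_ : _ && _ = false) //; lia.
- rewrite XX_none; last by move=> i hi; apply: sup; lia.
  by rewrite /YY (_ : _ && _ = false) //; lia.
- rewrite XX_none; last by move=> i hi; apply: sup; lia.
  by rewrite /YY (_ : _ && _ = false) //; lia.
Qed.

(** The shift changes sign at a corner, which alters the crossing count exactly when the image is in
    the same row to the left. *)
Lemma cross_corner_up : YY v.1.+1 v.2 (b v) = crossing k (nodeW (-1) v (b v)) (nodeW 1 v (b v)).
Proof.
have av : adj v v by rewrite /adj; lia.
have o := offb av.
rewrite /crossing /YY; case: k o => [|[|[|k']]] /= o; rewrite ?upz_nodeW_minus ?upz_nodeW_plus /=; lia.
Qed.

Lemma cross_corner_down : (- YY v.1 v.2 (b v))%Z = crossing k (nodeW 1 v (b v)) (nodeW (-1) v (b v)).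
Proof.
have av : adj v v by rewrite /adj; lia.
have o := offb av.
rewrite /crossing /YY; case: k o => [|[|[|k']]] /= o; rewrite ?upz_nodeW_minus ?upz_nodeW_plus /=; lia.
Qed.

Lemma cross_top i : v = (i.+1, v.2) -> (i < n)%N -> (v.2 < n)%N ->
  XX i.+1 v.2 (Ph (eh m i v.2)) = crossing k (nodeW 1 v (b v)) (nodeW 1 (i, v.2) (b (i, v.2))).
Proof.
move=> Ev hi hv.
have av : adj v v by rewrite /adj; lia.
have av' : adj v (i, v.2) by rewrite Ev /adj /=; lia.
have o := offb av; have o' := offb av'.
have se : src (eh m i v.2) = (i, v.2) by rewrite /src ee_eh //= ltnW.
have te : tgt (eh m i v.2) = v by rewrite /tgt ee_eh //= 1?ltnW // -Ev.
have sup l : (l <= n)%N -> ~~ off k v (l, v.2) -> Ph (eh m i v.2) (eu m l v.2) = 0%R.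
  by move=> hl; apply: supp_u => //; rewrite se.
have V1 : v.1 = i.+1 by rewrite Ev.
rewrite /crossing; case: k o o' sup => [|[|[|k']]] /= o o' sup.
- rewrite (XX_left bV chP) //; first 1 last.
  + by lia.
  + by move=> l hl; apply: sup; lia.
  rewrite !upz_nodeW_plus se te /=; lia.
- by rewrite XX_none // => l hl; apply: sup; lia.
- by rewrite XX_none // => l hl; apply: sup; lia.
- by rewrite XX_none // => l hl; apply: sup; lia.
Qed.

Lemma cross_left j : v = (v.1, j.+1) -> (v.1 < n)%N -> (j < n)%N ->
  (XX v.1 j (Ph (eu m v.1 j)) - YY v.1 j.+1 (b v))%Z
  = crossing k (nodeW 1 v (b v)) (nodeW 1 (v.1, j) (b (v.1, j))).
Proof.
move=> Ev hv hj.
have av : adj v v by rewrite /adj; lia.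
have av' : adj v (v.1, j) by rewrite Ev /adj /=; lia.
have o := offb av; have o' := offb av'.
have se : src (eu m v.1 j) = (v.1, j) by rewrite /src ee_eu //= 1?ltnW.
have te : tgt (eu m v.1 j) = v by rewrite /tgt ee_eu //= 1?ltnW // -Ev.
have sup i : (i <= n)%N -> ~~ off k v (i, j) -> Ph (eu m v.1 j) (eu m i j) = 0%R.
  by move=> hi; apply: supp_u => //; rewrite se.
have V2 : v.2 = j.+1 by rewrite Ev.
rewrite /crossing; case: k o o' sup => [|[|[|k']]] /= o o' sup.
- rewrite (XX_left bV chP) //; first 1 last.
  + by lia.
  + by move=> i hi; apply: sup; lia.
  rewrite !upz_nodeW_plus se te /YY /= V2; lia.
- rewrite XX_none; last by move=> i hi; apply: sup; lia.
  by rewrite /YY (_ : _ && _ = false) //; lia.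
- rewrite XX_none; last by move=> i hi; apply: sup; lia.
  by rewrite /YY (_ : _ && _ = false) //; lia.
- rewrite XX_none; last by move=> i hi; apply: sup; lia.
  by rewrite /YY (_ : _ && _ = false) //; lia.
Qed.

Lemma cross_bottom i : v = (i, v.2) -> (i < n)%N -> (0 < v.2 < n)%N ->
  (- XX i.+1 v.2.-1 (Ph (eh m i v.2)))%Z = crossing k (nodeW (-1) v (b v)) (nodeW (-1) (i.+1, v.2) (b (i.+1, v.2))).
Proof.
move=> Ev hi /andP [hv0 hv].
have av : adj v v by rewrite /adj; lia.
have av' : adj v (i.+1, v.2) by rewrite Ev /adj /=; lia.
have o := offb av; have o' := offb av'.
have se : src (eh m i v.2) = v by rewrite /src ee_eh //= 1?ltnW // -Ev.
have te : tgt (eh m i v.2) = (i.+1, v.2) by rewrite /tgt ee_eh //= 1?ltnW.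
have sup l : (l <= n)%N -> ~~ off k v (l, v.2.-1) -> Ph (eh m i v.2) (eu m l v.2.-1) = 0%R.
  by move=> hl; apply: supp_u => //; [lia | rewrite se].
have V1 : v.1 = i by rewrite Ev.
rewrite /crossing; case: k o o' sup => [|[|[|k']]] /= o o' sup.
- rewrite (XX_left bV chP) //; first 1 last.
  + by lia.
  + by lia.
  + by move=> l hl; apply: sup; lia.
  rewrite !upz_nodeW_minus se te /=; lia.
- by rewrite XX_none // => l hl; apply: sup; lia.
- by rewrite XX_none // => l hl; apply: sup; lia.
- by rewrite XX_none // => l hl; apply: sup; lia.
Qed.
End Boundary.

Section Square.
Variable m : nat.
Local Notation n := m.+1.
Local Notation E := (Et m).
Variables (b : nat * nat -> nat * nat) (Ph : E -> E -> Z).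
Hypothesis bV : forall p, inV m (b p).
Hypothesis chP : forall (e : E) (w : Vt m), (\sum_e' Ph e e' * kd1 e' w)%R = (bz (vv w == b (tgt e)) - bz (vv w == b (src e)))%Z.
Variables (p : pt) (c l : nat) (dl : R) (G : pt -> pt).
Hypothesis dl0 : 0 < dl.
Hypothesis l0 : (0 < l)%N.
Hypothesis lc : (l < c)%N.
Hypothesis cn : (c + l < n)%N.
Let lo := (c - l)%N.
Let hi := (c + l)%N.
Definition gpos (v : nat * nat) : pt := (fst p + dl * (INR v.1 - INR c), snd p + dl * (INR v.2 - INR c)).
Definition onb (v : nat * nat) : bool :=
  [&& lo <= v.1 <= hi, lo <= v.2 <= hi & [|| v.1 == lo, v.1 == hi, v.2 == lo | v.2 == hi]]%N.
Hypothesis HV : forall v, onb v -> exists k, (k < 4)%N /\ (forall w, adj v w -> off k v (b w)) /\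
  (forall e e', adj v (src e) -> Ph e e' != 0%R -> off k v (src e')) /\
  (forall x, nd x (gpos v) <= dl -> 0 < hp k (psub x (G x))).
Let rho := INR l * dl.
Let ga t := psub (sq p rho t) (G (sq p rho t)).
Hypothesis cga : cpath ga.

(** The time at which the square path reaches the i-th node on side s, counted from [lo] in the
    direction of travel. *)
Let tm (s : R) (i : nat) : R := (s + (INR i - INR lo) / (2 * INR l)) / 4.

Let lR : 1 <= INR l. Proof. by apply: (le_INR 1); lia. Qed.
Let Ilo : INR lo = INR c - INR l. Proof. by rewrite /lo minus_INR //; lia. Qed.
Let Ihi : INR hi = INR c + INR l. Proof. by rewrite /hi plus_INR. Qed.
Let rev_INR i : (i <= hi)%N -> INR (lo + hi - i)%N = 2 * INR c - INR i.
Proof.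
move=> h; have -> : (lo + hi - i = c + c - i)%N by rewrite /lo /hi; lia.
by rewrite minus_INR ?plus_INR; [lra | rewrite /hi in h; lia].
Qed.

Let tmE s i : 4 * tm s i - s = (INR i - INR lo) / (2 * INR l).
Proof. by rewrite /tm; field; lra. Qed.

Let mult_u s t : rho * (2 * (4 * t - s)) = dl * (2 * INR l * (4 * t - s)).
Proof. by rewrite /rho; ring. Qed.

Let tm_between s i t : (lo <= i < hi)%N -> tm s i <= t <= tm s i.+1 ->
  INR i - INR lo <= 2 * INR l * (4 * t - s) <= INR i + 1 - INR lo /\ s <= 4 * t <= s + 1.
Proof.
move=> /andP [h1 h2] [t1 t2].
have e1 := tmE s i; have e2 := tmE s i.+1; rewrite S_INR in e2.
have q1 : 2 * INR l * ((INR i - INR lo) / (2 * INR l)) = INR i - INR lo by field; lra.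
have q2 : 2 * INR l * ((INR i + 1 - INR lo) / (2 * INR l)) = INR i + 1 - INR lo by field; lra.
have i1 := INR_leq h1; have i2 := INR_leq h2; rewrite S_INR in i2.
have A : INR i - INR lo <= 2 * INR l * (4 * t - s) <= INR i + 1 - INR lo by split; nra.
split=> //; split; nra.
Qed.

Let tm_lo s : tm s lo = s / 4. Proof. by rewrite /tm; field; lra. Qed.
Let tm_hi s : tm s hi = (s + 1) / 4. Proof. by rewrite /tm Ilo Ihi; field; lra. Qed.
Let tm_le s i : tm s i <= tm s i.+1.
Proof.
have e1 := tmE s i; have e2 := tmE s i.+1; rewrite S_INR in e2.
have : (INR i - INR lo) / (2 * INR l) <= (INR i + 1 - INR lo) / (2 * INR l).
  by apply: Rmult_le_compat_r; [left; apply: Rinv_0_lt_compat; lra | lra].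
lra.
Qed.

Let ndI x y d : Rabs (fst x - fst y) <= d -> Rabs (snd x - snd y) <= d -> nd x y <= d.
Proof. by move=> h1 h2; apply/nd_le. Qed.

Let rab x d : - d <= x <= d -> Rabs x <= d.
Proof. by move=> h; apply: Rabs_le. Qed.

Let step s v w (sg sg' : R) t t' k (z : Z) : onb v ->
  (k < 4)%N -> (forall w, adj v w -> off k v (b w)) -> (forall x, nd x (gpos v) <= dl -> 0 < hp k (psub x (G x))) ->
  adj v w -> (sg = 1 \/ sg = -1) -> (sg' = 1 \/ sg' = -1) -> t <= t' ->
  (forall u, t <= u <= t' -> nd (sq p rho u) (gpos v) <= dl) ->
  z = crossing k (nodeW sg v (b v)) (nodeW sg' w (b w)) ->
  s = tt -> turn ga t (nodeW sg v (b v)) t' (nodeW sg' w (b w)) z.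
Proof.
move=> ov hk ho hG avw h1 h2 tt' hn -> _.
have avv : adj v v by rewrite /adj; lia.
apply: turn_step => //.
- exact/ltP.
- exact: nodeW_snd.
- exact: nodeW_snd.
- by apply: (@hp_nodeW _ _ v) => //; apply: ho.
- by apply: (@hp_nodeW _ _ v) => //; apply: ho.
- by move=> u hu; apply: hG; apply: hn.
Qed.

Let near0 i t : (lo <= i < hi)%N -> tm 0 i <= t <= tm 0 i.+1 -> nd (sq p rho t) (gpos (hi, i)) <= dl.
Proof.
move=> hi1 ht; have [A B] := tm_between hi1 ht; have M := mult_u 0 t.
rewrite sq_0; last lra.
apply: ndI; apply: rab; rewrite /= ?Ihi; rewrite Ilo in A; rewrite /rho in M *; nra.
Qed.
Let near1 i t : (lo <= i < hi)%N -> tm 1 i <= t <= tm 1 i.+1 -> nd (sq p rho t) (gpos (lo + hi - i, hi)%N) <= dl.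
Proof.
move=> hi1 ht; have [A B] := tm_between hi1 ht; have M := mult_u 1 t.
have R := @rev_INR i; rewrite sq_1; last lra.
apply: ndI; apply: rab; rewrite /= ?Ihi ?R; try (rewrite Ilo in A; rewrite /rho in M *; nra); lia.
Qed.
Let near2 i t : (lo <= i < hi)%N -> tm 2 i <= t <= tm 2 i.+1 -> nd (sq p rho t) (gpos (lo, lo + hi - i)%N) <= dl.
Proof.
move=> hi1 ht; have [A B] := tm_between hi1 ht; have M := mult_u 2 t.
have R := @rev_INR i; rewrite sq_2; last lra.
apply: ndI; apply: rab; rewrite /= ?Ilo ?R; try (rewrite Ilo in A; rewrite /rho in M *; nra); lia.
Qed.
Let near3 i t : (lo <= i < hi)%N -> tm 3 i <= t <= tm 3 i.+1 -> nd (sq p rho t) (gpos (i, lo)) <= dl.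
Proof.
move=> hi1 ht; have [A B] := tm_between hi1 ht; have M := mult_u 3 t.
rewrite sq_3; last lra.
apply: ndI; apply: rab; rewrite /= ?Ilo; rewrite Ilo in A; rewrite /rho in M *; nra.
Qed.

Let node_refl v sg t : onb v -> (sg = 1 \/ sg = -1) -> nd (sq p rho t) (gpos v) <= dl ->
  turn ga t (nodeW sg v (b v)) t (nodeW sg v (b v)) 0.
Proof.
move=> ov hs hn; have [k [hk [ho [_ hG]]]] := HV ov.
have avv : adj v v by rewrite /adj; lia.
apply: (@turn_refl _ _ _ k) => //.
- exact: nodeW_snd.
- by apply: (@hp_nodeW _ _ v) => //; apply: ho.
- exact: hG.
Qed.

Let lohi : (lo < hi)%N. Proof. rewrite /lo /hi; lia. Qed.
Let hin : (hi < n)%N. Proof. exact: cn. Qed.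
Let lo0 : (0 < lo)%N. Proof. rewrite /lo; lia. Qed.

Let side0 : turn ga 0 (nodeW (-1) (hi, lo) (b (hi, lo))) (/ 4) (nodeW 1 (hi, hi) (b (hi, hi)))
  (right_sum b Ph lo hi).
Proof.
(* There is one node more than there are edges; the term of the upper right corner pays for the
   change of shift there. *)
have -> : right_sum b Ph lo hi =
  (\sum_(lo <= j < hi) (YY hi.+1 j (b (hi, j)) - XX hi.+1 j (Ph (eu m hi j))) + YY hi.+1 hi (b (hi, hi)))%R.
  by rewrite /right_sum big_nat_recr 1?ltnW //= sumrB addrAC.
have T1 : turn ga (tm 0 lo) (nodeW (-1) (hi, lo) (b (hi, lo))) (tm 0 hi) (nodeW (-1) (hi, hi) (b (hi, hi)))
   (\sum_(lo <= j < hi) (YY hi.+1 j (b (hi, j)) - XX hi.+1 j (Ph (eu m hi j))))%R.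
  apply: (@turn_seq ga (tm 0) (fun j => nodeW (-1) (hi, j) (b (hi, j)))); first exact: ltnW.
    apply: node_refl; [by rewrite /onb /=; lia | by right |].
    by apply: near0; [lia | split; [lra | exact: tm_le]].
  move=> j hj; have ov : onb (hi, j) by rewrite /onb /=; lia.
  have [k [hk [ho [hP hG]]]] := HV ov.
  apply: (@step tt (hi, j) (hi, j.+1) _ _ _ _ k) => //; try by right.
  - by rewrite /adj /=; lia.
  - by move=> u hu; apply: near0.
  - by apply: (cross_right bV chP ho hP) => //=; lia.
rewrite tm_lo tm_hi (_ : 0 / 4 = 0) in T1; last lra.
rewrite (_ : (0 + 1) / 4 = / 4) in T1; last lra.
apply: turn_trans T1 _.
have ov : onb (hi, hi) by rewrite /onb /=; lia.
have [k [hk [ho [hP hG]]]] := HV ov.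
apply: (@step tt (hi, hi) (hi, hi) _ _ _ _ k) => //; [by rewrite /adj /=; lia | by right | by left | lra | | ].
- move=> u hu; have -> : u = tm 1 lo by rewrite tm_lo; lra.
  have -> : (hi, hi) = (lo + hi - lo, hi)%N by congr (_, _); lia.
  by apply: near1; [lia | split; [lra | exact: tm_le]].
- exact: (cross_corner_up ho).
Qed.

Let side1 : turn ga (/ 4) (nodeW 1 (hi, hi) (b (hi, hi))) (/ 2) (nodeW 1 (lo, hi) (b (lo, hi)))
  (top_sum Ph lo hi).
Proof.
rewrite /top_sum big_nat_rev /=.
have T1 : turn ga (tm 1 lo) (nodeW 1 (lo + hi - lo, hi)%N (b (lo + hi - lo, hi)%N)) (tm 1 hi) (nodeW 1 (lo + hi - hi, hi)%N (b (lo + hi - hi, hi)%N))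
   (\sum_(lo <= i < hi) XX (lo + hi - i.+1).+1 hi (Ph (eh m (lo + hi - i.+1) hi)))%R.
  apply: (@turn_seq ga (tm 1) (fun i => nodeW 1 (lo + hi - i, hi)%N (b (lo + hi - i, hi)%N))); first exact: ltnW.
    apply: node_refl; [by rewrite /onb /=; lia | by left |].
    by apply: near1; [lia | split; [lra | exact: tm_le]].
  move=> j hj; have ov : onb (lo + hi - j, hi)%N by rewrite /onb /=; lia.
  have [k [hk [ho [hP hG]]]] := HV ov.
  apply: (@step tt (lo + hi - j, hi)%N (lo + hi - j.+1, hi)%N _ _ _ _ k) => //; try by left.
  - by rewrite /adj /=; lia.
  - by move=> u hu; apply: near1.
  - by apply: (cross_top bV chP ho hP) => //=; [congr (_, _) |]; lia.
rewrite tm_lo tm_hi (_ : 1 / 4 = / 4) in T1; last lra.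
rewrite (_ : (1 + 1) / 4 = / 2) in T1; last lra.
have e1 : (lo + hi - lo = hi)%N by lia.
have e2 : (lo + hi - hi = lo)%N by lia.
by rewrite e1 e2 in T1.
Qed.

Let side2 : turn ga (/ 2) (nodeW 1 (lo, hi) (b (lo, hi))) (3 / 4) (nodeW (-1) (lo, lo) (b (lo, lo)))
  (left_sum b Ph lo hi).
Proof.
(* The side is traversed downwards, and the node left over is the lower left corner, where the shift
   changes back. *)
have -> : left_sum b Ph lo hi =
  (\sum_(lo <= i < hi) (XX lo (lo + hi - i.+1) (Ph (eu m lo (lo + hi - i.+1))) - YY lo (lo + hi - i.+1).+1 (b (lo, (lo + hi - i.+1).+1))) - YY lo lo (b (lo, lo)))%R.
  rewrite /left_sum -(big_nat_rev _ _ _ _ xpredT (fun j => XX lo j (Ph (eu m lo j)) - YY lo j.+1 (b (lo, j.+1)))%R).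
  rewrite sumrB (@big_nat_recl _ _ _ hi lo (fun j => YY lo j (b (lo, j)))) ?opprD; last exact: ltnW.
  move: (\sum_(lo <= i < hi) XX _ _ _)%R (\sum_(lo <= i < hi) YY _ _ _)%R (YY _ _ _) => x y z; lia.
have T1 : turn ga (tm 2 lo) (nodeW 1 (lo, lo + hi - lo)%N (b (lo, lo + hi - lo)%N)) (tm 2 hi) (nodeW 1 (lo, lo + hi - hi)%N (b (lo, lo + hi - hi)%N))
  (\sum_(lo <= i < hi) (XX lo (lo + hi - i.+1) (Ph (eu m lo (lo + hi - i.+1))) - YY lo (lo + hi - i.+1).+1 (b (lo, (lo + hi - i.+1).+1))))%R.
  apply: (@turn_seq ga (tm 2) (fun i => nodeW 1 (lo, lo + hi - i)%N (b (lo, lo + hi - i)%N))); first exact: ltnW.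
    apply: node_refl; [by rewrite /onb /=; lia | by left |].
    by apply: near2; [lia | split; [lra | exact: tm_le]].
  move=> j hj; have ov : onb (lo, lo + hi - j)%N by rewrite /onb /=; lia.
  have [k [hk [ho [hP hG]]]] := HV ov.
  apply: (@step tt (lo, lo + hi - j)%N (lo, lo + hi - j.+1)%N _ _ _ _ k) => //; try by left.
  - by rewrite /adj /=; lia.
  - by move=> u hu; apply: near2.
  - have e : (lo + hi - j = (lo + hi - j.+1).+1)%N by lia.
    rewrite e; rewrite e in ho hP; apply: (cross_left bV chP ho hP) => //=; lia.
rewrite tm_lo tm_hi (_ : 2 / 4 = / 2) in T1; last lra.
rewrite (_ : (2 + 1) / 4 = 3 / 4) in T1; last lra.
have e1 : (lo + hi - lo = hi)%N by lia. have e2 : (lo + hi - hi = lo)%N by lia. rewrite e1 e2 in T1.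
apply: turn_trans T1 _.
have ov : onb (lo, lo) by rewrite /onb /=; lia.
have [k [hk [ho [hP hG]]]] := HV ov.
apply: (@step tt (lo, lo) (lo, lo) _ _ _ _ k) => //; [by rewrite /adj /=; lia | by left | by right | lra | | ].
- move=> u hu; have -> : u = tm 3 lo by rewrite tm_lo; lra.
  by apply: near3; [lia | split; [lra | exact: tm_le]].
- exact: (cross_corner_down ho).
Qed.

Let side3 : turn ga (3 / 4) (nodeW (-1) (lo, lo) (b (lo, lo))) 1 (nodeW (-1) (hi, lo) (b (hi, lo)))
  (bottom_sum Ph lo hi).
Proof.
have -> : bottom_sum Ph lo hi = (\sum_(lo <= i < hi) - XX i.+1 lo.-1 (Ph (eh m i lo)))%R by rewrite sumrN.
have T1 : turn ga (tm 3 lo) (nodeW (-1) (lo, lo) (b (lo, lo))) (tm 3 hi) (nodeW (-1) (hi, lo) (b (hi, lo)))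
   (\sum_(lo <= i < hi) - XX i.+1 lo.-1 (Ph (eh m i lo)))%R.
  apply: (@turn_seq ga (tm 3) (fun i => nodeW (-1) (i, lo) (b (i, lo)))); first exact: ltnW.
    apply: node_refl; [by rewrite /onb /=; lia | by right |].
    by apply: near3; [lia | split; [lra | exact: tm_le]].
  move=> j hj; have ov : onb (j, lo) by rewrite /onb /=; lia.
  have [k [hk [ho [hP hG]]]] := HV ov.
  apply: (@step tt (j, lo) (j.+1, lo) _ _ _ _ k) => //; try by right.
  - by rewrite /adj /=; lia.
  - by move=> u hu; apply: near3.
  - by apply: (cross_bottom bV chP ho hP) => //=; lia.
rewrite tm_lo tm_hi in T1.
by rewrite (_ : (3 + 1) / 4 = 1) in T1; last lra.
Qed.

Lemma winding_square : (forall t, 0 <= t <= 1 -> ga t <> (0, 0)) ->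
  winding_number ga (right_sum b Ph lo hi + top_sum Ph lo hi + left_sum b Ph lo hi + bottom_sum Ph lo hi)%R.
Proof.
move=> hn; apply: (turn_closed _ _ _ cga _ hn); first by rewrite /ga sq_closed.
exact: turn_trans (turn_trans _ _ _ _ _ _ _ _ _ (turn_trans _ _ _ _ _ _ _ _ _ side0 side1) side2) side3.
Qed.
End Square.

(** * Discretization of a planar map *)

(* [y] lies in the bounding box of the images of the corners of the cell based at [x]. *)
Definition stp (a : nat * nat -> nat * nat) (x y : nat * nat) : Prop :=
  exists w1 w2 w3 w4, [&& corner x w1, corner x w2, corner x w3 & corner x w4] /\
    [&& (a w1).1 <= y.1, y.1 <= (a w2).1, (a w3).2 <= y.2 & y.2 <= (a w4).2]%N.

Lemma corner_refl x : corner x x. Proof. by rewrite /corner; lia. Qed.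

Lemma stp_map a x : stp a x (a x).
Proof. by exists x, x, x, x; rewrite !corner_refl /= !leqnn. Qed.

Section Support.
Variables (m : nat) (a : nat * nat -> nat * nat).
Hypothesis aV : forall p, inV m (a p).

Lemma corner_src e : corner (@src m e) (src e). Proof. exact: corner_refl. Qed.
Lemma corner_tgt e : corner (@src m e) (tgt e).
Proof. by case: e => -[[i hi] [j hj]]; rewrite /corner /src /tgt /=; lia. Qed.

Lemma stp_F0 v w : F0 m a (enum_rank v) (enum_rank w) != 0%R -> stp a (vv v) (vv w).
Proof.
rewrite -[F0 m a]expr1 F0_exp //=.
by case: (vv w =P a (vv v)) => [-> _|//]; apply: stp_map.
Qed.

Lemma stp_F1 e e' : F1 m a (enum_rank e) (enum_rank e') != 0%R -> stp a (src e) (src e').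
Proof.
rewrite mxEr /kF1 /lch => H.
have cs := corner_src e; have ct := corner_tgt e.
move: H; rewrite /src; case: (ee e') => -[] [k l] /=; rewrite -/(src e).
  case E1 : (_ && _); first by move=> _; exists (src e), (tgt e), (src e), (src e); rewrite cs ct /=; lia.
  case E2 : (_ && _); first by move=> _; exists (tgt e), (src e), (src e), (src e); rewrite cs ct /=; lia.
  by [].
case E1 : (_ && _); first by move=> _; exists (tgt e), (tgt e), (src e), (tgt e); rewrite cs ct /=; lia.
case E2 : (_ && _); first by move=> _; exists (tgt e), (tgt e), (tgt e), (src e); rewrite cs ct /=; lia.
by [].
Qed.

Lemma XX_lch p q k l : (k < m.+1)%N -> (l < m.+1)%N -> inV m q ->
  XX k.+1 l (fun e' : Et m => lch p q (ee e')) = (if (q.1 <= k)%N then bz (l < q.2)%N - bz (l < p.2)%N else 0)%Z.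
Proof.
move=> hk hl /andP [q1 q2]; rewrite /XX.
transitivity (\sum_(i < k.+1) bz (i == q.1 :> nat) * (bz (l < q.2)%N - bz (l < p.2)%N)%Z)%R.
  rewrite big_mkord; apply: eq_bigr => -[i hi] _; rewrite ee_eu //=; last by lia.
  rewrite /lch /=; case: (i == q.1) => /=; last by rewrite mul0r.
  rewrite mul1r; lia.
by rewrite (sum_ind k.+1 q.1 (fun _ => (bz (l < q.2)%N - bz (l < p.2)%N)%Z)) ltnS.
Qed.

(** The entry is an alternating sum that depends only on the images of the four corners, and it
    cancels when all of them lie strictly on one side of the target. *)
Lemma stp_F2 s s' : F2 m a (enum_rank s) (enum_rank s') != 0%R -> stp a (ss s) (ss s').
Proof.
have -> : F2 m a (enum_rank s) (enum_rank s') = (\sum_e kd2 s e * (- XX (ss s').1.+1 (ss s').2 (kF1 a e)))%R.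
  rewrite /F2 mxE sum_rank.
  transitivity (\sum_e' (\sum_e kd2 s e * kF1 a e e') * kh1 e' s')%R.
    apply: eq_bigr => e' _; rewrite mxE sum_rank /H1 mxEr; congr (_ * _)%R.
    by apply: eq_bigr => e _; rewrite /D2 /F1 !mxEr.
  under eq_bigr do rewrite mulr_suml.
  rewrite exchange_big /=; apply: eq_bigr => e _; rewrite -sum_h1 mulr_sumr.
  by apply: eq_bigr => e' _; rewrite mulrA.
have [k [l [Es' hk hl]]] : exists k l, [/\ ss s' = (k, l), (k < m.+1)%N & (l < m.+1)%N].
  by case: s' => i j; exists i, j; rewrite !ltn_ord.
rewrite Es' /=.
pose g (r : bool * (nat * nat)) : Z := (- (if ((a (ntgt r)).1 <= k)%N then bz (l < (a (ntgt r)).2)%N - bz (l < (a (nsrc r)).2)%N else 0))%Z.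
have -> : (\sum_e kd2 s e * - XX k.+1 l (kF1 a e))%R = (\sum_e kd2 s e * g (ee e))%R.
  by apply: eq_bigr => e _; congr (_ * - _)%R; rewrite /kF1 XX_lch.
rewrite sum_kd2 /g /ntgt /nsrc; case: (ss s) => i j /=.
set c00 := a (i, j); set c10 := a (i.+1, j); set c01 := a (i, j.+1); set c11 := a (i.+1, j.+1).
move=> H.
have cor x y : (x <= 1)%N -> (y <= 1)%N -> corner (i, j) (i + x, j + y)%N by rewrite /corner /=; lia.
have co : [&& corner (i, j) (i, j), corner (i, j) (i.+1, j), corner (i, j) (i, j.+1) & corner (i, j) (i.+1, j.+1)] by rewrite /corner /=; lia.
case/and4P: co => C00 C10 C01 C11.
have ex (P : nat * nat -> bool) : (P c00 || P c10 || P c01 || P c11) -> exists2 w, corner (i, j) w & P (a w).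
  by case/orP => [/orP [/orP [?|?]|?]|?]; [exists (i, j)|exists (i.+1, j)|exists (i, j.+1)|exists (i.+1, j.+1)].
have [w1 W1 P1] : exists2 w, corner (i, j) w & ((a w).1 <= k)%N.
  apply: (ex (fun c => c.1 <= k)%N); apply: contraNT H; rewrite !negb_or => /andP [/andP [/andP [_ h2] h3] h4].
  by rewrite (negPf h2) (negPf h3) (negPf h4).
have [w2 W2 P2] : exists2 w, corner (i, j) w & (k <= (a w).1)%N.
  apply: (ex (fun c => k <= c.1)%N); apply: contraNT H; rewrite !negb_or -!ltnNge => /andP [/andP [/andP [h1 h2] h3] h4].
  rewrite (ltnW h2) (ltnW h3) (ltnW h4); lia.
have [w3 W3 P3] : exists2 w, corner (i, j) w & ((a w).2 <= l)%N.
  apply: (ex (fun c => c.2 <= l)%N); apply: contraNT H; rewrite !negb_or -!ltnNge => /andP [/andP [/andP [-> ->] ->] ->].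
  by do 3 case: ifP => _.
have [w4 W4 P4] : exists2 w, corner (i, j) w & (l <= (a w).2)%N.
  apply: (ex (fun c => l <= c.2)%N); apply: contraNT H; rewrite !negb_or -!ltnNge => /andP [/andP [/andP [h1 h2] h3] h4].
  have lt0 c : (c < l)%N -> (l < c)%N = false by lia.
  by rewrite !lt0 //; do 3 case: ifP => _.
by exists w1, w2, w3, w4; rewrite W1 W2 W3 W4 P1 P2 P3 P4.
Qed.
End Support.

Definition nflo (r : R) : nat := Z.to_nat (Int_part r).

Lemma nflo_spec r : 0 <= r -> INR (nflo r) <= r < INR (nflo r) + 1.
Proof.
move=> h; have [a b] := base_Int_part r.
have hz : (0 <= Int_part r)%Z.
  have : (-1 < Int_part r)%Z by apply: lt_IZR; lra.
  by lia.
rewrite /nflo INR_IZR_INZ Z2Nat.id //; lra.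
Qed.

Definition gpos' p s h v := gpos p h (s / INR h) v.
(** Rounding down after clamping to the box. The clamp makes the grid map a self map and does not
    increase the distance to any target in the box. *)
Definition cidx (q dl : R) (h : nat) (z : R) : nat := nflo (clamp 0 (2 * INR h) ((z - q) / dl + INR h)).
Definition ah (g : pt -> pt) (p : pt) (s : R) (h : nat) (v : nat * nat) : nat * nat :=
  (cidx (fst p) (s / INR h) h (fst (g (gpos' p s h v))), cidx (snd p) (s / INR h) h (snd (g (gpos' p s h v)))).
(** The grid with parameter m has m + 1 squares per side, here [h + h], with p at the vertex (h,
    h). *)
Definition gridm (h : nat) : nat := (h + h).-1.

Lemma INR_pos h : (0 < h)%N -> 0 < INR h.
Proof. by move=> hh; apply: lt_0_INR; lia. Qed.

Lemma cidx_le q dl h z : (cidx q dl h z <= h + h)%N.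
Proof.
have hh := pos_INR h.
have c := clamp_in 0 (2 * INR h) ((z - q) / dl + INR h) ltac:(lra).
have [a _] := nflo_spec (proj1 c).
have : INR (cidx q dl h z) <= INR (h + h) by rewrite plus_INR /cidx; lra.
by move/INR_le => H; lia.
Qed.

Lemma ah_inV g p s h v : (0 < h)%N -> inV (gridm h) (ah g p s h v).
Proof.
move=> hh; rewrite /inV /=; have -> : (gridm h).+1 = (h + h)%N by rewrite /gridm; lia.
by rewrite !cidx_le.
Qed.

Lemma clamp_near a b t u e : a <= u <= b -> Rabs (t - u) <= e -> Rabs (clamp a b t - u) <= e.
Proof.
move=> hu; unfold clamp, Rmax, Rmin, Rabs; repeat destruct Rle_dec; repeat destruct Rcase_abs; lra.
Qed.

Lemma cidx_near q dl h z z0 e : (0 < h)%N -> 0 < dl -> Rabs (z0 - q) <= INR h * dl -> Rabs (z - z0) <= e ->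
  Rabs (q + dl * (INR (cidx q dl h z) - INR h) - z0) <= e + dl.
Proof.
move=> hh hd h1 h2; have hp := INR_pos hh.
set v0 := (z0 - q) / dl + INR h.
have ev : dl * (v0 - INR h) = z0 - q by rewrite /v0; field; lra.
have hv : 0 <= v0 <= 2 * INR h.
  by move: h1; rewrite /Rabs; case: Rcase_abs => hc h1; split; nra.
have hu : Rabs ((z - q) / dl + INR h - v0) <= e / dl.
  have -> : (z - q) / dl + INR h - v0 = (z - z0) / dl by rewrite /v0; field; lra.
  rewrite /Rdiv Rabs_mult (Rabs_pos_eq (/ dl)); last by left; apply: Rinv_0_lt_compat.
  by apply: Rmult_le_compat_r => //; left; apply: Rinv_0_lt_compat.
have hc := clamp_near hv hu.
have c := clamp_in 0 (2 * INR h) ((z - q) / dl + INR h) ltac:(lra).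
have [a b] := nflo_spec (proj1 c).
rewrite -/(cidx q dl h z) in a b.
set w := clamp _ _ _ in hc a b c; set k := INR (cidx q dl h z) in a b *.
have -> : q + dl * (k - INR h) - z0 = dl * (k - v0) by rewrite Rmult_minus_distr_l; rewrite Rmult_minus_distr_l in ev *; lra.
have : Rabs (k - v0) <= e / dl + 1 by move: hc; unfold Rabs; repeat destruct Rcase_abs; lra.
move=> hk; rewrite Rabs_mult (Rabs_pos_eq dl); last lra.
have -> : e + dl = dl * (e / dl + 1) by field; lra.
by apply: Rmult_le_compat_l => //; lra.
Qed.

Lemma gpos_adj p s h v w : 0 <= s -> (0 < h)%N -> adj v w -> nd (gpos' p s h w) (gpos' p s h v) <= s / INR h.
Proof.
move=> hs hh /and4P [a1 a2 a3 a4]; have hp := INR_pos hh.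
have hd : 0 <= s / INR h by apply: Rmult_le_pos => //; left; apply: Rinv_0_lt_compat.
have b1 := INR_leq a1; have b2 := INR_leq a2; have b3 := INR_leq a3; have b4 := INR_leq a4.
rewrite !S_INR in b1 b2 b3 b4.
apply/nd_le; rewrite /gpos' /gpos /=; split; apply: Rabs_le; nra.
Qed.

Lemma corner_adj x w : corner x w -> adj x w.
Proof. by rewrite /corner /adj; lia. Qed.

Lemma near_stp g p s h x y y0 e : 0 < s -> (0 < h)%N -> nd y0 p <= s -> stp (ah g p s h) x y ->
  (forall w, nd w (gpos' p s h x) <= s / INR h -> nd (g w) y0 <= e) ->
  nd (gpos' p s h y) y0 <= e + s / INR h.
Proof.
move=> hs hh hy [w1 [w2 [w3 [w4 [/and4P [c1 c2 c3 c4] /and4P [i1 i2 i3 i4]]]]]] hg.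
have hp := INR_pos hh.
have hd : 0 < s / INR h by apply: Rdiv_lt_0_compat.
have es : INR h * (s / INR h) = s by field; lra.
have C w : corner x w -> Rabs (fst (gpos' p s h (ah g p s h w)) - fst y0) <= e + s / INR h /\
    Rabs (snd (gpos' p s h (ah g p s h w)) - snd y0) <= e + s / INR h.
  move=> cw; have := hg (gpos' p s h w) (gpos_adj _ (Rlt_le _ _ hs) hh (corner_adj cw)).
  move=> /nd_le [n1 n2]; move/nd_le: hy => [y1 y2].
  split; rewrite /gpos' /gpos /=; apply: cidx_near => //; rewrite es Rabs_minus_sym //; rewrite Rabs_minus_sym //.
have [a1 _] := C _ c1; have [a2 _] := C _ c2; have [_ a3] := C _ c3; have [_ a4] := C _ c4.
have j1 := INR_leq i1; have j2 := INR_leq i2; have j3 := INR_leq i3; have j4 := INR_leq i4.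
have mon u v : u <= v -> s / INR h * (u - INR h) <= s / INR h * (v - INR h) by move=> huv; nra.
apply/nd_le; rewrite /gpos' /gpos /= in a1 a2 a3 a4 *.
have k1 := mon _ _ j1; have k2 := mon _ _ j2; have k3 := mon _ _ j3; have k4 := mon _ _ j4.
rewrite /ah /= in a1 a2 a3 a4 k1 k2 k3 k4.
split.
- move: a1 a2; unfold Rabs; repeat destruct Rcase_abs; lra.
- move: a3 a4; unfold Rabs; repeat destruct Rcase_abs; lra.
Qed.

Lemma null_mesh s sg : 0 < s -> incr sg -> null (fun j => s / INR (sg j)).
Proof.
move=> hs hi d hd.
have H : null (fun n => s * / INR (S n)).
  by apply: null_mult null_inv => n; left; apply: Rinv_0_lt_compat; apply: lt_0_INR; lia.
have [N HN] := H d hd; exists (S (S N)) => n hn.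
have hsn := incr_ge sg hi n.
have := HN (sg n - 1)%coq_nat ltac:(lia).
by have -> : (sg n - 1)%coq_nat.+1 = sg n by lia.
Qed.

(** * Convergence of discrete walks to orbits *)

Section WalkLimit.
Variables (g : pt -> pt) (p : pt) (s : R) (sg : nat -> nat).
Hypothesis hs : 0 < s.
Hypothesis hsg : incr sg.

Lemma step_cv (x y : nat -> nat * nat) X : (forall j, stp (ah g p s (sg j)) (x j) (y j)) ->
  cv (fun j => gpos' p s (sg j) (x j)) X -> contat g X -> nd (g X) p <= s ->
  cv (fun j => gpos' p s (sg j) (y j)) (g X).
Proof.
move=> hst hx hc hX e he.
have [d [hd Hd]] := hc (e / 2) ltac:(lra).
have nm := null_mesh hs hsg.
have [N HN] := ev_and _ _ (ev_and _ _ (hx (d / 2) ltac:(lra)) (ev_ge 1)) (ev_and _ _ (nm (d / 2) ltac:(lra)) (nm (e / 2) ltac:(lra))).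
exists N => n /HN [[a1 h1] [a2 a3]].
have hn : (0 < sg n)%N by have := incr_ge sg hsg n; lia.
apply: Rle_lt_trans (near_stp hs hn hX (hst n) (e := e / 2) _) _; last lra.
move=> w hw; rewrite nd_sym; left; apply: Hd.
have := nd_tri w (gpos' p s (sg n) (x n)) X; rewrite (nd_sym X); lra.
Qed.

Lemma walk_cv N (x : nat -> nat -> nat * nat) X : (forall j t, (t < N)%N -> stp (ah g p s (sg j)) (x j t) (x j t.+1)) ->
  cv (fun j => gpos' p s (sg j) (x j 0%N)) X ->
  (forall t, (t <= N)%N -> contat g (fiter g t X) /\ nd (fiter g t X) p <= s) ->
  forall t, (t <= N)%N -> cv (fun j => gpos' p s (sg j) (x j t)) (fiter g t X).
Proof.
move=> hw h0 hX; elim=> [|t IH] ht //.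
apply: (@step_cv (fun j => x j t) (fun j => x j t.+1)).
- by move=> j; apply: hw.
- exact: IH (ltnW ht).
- by have [] := hX t (ltnW ht).
- by have [] := hX t.+1 ht.
Qed.
End WalkLimit.

Lemma uniform_cont G p r : (forall x, nd x p <= r -> contat G x) -> forall e, 0 < e ->
  exists d, 0 < d /\ forall x y, nd x p <= r -> nd x y < d -> nd (G x) (G y) < e.
Proof.
move=> H e he; apply: NNPP => Q.
have C (n : nat) : exists q : pt * pt, nd q.1 p <= r /\ nd q.2 q.1 <= / INR (S n) /\ e <= nd (G q.1) (G q.2).
  apply: NNPP => Q'; apply: Q; exists (/ INR (S n)); split.
    by apply: Rinv_0_lt_compat; apply: lt_0_INR; lia.
  move=> x y hx hxy; apply: Rnot_le_lt => L; apply: Q'; exists (x, y) => /=.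
  by split=> //; split=> //; rewrite nd_sym; left.
have [q Hq] := fchoice _ C.
have [s [x [hs [hx bx]]]] := BW (fun n => (q n).1) p r (fun n => proj1 (Hq n)).
have hy : cv (fun n => (q (s n)).2) x.
  apply: (cv_near (fun n => (q (s n)).1) _ _ (fun n => / INR (S (s n)))) => //.
    exact: (null_sub _ s hs null_inv).
  by exists O => n _; have [_ []] := Hq (s n).
have gx := contat_cv _ _ _ (H x bx) hx; have gy := contat_cv _ _ _ (H x bx) hy.
have [n [a b]] := ev_ex _ (ev_and _ _ (gx (e / 2) ltac:(lra)) (gy (e / 2) ltac:(lra))).
have [_ [_ c]] := Hq (s n).
have := nd_tri (G (q (s n)).1) (G x) (G (q (s n)).2); rewrite (nd_sym (G x)); lra.
Qed.

Lemma move_lower G p r r' : (forall x, r' <= nd x p <= r -> contat G x /\ G x <> x) ->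
  exists e, 0 < e /\ forall x, r' <= nd x p <= r -> e <= nd x (G x).
Proof.
move=> H; apply: NNPP => Q.
have C (n : nat) : exists x, (r' <= nd x p <= r) /\ nd x (G x) <= / INR (S n).
  apply: NNPP => Q'; apply: Q; exists (/ INR (S n)); split.
    by apply: Rinv_0_lt_compat; apply: lt_0_INR; lia.
  by move=> x hx; apply: Rnot_lt_le => L; apply: Q'; exists x; split => //; left.
have [q Hq] := fchoice _ C.
have [s [x [hs [hx bx]]]] := BW q p r (fun n => proj2 (proj1 (Hq n))).
have lx : r' <= nd x p by apply: cv_ge hx _; exists O => n _; have [[]] := Hq (s n).
have [cx nx] := H x (conj lx bx).
apply: nx; apply: (cv_unique (fun n => q (s n))) => //.
apply: (cv_near (fun n => G (q (s n))) _ _ (fun n => / INR (S (s n)))).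
- exact: contat_cv.
- exact: (null_sub _ s hs null_inv).
- by exists O => n _; have [_] := Hq (s n).
Qed.

Lemma onb_pos p s h l v : 0 < s -> (0 < h)%N -> (l < h)%N -> onb h l v ->
  nd (gpos' p s h v) p = INR l * (s / INR h).
Proof.
move=> hs hh lh /and3P [/andP [a1 a2] /andP [a3 a4] a5].
have hp := INR_pos hh; have hd : 0 < s / INR h by apply: Rdiv_lt_0_compat.
have b1 := INR_leq a1; have b2 := INR_leq a2; have b3 := INR_leq a3; have b4 := INR_leq a4.
rewrite minus_INR ?plus_INR in b1 b2 b3 b4; try lia.
set d := s / INR h in hd *.
have le : nd (gpos' p s h v) p <= INR l * d.
  by apply/nd_le; rewrite /gpos' /gpos /=; split; apply: Rabs_le; rewrite -/d; nra.
have ge : INR l * d <= nd (gpos' p s h v) p.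
  have := proj1 (nd_le (gpos' p s h v) p _) (Rle_refl _); rewrite /gpos' /gpos /= -/d => -[c1 c2].
  move: c1 c2; set q := nd _ _ => c1 c2.
  have lp := pos_INR l.
  case/or4P: a5 => /eqP E; rewrite E ?minus_INR ?plus_INR in c1 c2; try lia.
  - move: c1; rewrite /Rabs; case: Rcase_abs => hc c1; nra.
  - move: c1; rewrite /Rabs; case: Rcase_abs => hc c1; nra.
  - move: c2; rewrite /Rabs; case: Rcase_abs => hc c2; nra.
  - move: c2; rewrite /Rabs; case: Rcase_abs => hc c2; nra.
lra.
Qed.

(** * The fixed point index as a local trace *)

Definition rad (r s : R) (h : nat) : nat := nflo (r * INR h / s).
Definition ltrh g p s h N r : Z := ltr (gridm h) (ah g p s h) N (h - rad r s h)%N (h + rad r s h)%N.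

Lemma F1_walk m a N (e e' : Et m) : (F1 m a ^+ N)%R (enum_rank e) (enum_rank e') != 0%R ->
  exists x : nat -> nat * nat, [/\ x 0%N = src e, x N = src e' & forall t, (t < N)%N -> stp a (x t) (x t.+1)].
Proof.
move=> /exp_walk [w [w0 wN ww]]; exists (fun t => src (enum_val (w t))); split.
- by rewrite w0 enum_rankK.
- by rewrite wN enum_rankK.
- by move=> t /ww; rewrite -[w t]enum_valK -[w t.+1]enum_valK !enum_rankK; apply: stp_F1.
Qed.

(** Uniform shadowing: otherwise bad walks on finer and finer meshes would have convergent starting
    points, and [walk_cv] would make them follow the limit orbit. *)
Lemma ev_walk_near g p s N r e : 0 < s -> 0 < e ->
  (forall x, nd x p <= r -> forall t, (t <= N)%N -> contat g (fiter g t x) /\ nd (fiter g t x) p <= s) ->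
  ev (fun h => forall x : nat -> nat * nat, (forall t, (t < N)%N -> stp (ah g p s h) (x t) (x t.+1)) ->
    nd (gpos' p s h (x 0%N)) p <= r -> forall t, (t <= N)%N -> nd (gpos' p s h (x t)) (fiter g t (gpos' p s h (x 0%N))) <= e).
Proof.
move=> hs he H1; apply: NNPP => Q.
have [sg [hsg Hsg]] := not_ev _ Q.
have C (j : nat) : exists q : (nat -> nat * nat) * nat, (forall t, (t < N)%N -> stp (ah g p s (sg j)) (q.1 t) (q.1 t.+1)) /\
   nd (gpos' p s (sg j) (q.1 0%N)) p <= r /\ (q.2 <= N)%N /\ e <= nd (gpos' p s (sg j) (q.1 q.2)) (fiter g q.2 (gpos' p s (sg j) (q.1 0%N))).
  apply: NNPP => Q'; apply: (Hsg j) => x hx hr t ht; apply: Rnot_lt_le => L; apply: Q'.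
  by exists (x, t) => /=; do 3 split=> //; left.
have [q Hq] := fchoice _ C.
have [s' [X [hs' [hX bX]]]] := BW (fun j => gpos' p s (sg j) ((q j).1 0%N)) p r (fun j => proj1 (proj2 (Hq j))).
have hX' := H1 X bX.
have isg : incr (fun j => sg (s' j)) by apply: incr_comp.
have W := walk_cv hs isg (fun j t ht => proj1 (Hq (s' j)) t ht) hX hX'.
have E : ev (fun j => forall t, (t < N.+1)%coq_nat -> nd (gpos' p s (sg (s' j)) ((q (s' j)).1 t)) (fiter g t (gpos' p s (sg (s' j)) ((q (s' j)).1 0%N))) < e).
  apply: ev_fin => t ht; have ht' : (t <= N)%N by lia.
  have ct : contat (fiter g t) X by apply: contat_fiter => i hi; have [] := hX' i ltac:(lia).
  have A := W t ht' (e / 2) ltac:(lra).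
  have B := contat_cv _ _ _ ct hX (e / 2) ltac:(lra).
  apply: ev_imp (ev_and _ _ A B) _ => j [a b] /=.
  have := nd_tri (gpos' p s (sg (s' j)) ((q (s' j)).1 t)) (fiter g t X) (fiter g t (gpos' p s (sg (s' j)) ((q (s' j)).1 0%N))).
  rewrite (nd_sym (fiter g t X)); lra.
have [j Hj] := ev_ex _ E.
have [_ [_ [a b]]] := Hq (s' j).
by have := Hj (q (s' j)).2 ltac:(lia); lra.
Qed.

(** A displacement of [10 * e] known up to [3 * e] leaves at least seven cells, more than the margin
    of two that [off] demands. *)
Lemma off_of_hp p s h k v y e z : 0 < s -> (0 < h)%N -> s / INR h <= e ->
  10 * e <= hp k (psub (gpos' p s h v) z) -> nd (gpos' p s h y) z <= 3 * e -> off k v y.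
Proof.
move=> hs hh he hk /nd_le [n1 n2]; have hp := INR_pos hh.
have hd : 0 < s / INR h by apply: Rdiv_lt_0_compat.
set d := s / INR h in he hd.
have key (a b : nat) : 7 * d <= d * (INR a - INR b) -> (b + 2 <= a)%N.
  move=> H; have : INR b + 7 <= INR a by nra.
  move=> H'; have : INR (b + 2) <= INR a by rewrite plus_INR /=; lra.
  by move/INR_le => h2; lia.
have ra a b : Rabs a <= b -> - b <= a <= b by unfold Rabs; destruct Rcase_abs; lra.
have {}n1 := ra _ _ n1; have {}n2 := ra _ _ n2.
rewrite /gpos' /gpos /= -/d in n1 n2 hk.
case: k hk => [|[|[|k]]] /= hk; apply: key; lra.
Qed.

Lemma hp_exists w e : e <= Rmax (Rabs (fst w)) (Rabs (snd w)) -> exists k, (k < 4)%N /\ e <= hp k w.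
Proof.
rewrite /Rmax; case: Rle_dec => _; rewrite /Rabs; case: Rcase_abs => h H.
- by exists 3%N.
- by exists 1%N.
- by exists 2%N.
- by exists 0%N.
Qed.

Lemma hp_near k x y e : Rabs (fst x - fst y) <= e -> Rabs (snd x - snd y) <= e -> hp k y - e <= hp k x.
Proof.
have ra a b : Rabs a <= b -> - b <= a <= b by unfold Rabs; destruct Rcase_abs; lra.
move=> /ra h1 /ra h2; case: k => [|[|[|k]]] /=; lra.
Qed.

Lemma psub_eq0 x y : psub x y = (0, 0) -> y = x.
Proof. by case: x y => [a b] [c d] [E1 E2]; congr pair; lra. Qed.

Lemma sq_clamp p rho t : sq p rho t = sq p rho (clamp 0 1 t).
Proof.
have Q k : 0 <= k <= 3 -> qk k t = qk k (clamp 0 1 t).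
  by move=> hk; unfold qk, clamp, Rmax, Rmin; repeat destruct Rle_dec; lra.
by rewrite /sq -!Q; lra || done.
Qed.

Lemma index_grid g p s N r : 0 < s -> 0 < r -> 2 * r < s ->
  (forall x, nd x p <= 2 * r -> forall t, (t <= N.+1)%N -> contat g (fiter g t x) /\ nd (fiter g t x) p <= s) ->
  (forall x, nd x p <= 2 * r -> fiter g N.+1 x = x -> x = p) ->
  ev (fun h => (0 < h)%N /\ winding_number (fun t => psub (circ p r t) (fiter g N.+1 (circ p r t))) (ltrh g p s h N.+1 r)).
Proof.
move=> hs hr hrs H1 H2; set G := fiter g N.+1.
have cG x : nd x p <= 2 * r -> contat G x.
  by move=> hx; apply: contat_fiter => i hi; have [] := H1 x hx i ltac:(lia).
have HG x : r / 4 <= nd x p <= 2 * r -> contat G x /\ G x <> x.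
  move=> [h1 h2]; split; first exact: cG.
  by move=> /(H2 x h2) E; rewrite E nd_refl in h1; lra.
have [e0 [he0 He0]] := move_lower HG.
(* Displacements on the annulus are at least [10 * e], and the images of cells around a boundary
   node scatter by less than [3 * e]. The bound [r / 8] keeps the rounded radius of the square above
   [r / 2]. *)
pose e := Rmin (e0 / 10) (r / 8).
have he : 0 < e by apply: Rmin_glb_lt; lra.
have he1 : 10 * e <= e0 by have := Rmin_l (e0 / 10) (r / 8); rewrite -/e; lra.
have he2 : e <= r / 8 by exact: Rmin_r.
have [d [hd Hd]] := uniform_cont cG he.
have Ew := ev_walk_near hs he H1.
have id_incr : incr (fun n => n) by move=> n; lia.
have nm := null_mesh hs id_incr.
apply: ev_imp (ev_and _ _ (ev_and _ _ Ew (ev_ge 1)) (ev_and _ _ (nm d hd) (nm e he))) _ => h [[Wk /leP h0] [hdl1 hdl2]].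
split=> //.
have hp := INR_pos h0.
have hdl : 0 < s / INR h by apply: Rdiv_lt_0_compat.
set dl := s / INR h in hdl1 hdl2 hdl *.
set l := rad r s h.
have hl : INR l <= r / dl < INR l + 1.
  have -> : r / dl = r * INR h / s by rewrite /dl; field; lra.
  apply: nflo_spec; apply: Rmult_le_pos; last by left; apply: Rinv_0_lt_compat.
  by apply: Rmult_le_pos; lra.
have rdl : dl * (r / dl) = r by field; lra.
have rho1 : INR l * dl <= r by nra.
have rho2 : r - dl < INR l * dl by nra.
have sdl : INR h * dl = s by rewrite /dl; field; lra.
have lh : (l < h)%N.
  have : INR l < INR h by nra.
  by move/INR_lt => ?; lia.
have l0 : (0 < l)%N.
  rewrite lt0n; apply/eqP => E; rewrite E /= in rho2; lra.
have aV := fun v => ah_inV g p s v h0.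
have nE : (gridm h).+1 = (h + h)%N by rewrite /gridm; lia.
have bdl v w : onb h l v -> adj v w -> nd (gpos' p s h w) p <= 2 * r.
  move=> ov avw; have := gpos_adj p (Rlt_le _ _ hs) h0 avw; rewrite -/dl.
  have := onb_pos p hs h0 lh ov; rewrite -/dl.
  have := nd_tri (gpos' p s h w) (gpos' p s h v) p; lra.
have Gnear v x : onb h l v -> nd x (gpos' p s h v) <= dl -> nd (G x) (G (gpos' p s h v)) <= e.
  move=> ov hx; rewrite nd_sym; left; apply: Hd; last by rewrite nd_sym; lra.
  by apply: (bdl v v) => //; rewrite /adj; lia.
rewrite /ltrh -/l ltr_boundary //; first 1 last.
- by lia.
- by rewrite nE; lia.
apply: (@winding_sq_circ G p (INR l * dl) r) => //; first by split; lra.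
have bd_annulus t : 0 <= t <= 1 -> r / 4 <= nd (sq p (INR l * dl) t) p <= 2 * r.
  move=> ht; have [a b] := sq_sides p (INR l * dl) t ht ltac:(nra).
  split; last lra; apply: nd_lower; first lra.
  by nra.
apply: winding_ext (winding_square _ (Ph_chain aV N.+1) hdl l0 lh _ _ _ _).
- by [].
- by move=> q; rewrite /= aV.
- by rewrite nE; lia.
- move=> v ov.
  have on := onb_pos p hs h0 lh ov; rewrite -/dl in on.
  have q := He0 (gpos' p s h v) ltac:(rewrite on; lra).
  have [k [hk Hk]] := @hp_exists (psub (gpos' p s h v) (G (gpos' p s h v))) _ (Rle_trans _ _ _ he1 q).
    exists k; split=> //; split; last split.
    - move=> w avw.
      have W := Wk (fun t => iter t (ah g p s h) w) (fun t _ => stp_map _ _) (bdl _ _ ov avw) N.+1 (leqnn _).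
      apply: (off_of_hp hs h0 (Rlt_le _ _ hdl2) Hk).
      have := Gnear v (gpos' p s h w) ov (gpos_adj p (Rlt_le _ _ hs) h0 avw).
      have := nd_tri (gpos' p s h (iter N.+1 (ah g p s h) w)) (G (gpos' p s h w)) (G (gpos' p s h v)).
      rewrite /G /= in W *; lra.
    - move=> ed ed' aed /F1_walk [x [x0 xN xs]].
      have W := Wk x xs ltac:(rewrite x0; exact: bdl ov aed) N.+1 (leqnn _); rewrite x0 xN in W.
      apply: (off_of_hp hs h0 (Rlt_le _ _ hdl2) Hk).
      have := Gnear v (gpos' p s h (src ed)) ov (gpos_adj p (Rlt_le _ _ hs) h0 aed).
      have := nd_tri (gpos' p s h (src ed')) (G (gpos' p s h (src ed))) (G (gpos' p s h v)).
      rewrite -/G in W; lra.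
    - move=> x hx; rewrite -/(gpos' p s h v) in hx.
      have gx := Gnear v x ov hx.
      have/nd_le [n1 n2] := hx; have/nd_le [n3 n4] := gx.
      have := @hp_near k (psub x (G x)) (psub (gpos' p s h v) (G (gpos' p s h v))) (2 * e).
      have ra a b : Rabs a <= b <-> - b <= a <= b by unfold Rabs; destruct Rcase_abs; lra.
      move/ra: n1 => n1; move/ra: n2 => n2; move/ra: n3 => n3; move/ra: n4 => n4.
      move=> H; have {}H := H ltac:(apply/ra; unfold psub; cbn [fst snd]; lra) ltac:(apply/ra; unfold psub; cbn [fst snd]; lra).
      lra.
- apply: cpath_psub; first exact: sq_cpath.
  move=> t; rewrite sq_clamp; apply: cG.
  by have [] := bd_annulus (clamp 0 1 t) (clamp_in 0 1 t ltac:(lra)).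
- move=> t ht E; have := bd_annulus t ht => /HG [_]; apply.
  exact: psub_eq0 E.
Qed.

Definition swalk a N (x : nat -> nat * nat) := forall t, (t < N)%N -> stp a (x t) (x t.+1).

(** * Local traces as traces of truncated matrices *)

Section LocalTrace.
Variables (m : nat) (a : nat * nat -> nat * nat) (N lo hi : nat).
Hypothesis aV : forall p, inV m (a p).
Variables (near Q : nat * nat -> Prop).
Variables (AV : pred (Vt m)) (AE : pred (Et m)) (AS : pred (St m)).
Hypothesis near0 : forall x, swalk a N.+1 x -> x N.+1 = x 0%N -> inW lo hi (x 0%N) -> forall t, (t <= N.+1)%N -> near (x t).
Hypothesis near1 : forall x, swalk a N.+1 x -> x N.+1 = x 0%N -> (forall t, (t <= N.+1)%N -> Q (x t)) -> near (x 0%N).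
Hypothesis nearV : forall v, near (vv v) -> AV v && oV lo hi v.
Hypothesis nearE : forall v, near (src v) -> AE v && oE lo hi v.
Hypothesis nearS : forall v, near (ss v) -> AS v && oS lo hi v.
Hypothesis QV : forall v, AV v -> Q (vv v).
Hypothesis QE : forall v, AE v -> Q (src v).
Hypothesis QS : forall v, AS v -> Q (ss v).

Let trace_cells (T : finType) (bs : T -> nat * nat) (o A : pred T) (X : 'M[Z]_#|T|) :
  (forall c c', X (enum_rank c) (enum_rank c') != 0%R -> stp a (bs c) (bs c')) ->
  (forall c, o c -> inW lo hi (bs c)) -> (forall c, near (bs c) -> A c && o c) -> (forall c, A c -> Q (bs c)) ->
  (\sum_(i | o (enum_val i)) (X ^+ N.+1) i i = \tr ((pj (A \o enum_val) *m X *m pj (A \o enum_val)) ^+ N.+1))%R.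
Proof.
move=> hX ho hn hQ.
have W w : walk X N.+1 w -> swalk a N.+1 (fun t => bs (enum_val (w t))).
  by move=> hw t /hw; rewrite -[w t]enum_valK -[w t.+1]enum_valK !enum_rankK; apply: hX.
rewrite -(@trace_walk _ X (A \o enum_val) (o \o enum_val)) // => w hw cw.
  move=> ow t ht; have /hn /andP [] // := near0 (W w hw) (congr1 (fun i => bs (enum_val i)) cw) (ho _ ow) ht.
move=> Aw; have /hn /andP [] // := near1 (W w hw) (congr1 (fun i => bs (enum_val i)) cw) (fun t ht => hQ _ (Aw t ht)).
Qed.

(** Cells of all dimensions obey one discrete dynamics, that of [stp] on base points, so
    [trace_walk] applies in each degree under the same two conditions on closed walks. *)
Lemma ltr_trace : ltr m a N.+1 lo hi =
  (\tr ((pj (AV \o enum_val) *m F0 m a *m pj (AV \o enum_val)) ^+ N.+1)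
  - \tr ((pj (AE \o enum_val) *m F1 m a *m pj (AE \o enum_val)) ^+ N.+1)
  + \tr ((pj (AS \o enum_val) *m F2 m a *m pj (AS \o enum_val)) ^+ N.+1))%R.
Proof.
rewrite /ltr (@trace_cells _ (@vv m) (oV lo hi) AV) //; last by move=> c c'; apply: stp_F0.
rewrite (@trace_cells _ (@src m) (oE lo hi) AE) //; first 1 last.
- by move=> c c'; apply: stp_F1.
- by move=> c /andP [].
rewrite (@trace_cells _ (@ss m) (oS lo hi) AS) //.
- by move=> c c'; apply: stp_F2.
- by move=> c /andP [].
Qed.
End LocalTrace.

Section Radius.
Variables (p : pt) (s r : R) (h : nat).
Hypotheses (hs : 0 < s) (h0 : (0 < h)%N) (hr : 0 < r) (hrs : r < s).

Let hp := INR_pos h0.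
Let dl := s / INR h.
Let hdl : 0 < dl. Proof. by apply: Rdiv_lt_0_compat. Qed.

Lemma rad_spec : INR (rad r s h) * dl <= r < INR (rad r s h) * dl + dl.
Proof.
have : INR (rad r s h) <= r / dl < INR (rad r s h) + 1.
  have -> : r / dl = r * INR h / s by rewrite /dl; field; lra.
  apply: nflo_spec; apply: Rmult_le_pos; last by left; apply: Rinv_0_lt_compat.
  by apply: Rmult_le_pos; lra.
have rdl : dl * (r / dl) = r by field; lra.
nra.
Qed.

Lemma rad_lt : (rad r s h < h)%N.
Proof.
have sdl : INR h * dl = s by rewrite /dl; field; lra.
have := rad_spec; set l := rad r s h => -[a b].
have : INR l < INR h by nra.
by move/INR_lt => ?; lia.
Qed.

Lemma inW_pos v : inW (h - rad r s h) (h + rad r s h) v -> nd (gpos' p s h v) p <= r.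
Proof.
move=> /andP [/andP [a1 a2] /andP [a3 a4]]; have [q _] := rad_spec; have lh := rad_lt.
have b1 := INR_leq a1; have b2 := INR_leq a2; have b3 := INR_leq a3; have b4 := INR_leq a4.
rewrite minus_INR ?plus_INR in b1 b2 b3 b4; try lia.
apply/nd_le; rewrite /gpos' /gpos /= -/dl; split; apply: Rabs_le; nra.
Qed.

Lemma near_inW v : 4 * dl <= r -> nd (gpos' p s h v) p <= r / 2 ->
  [&& h - rad r s h <= v.1, v.1.+1 <= h + rad r s h, h - rad r s h <= v.2 & v.2.+1 <= h + rad r s h]%N.
Proof.
move=> h4 /nd_le; rewrite /gpos' /gpos /= -/dl => -[n1 n2]; have [_ q] := rad_spec; have lh := rad_lt.
have ra x y : Rabs x <= y -> - y <= x <= y by unfold Rabs; destruct Rcase_abs; lra.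
have {n1}n1 := ra _ _ n1; have {n2}n2 := ra _ _ n2.
have key (x y : nat) : dl * INR x <= dl * INR y -> (x <= y)%N.
  by move=> H; have : INR x <= INR y by [nra|]; move/INR_le => ?; lia.
have lh' : (rad r s h <= h)%coq_nat by lia.
apply/and4P; split; apply: key; rewrite ?S_INR ?minus_INR ?plus_INR //; nra.
Qed.
End Radius.

Section Closed.
Variables (g : pt -> pt) (p : pt) (s : R).
Hypothesis hs : 0 < s.

(** Closed walks that start near p converge to periodic orbits of g, and the only one available is
    p. *)
Lemma closed_walk_start N r e : 0 < e ->
  (forall x, nd x p <= r -> forall t, (t <= N)%N -> contat g (fiter g t x) /\ nd (fiter g t x) p <= s) ->
  (forall x, nd x p <= r -> fiter g N x = x -> x = p) -> g p = p ->
  ev (fun h => forall x, swalk (ah g p s h) N x -> x N = x 0%N ->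
    nd (gpos' p s h (x 0%N)) p <= r -> forall t, (t <= N)%N -> nd (gpos' p s h (x t)) p <= e).
Proof.
move=> he H1 H2 gp; apply: NNPP => Q.
have [sg [hsg Hsg]] := not_ev _ Q.
have C (j : nat) : exists q : (nat -> nat * nat) * nat, swalk (ah g p s (sg j)) N q.1 /\ q.1 N = q.1 0%N /\
   nd (gpos' p s (sg j) (q.1 0%N)) p <= r /\ (q.2 <= N)%N /\ e <= nd (gpos' p s (sg j) (q.1 q.2)) p.
  apply: NNPP => Q'; apply: (Hsg j) => x hx cx hr t ht; apply: Rnot_lt_le => L; apply: Q'.
  by exists (x, t) => /=; do 4 split=> //; left.
have [q Hq] := fchoice _ C.
have [s' [X [hs' [hX bX]]]] := BW (fun j => gpos' p s (sg j) ((q j).1 0%N)) p r (fun j => proj1 (proj2 (proj2 (Hq j)))).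
have hX' := H1 X bX.
have isg : incr (fun j => sg (s' j)) by apply: incr_comp.
have W := walk_cv hs isg (fun j t ht => proj1 (Hq (s' j)) t ht) hX hX'.
have Xp : X = p.
  apply: H2 => //; apply: (cv_unique (fun j => gpos' p s (sg (s' j)) ((q (s' j)).1 N))); first exact: W.
  by apply: cv_ext hX => j; have [_ [-> _]] := Hq (s' j).
have E : ev (fun j => forall t, (t < N.+1)%coq_nat -> nd (gpos' p s (sg (s' j)) ((q (s' j)).1 t)) p < e).
  apply: ev_fin => t ht; have := W t ltac:(lia) e he.
  by rewrite Xp (_ : fiter g t p = p) //; apply: fiter_fix.
have [j Hj] := ev_ex _ E.
have [_ [_ [_ [a b]]]] := Hq (s' j).
by have := Hj (q (s' j)).2 ltac:(lia); lra.
Qed.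

Variables (Qc : nat -> nat * nat -> Prop) (Gd : pt -> Prop).
Hypothesis Qbd : forall h v, Qc h v -> nd (gpos' p s h v) p <= s.
Hypothesis Qcl : forall sg c X, incr sg -> (forall j, Qc (sg j) (c j)) -> cv (fun j => gpos' p s (sg j) (c j)) X -> Gd X.
Hypothesis Gcont : forall X, Gd X -> contat g X /\ nd (g X) p <= s.

Lemma limit_walk N sg (x : nat -> nat -> nat * nat) : incr sg ->
  (forall j, swalk (ah g p s (sg j)) N (x j)) -> (forall j t, (t <= N)%N -> Qc (sg j) (x j t)) ->
  exists s' X, [/\ incr s', forall t, (t <= N)%N -> Gd (fiter g t X) &
    forall t, (t <= N)%N -> cv (fun j => gpos' p s (sg (s' j)) (x (s' j) t)) (fiter g t X)].
Proof.
move=> hsg hx hQ.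
have [s' [X [hs' [hX bX]]]] := BW (fun j => gpos' p s (sg j) (x j 0%N)) p s (fun j => Qbd (hQ j 0%N isT)).
have isg : incr (fun j => sg (s' j)) by apply: incr_comp.
exists s', X.
have K t : (t <= N)%N -> Gd (fiter g t X) /\ cv (fun j => gpos' p s (sg (s' j)) (x (s' j) t)) (fiter g t X).
  elim: t => [|t IH] ht.
    by split=> //; apply: (Qcl isg _ hX) => j; apply: hQ.
  have [IH1 IH2] := IH (ltnW ht); have [c1 c2] := Gcont IH1.
  have C : cv (fun j => gpos' p s (sg (s' j)) (x (s' j) t.+1)) (fiter g t.+1 X).
    exact: (step_cv hs isg (x := fun j => x (s' j) t) (fun j => hx (s' j) t ht) IH2 c1 c2).
  by split=> //; apply: (Qcl isg _ C) => j; apply: hQ.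
by split=> // t /K [].
Qed.

(** The same limit argument for closed walks confined to a region whose limit set is [Gd], wherever
    they start. *)
Lemma closed_walk_inside N e : 0 < e ->
  (forall X, (forall t, (t <= N)%N -> Gd (fiter g t X)) -> fiter g N X = X -> X = p) ->
  ev (fun h => forall x, swalk (ah g p s h) N x -> x N = x 0%N -> (forall t, (t <= N)%N -> Qc h (x t)) ->
    nd (gpos' p s h (x 0%N)) p <= e).
Proof.
move=> he H2; apply: NNPP => Q.
have [sg [hsg Hsg]] := not_ev _ Q.
have C (j : nat) : exists x, swalk (ah g p s (sg j)) N x /\ x N = x 0%N /\ (forall t, (t <= N)%N -> Qc (sg j) (x t)) /\
    e <= nd (gpos' p s (sg j) (x 0%N)) p.
  apply: NNPP => Q'; apply: (Hsg j) => x hx cx hq; apply: Rnot_lt_le => L; apply: Q'.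
  by exists x; do 3 split=> //; left.
have [x Hx] := fchoice _ C.
have [s' [X [hs' GX cX]]] := limit_walk hsg (fun j => proj1 (Hx j)) (fun j => proj1 (proj2 (proj2 (Hx j)))).
have Xp : X = p.
  apply: H2 => //; apply: (cv_unique (fun j => gpos' p s (sg (s' j)) (x (s' j) N))); first exact: cX.
  by apply: cv_ext (cX 0%N isT) => j; have [_ [-> _]] := Hx (s' j).
have [j Hj] := ev_ex _ (cX 0%N isT e he); rewrite /= Xp in Hj.
by have [_ [_ [_ a]]] := Hx (s' j); lra.
Qed.
End Closed.

(** * Index of iterates *)

Definition idx (g : pt -> pt) p r k := winding_number (fun t => psub (circ p r t) (g (circ p r t))) k.

(** The radius is doubled because the deformation of the square to the circle sweeps out an annulus
    reaching up to [2 * r]. *)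
Definition good g p s r N :=
  (forall x, nd x p <= 2 * r -> forall t, (t <= N)%N -> contat g (fiter g t x) /\ nd (fiter g t x) p <= s) /\
  (forall x, nd x p <= 2 * r -> forall t, (0 < t <= N)%N -> fiter g t x = x -> x = p).

Lemma good_le g p s r N r' N' : r' <= r -> (N' <= N)%N -> good g p s r N -> good g p s r' N'.
Proof.
by move=> hr hN [A B]; split=> x hx t ht; [apply: A | apply: B]; try lra; lia.
Qed.

(** Here the truncation precedes the power, so the values for all N are traces of powers of the same
    three integer matrices, as the congruence modulo a prime requires. *)
Definition boxtr g p s h r N : Z :=
  let m := gridm h in let a := ah g p s h in let lo := (h - rad r s h)%N in let hi := (h + rad r s h)%N in
  (\tr ((pj (@oV m lo hi \o enum_val) *m F0 m a *m pj (@oV m lo hi \o enum_val)) ^+ N)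
  - \tr ((pj (@oE m lo hi \o enum_val) *m F1 m a *m pj (@oE m lo hi \o enum_val)) ^+ N)
  + \tr ((pj (@oS m lo hi \o enum_val) *m F2 m a *m pj (@oS m lo hi \o enum_val)) ^+ N))%R.

(** On a fine mesh the closed walks of either window are concentrated in a smaller square common to
    both; hence the two radii need not agree. *)
Lemma ltrh_boxtr g p s N r r' : 0 < s -> 0 < r < s -> 0 < r' < s -> g p = p -> good g p s r N.+1 -> good g p s r' N.+1 ->
  ev (fun h => ltrh g p s h N.+1 r = boxtr g p s h r' N.+1).
Proof.
move=> hs [hr hrs] [hr' hrs'] gp [H1 H2] [H1' H2'].
pose e := Rmin (r / 2) (r' / 2).
have e0 : 0 < e by apply: Rmin_glb_lt; lra.
have e1 : e <= r / 2 by apply: Rmin_l.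
have e2 : e <= r' / 2 by apply: Rmin_r.
have id_incr : incr (fun n => n) by move=> n; lia.
have nm := null_mesh hs id_incr; have {}nm := nm (e / 2) ltac:(lra).
have C1 := @closed_walk_start g p s hs N.+1 r e e0 (fun x hx => H1 x ltac:(lra)) (fun x hx => H2 x ltac:(lra) N.+1 ltac:(lia)) gp.
have C2 := @closed_walk_start g p s hs N.+1 r' e e0 (fun x hx => H1' x ltac:(lra)) (fun x hx => H2' x ltac:(lra) N.+1 ltac:(lia)) gp.
apply: ev_imp (ev_and _ _ (ev_and _ _ C1 C2) (ev_and _ _ nm (ev_ge 1))) _ => h [[W1 W2] [hm /leP h1]].
have nW v : nd (gpos' p s h v) p <= e -> forall q, 0 < q -> q < s -> e <= q / 2 ->
   [&& h - rad q s h <= v.1, v.1.+1 <= h + rad q s h, h - rad q s h <= v.2 & v.2.+1 <= h + rad q s h]%N.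
  by move=> hv q q0 q1 q2; apply: (@near_inW p) => //; lra.
apply: (@ltr_trace (gridm h) (ah g p s h) N _ _ (fun v => ah_inV g p s v h1) (fun v => nd (gpos' p s h v) p <= e)
   (inW (h - rad r' s h) (h + rad r' s h))).
- by move=> x wx cx /(inW_pos p hs h1 hr hrs) x0; apply: W1.
- by move=> x wx cx /(_ 0%N isT) /(inW_pos p hs h1 hr' hrs') x0; apply: W2.
- move=> v hv; have := nW _ hv r hr hrs e1; have := nW _ hv r' hr' hrs' e2; clear.
  by rewrite /oV /inW; case: (vv v) => i j /=; lia.
- move=> v hv; have := nW _ hv r hr hrs e1; have := nW _ hv r' hr' hrs' e2; clear.
  by rewrite /oE /inW /src /tgt /nsrc /ntgt; case: (ee v) => [[] [i j]] /=; lia.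
- move=> v hv; have := nW _ hv r hr hrs e1; have := nW _ hv r' hr' hrs' e2; clear.
  by rewrite /oS /inW; case: (ss v) => i j /=; lia.
- by [].
- by move=> v /andP [].
- by move=> v /andP [].
Qed.

Lemma idx_boxtr g p s N r r' : 0 < s -> 0 < r -> 2 * r < s -> 0 < r' < s -> g p = p -> good g p s r N.+1 -> good g p s r' N.+1 ->
  ev (fun h => idx (fiter g N.+1) p r (boxtr g p s h r' N.+1)).
Proof.
move=> hs hr hrs hr' gp G G'; have [H1 H2] := G.
have I := index_grid hs hr hrs H1 (fun x hx => H2 x hx N.+1 ltac:(lia)).
have B := ltrh_boxtr hs (conj hr (ltac:(lra) : r < s)) hr' gp G G'.
by apply: ev_imp (ev_and _ _ I B) _ => h [[_ i] <-].
Qed.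

(** Both indices equal one truncated trace, so the index does not depend on the radius. *)
Lemma idx_radius g p s N r r' : 0 < s -> 0 < r -> 2 * r < s -> 0 < r' -> 2 * r' < s -> g p = p ->
  good g p s r N.+1 -> good g p s r' N.+1 -> exists k, idx (fiter g N.+1) p r k /\ idx (fiter g N.+1) p r' k.
Proof.
move=> hs hr hrs hr' hrs' gp G G'.
have I := @idx_boxtr g p s N r r hs hr hrs ltac:(lra) gp G G.
have I' := @idx_boxtr g p s N r' r hs hr' hrs' ltac:(lra) gp G' G.
by have [h [A B]] := ev_ex _ (ev_and _ _ I I'); exists (boxtr g p s h r N.+1).
Qed.

Lemma idx_prime g p s r q : prime q -> 0 < s -> 0 < r -> 2 * r < s -> g p = p -> good g p s r q ->
  exists i j k, idx g p r i /\ idx (fiter g q) p r j /\ j = (i + k * Z.of_nat q)%Z.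
Proof.
move=> pq hs hr hrs gp G; have q0 := prime_gt0 pq.
have G1 : good g p s r 1 by apply: good_le G; [lra|].
have I := @idx_boxtr g p s 0 r r hs hr hrs ltac:(lra) gp G1 G1.
have J : ev (fun h => idx (fiter g q) p r (boxtr g p s h r q)).
  by rewrite -(prednK q0) in G *; apply: idx_boxtr => //; lra.
have [h [A B]] := ev_ex _ (ev_and _ _ I J).
exists (boxtr g p s h r 1), (boxtr g p s h r q).
pose TV : 'M[Z]_#|{: Vt (gridm h)}| := pj (@oV (gridm h) (h - rad r s h) (h + rad r s h) \o enum_val).
pose TE : 'M[Z]_#|{: Et (gridm h)}| := pj (@oE (gridm h) (h - rad r s h) (h + rad r s h) \o enum_val).
pose TS : 'M[Z]_#|{: St (gridm h)}| := pj (@oS (gridm h) (h - rad r s h) (h + rad r s h) \o enum_val).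
have [k1 E1] := trace_prime_mod (TV *m F0 _ (ah g p s h) *m TV)%R pq.
have [k2 E2] := trace_prime_mod (TE *m F1 _ (ah g p s h) *m TE)%R pq.
have [k3 E3] := trace_prime_mod (TS *m F2 _ (ah g p s h) *m TS)%R pq.
exists (k1 - k2 + k3)%Z; do 2 split=> //.
rewrite /boxtr -/TV -/TE -/TS E1 E2 E3 !expr1.
by move: (\tr _)%R (\tr _)%R (\tr _)%R => x1 x2 x3; lia.
Qed.

(** * The region attached to a block *)

Definition pb (P : Prop) : bool := if excluded_middle_informative P then true else false.
Lemma pbP P : reflect P (pb P).
Proof. by rewrite /pb; case: excluded_middle_informative => H; constructor. Qed.

Section Block.
Variables (p : pt) (s : R) (h : nat) (Gd : pt -> Prop).
Hypotheses (hs : 0 < s) (h0 : (0 < h)%N).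
Let m := gridm h.
Let dl := s / INR h.
Let pos := gpos' p s h.
Local Notation V := (Vt m).
Local Notation E := (Et m).
Local Notation S := (St m).

Let hdl : 0 < dl. Proof. by apply: Rdiv_lt_0_compat => //; apply: INR_pos. Qed.
Let nE : m.+1 = (h + h)%N. Proof. by rewrite /m /gridm; lia. Qed.

Definition nearG (d : R) (x : pt) : Prop := exists G, Gd G /\ nd x G <= d.
Definition Sp (t : S) : bool := pb (nearG dl (pos (ss t))).
Definition rM := [rel x y : S | Sp x && Sp y && (adj4 x y || adj4 y x)].
Definition Mg (t : S) : bool := connect rM (mks m (h, h)) t.

Hypothesis Gp : Gd p.

Lemma nearG_tri d d' x y : nearG d x -> nd y x <= d' -> nearG (d + d') y.
Proof. by move=> [G [HG n]] n'; exists G; split=> //; have := nd_tri y x G; lra. Qed.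

Lemma pos_corner t v : corner t v -> nd (pos v) (pos t) <= dl.
Proof. by move=> c; apply: gpos_adj => //; [lra | apply: corner_adj]. Qed.

Lemma pos_center : pos (h, h) = p.
Proof. by rewrite /pos /gpos' /gpos /=; case: p => x y /=; congr pair; ring. Qed.

Lemma Sp_Mg t : Mg t -> Sp t.
Proof.
have S0 : Sp (mks m (h, h)).
  apply/pbP; exists p; split=> //; rewrite ss_mks /= ?nE; try lia.
  by rewrite pos_center nd_refl; lra.
case/connectP=> q; elim: q (mks m (h, h)) S0 => [|x q IH] y Sy /=; first by move=> _ ->.
by move=> /andP [/andP [/andP [_ Sx] _] pq] /(IH _ Sx pq).
Qed.

Lemma Mg_nearG t v : Mg t -> corner (ss t) v -> nearG (2 * dl) (pos v).
Proof. by move=> /Sp_Mg /pbP n /pos_corner c; have -> : 2 * dl = dl + dl by [ring|]; apply: nearG_tri c. Qed.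

Lemma Mg_step t t' : Mg t -> Sp t' -> adj4 t t' || adj4 t' t -> Mg t'.
Proof.
move=> Mt St a; apply: (connect_trans Mt); apply: connect1.
by rewrite /rM /= St a (Sp_Mg Mt).
Qed.

Lemma Mg_ind (ph : S -> Z) : (forall t t', Mg t -> Mg t' -> adj4 t t' -> ph t = ph t') ->
  forall t t', Mg t -> Mg t' -> ph t = ph t'.
Proof.
move=> H.
have K t : Mg t -> ph t = ph (mks m (h, h)).
  case/connectP=> q; have : Mg (mks m (h, h)) by apply: connect0.
  elim: q (mks m (h, h)) => [|x q IH] y My /=; first by move=> _ ->.
  move=> /andP [yx pq] tl.
  have Mx : Mg x by apply: (connect_trans My); apply: connect1.
  rewrite (IH x Mx pq tl); case/andP: yx => _ /orP [] a; first by rewrite (H y x).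
  by rewrite (H x y).
by move=> t t' /K -> /K ->.
Qed.

(** If a vertex were in [Gd], all squares around it would qualify for [Sp], so they would be in M as
    soon as one of them is. *)
Lemma front_notGd (v : V) : front Mg v -> ~ Gd (pos (vv v)).
Proof.
case/andP=> /existsP [t /andP [Mt ct]] /existsP [t' /andP [Mt' ct']] Gv.
have SpG (q : S) : corner (ss q) (vv v) -> Sp q.
  by move=> c; apply/pbP; exists (pos (vv v)); split=> //; rewrite nd_sym; apply: pos_corner.
have [a1 a2] := ss_lt t; have [b1 b2] := ss_lt t'.
(* The two squares may meet only diagonally; r shares a side with each of them unless it coincides
   with one. *)
pose r := mks m ((ss t).1, (ss t').2).
have er : ss r = ((ss t).1, (ss t').2) by rewrite /r ss_mks.
have cr : corner (ss r) (vv v).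
  by rewrite er; move: ct ct'; rewrite /corner; case: (ss t) (ss t') => i j [k l] /=; lia.
have St := SpG _ ct; have Sr := SpG _ cr.
have Mr : Mg r.
  case: (eqVneq (ss r) (ss t')) => [/ss_inj -> //|ne]; apply: (Mg_step Mt' Sr).
  move: ne ct ct'; rewrite /adj4 er /corner; case: (ss t) (ss t') => i j [k l] /=; rewrite !xpair_eqE eqxx /=; lia.
apply: (negP Mt); case: (eqVneq (ss r) (ss t)) => [/ss_inj <- //|ne]; apply: (Mg_step Mr St).
move: ne ct ct'; rewrite /adj4 er /corner; case: (ss t) (ss t') => i j [k l] /=; rewrite !xpair_eqE eqxx /=; lia.
Qed.

Lemma vv_bd (v : V) : nd (pos (vv v)) p <= s.
Proof.
have := inV_vv v; rewrite /inV nE; case: (vv v) => i j /andP [/= /INR_leq a /INR_leq b].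
rewrite plus_INR in a b; have hp := INR_pos h0.
have sdl : INR h * dl = s by rewrite /dl; field; lra.
have c1 := pos_INR i; have c2 := pos_INR j.
apply/nd_le; rewrite /pos /gpos' /gpos /= -/dl; split; apply: Rabs_le; nra.
Qed.

Lemma box_bd (c : nat * nat) : inV m c -> nd (pos c) p <= s.
Proof. by move=> hc; rewrite -(vv_mkv hc); apply: vv_bd. Qed.

Lemma front_nearG (v : V) : front Mg v -> nearG (2 * dl) (pos (vv v)).
Proof. by case/andP=> _ /existsP [t /andP [Mt ct]]; apply: Mg_nearG Mt ct. Qed.

(** Corners of squares of M are within two cells of [Gd], so three cells are enough to leave M. *)
Definition far (x : pt) := ~ nearG (3 * dl) x.

Lemma vertex_square (v : V) : exists t : S, corner (ss t) (vv v).
Proof.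
have := inV_vv v; rewrite /inV => /andP [a b].
exists (mks m ((vv v).1 - ((vv v).1 == m.+1), (vv v).2 - ((vv v).2 == m.+1))%N).
rewrite ss_mks; move: a b; rewrite /corner; case: (vv v) => i j /=; lia.
Qed.

Lemma far_notM x t : far (pos x) -> corner (ss t) x -> ~~ Mg t.
Proof.
move=> fx ct; apply/negP => /Mg_nearG /(_ ct) [G [HG n]]; apply: fx; exists G; split=> //; lra.
Qed.

Lemma far_LV (v : V) : far (pos (vv v)) -> LV Mg v.
Proof.
by move=> fv; have [t ct] := vertex_square v; apply/existsP; exists t; rewrite ct (far_notM fv ct).
Qed.

Lemma far_LE (e : E) : far (pos (src e)) -> LE Mg e.
Proof.
move=> fe; have [t ct] := edge_face e; apply/existsP; exists t; rewrite ct andbT.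
by have /andP [c _] := face_corner ct; apply: far_notM fe c.
Qed.

Lemma notLV_near (v : V) : ~~ LV Mg v -> nearG (2 * dl) (pos (vv v)).
Proof.
move=> /existsPn H; have [t ct] := vertex_square v; have := H t; rewrite ct andbT negbK => Mt.
exact: Mg_nearG Mt ct.
Qed.

Lemma notLE_near (e : E) : ~~ LE Mg e -> nearG (2 * dl) (pos (src e)).
Proof.
by move=> /notLE_ME /existsP [t /andP [Mt /face_corner /andP [c _]]]; apply: Mg_nearG Mt c.
Qed.

Lemma far_row j i i' : (i <= i')%N -> inV m (i', j) -> (forall t, (i <= t <= i')%N -> far (pos (t, j))) ->
  connect (lrel Mg) (mkv m (i, j)) (mkv m (i', j)).
Proof.
elim: i' => [|i' IH]; first by rewrite leqn0 => /eqP ->; rewrite connect0.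
rewrite leq_eqVlt => /orP [/eqP -> *|]; first by rewrite connect0.
rewrite ltnS => hi; rewrite /inV => /andP [/= a b] hf.
apply: connect_trans (IH hi _ _) _; first by rewrite /inV /=; lia.
  by move=> t ht; apply: hf; lia.
apply: connect1; have := @lrel_edge m Mg (eh m i' j); rewrite /src /tgt ee_eh //; apply.
by apply: far_LE; rewrite /src ee_eh //; apply: hf; rewrite /= hi leqnSn.
Qed.

Lemma far_col i j j' : (j <= j')%N -> inV m (i, j') -> (forall t, (j <= t <= j')%N -> far (pos (i, t))) ->
  connect (lrel Mg) (mkv m (i, j)) (mkv m (i, j')).
Proof.
elim: j' => [|j' IH]; first by rewrite leqn0 => /eqP ->; rewrite connect0.
rewrite leq_eqVlt => /orP [/eqP -> *|]; first by rewrite connect0.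
rewrite ltnS => hi; rewrite /inV => /andP [/= a b] hf.
apply: connect_trans (IH hi _ _) _; first by rewrite /inV /=; lia.
  by move=> t ht; apply: hf; lia.
apply: connect1; have := @lrel_edge m Mg (eu m i j'); rewrite /src /tgt ee_eu //; apply.
by apply: far_LE; rewrite /src ee_eu //; apply: hf; rewrite /= hi leqnSn.
Qed.

(** The connecting path is L-shaped and stays in the bounding box of its ends. *)
Lemma far_box (x y : nat * nat) : inV m x -> inV m y ->
  (forall z, (minn x.1 y.1 <= z.1 <= maxn x.1 y.1)%N -> (minn x.2 y.2 <= z.2 <= maxn x.2 y.2)%N -> far (pos z)) ->
  connect (lrel Mg) (mkv m x) (mkv m y).
Proof.
case: x y => i j [k l]; rewrite /inV => /andP [/= a1 a2] /andP [/= b1 b2] hf.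
apply: (@connect_trans _ _ (mkv m (k, j))).
  case: (leqP i k) => hik; [|rewrite lconn_sym]; apply: far_row; rewrite ?/inV /= ?a2 ?a1 ?b1 //; try lia;
    by move=> t ht; apply: hf => /=; lia.
case: (leqP j l) => hik; [|rewrite lconn_sym]; apply: far_col; rewrite ?/inV /= ?a2 ?b2 ?b1 //; try lia;
    by move=> t ht; apply: hf => /=; lia.
Qed.

(** Moving one coordinate at a time towards the centre never leaves the ball, so each such square is
    joined to the central one. *)
Lemma ball_Mg e : (forall x, nd x p <= e -> Gd x) -> forall t : S, nd (pos (ss t)) p <= e -> Mg t.
Proof.
move=> He.
have step (t t' : S) : adj4 t t' || adj4 t' t -> nd (pos (ss t')) p <= e -> Mg t -> Mg t'.
  move=> a n Mt; apply: Mg_step Mt _ a; apply/pbP; exists (pos (ss t')); split; first exact: He.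
  by rewrite nd_refl; lra.
have mono x y : (minn x.1 h <= y.1 <= maxn x.1 h)%N -> (minn x.2 h <= y.2 <= maxn x.2 h)%N -> nd (pos x) p <= e -> nd (pos y) p <= e.
  have M1 (i j : nat) : (minn i h <= j <= maxn i h)%N -> Rabs (dl * (INR i - INR h)) <= e -> Rabs (dl * (INR j - INR h)) <= e.
    have AM u : Rabs (dl * u) = dl * Rabs u by rewrite Rabs_mult (Rabs_pos_eq dl) //; lra.
    move=> hij; rewrite !AM.
    move=> H; apply: Rle_trans H; apply: Rmult_le_compat_l; first lra.
    case: (leqP i h) => hi.
      have a : INR i <= INR j by apply/le_INR; lia.
      have b : INR j <= INR h by apply/le_INR; lia.
      rewrite !Rabs_left1; lra.
    have a : INR j <= INR i by apply/le_INR; lia.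
    have b : INR h <= INR j by apply/le_INR; lia.
    rewrite !Rabs_pos_eq; lra.
  have sh (a b : R) : a + b - a = b by ring.
  move=> h1 h2 /nd_le; rewrite /pos /gpos' /gpos /= -/dl !sh => -[a b]; apply/nd_le; rewrite /= !sh.
  by split; [apply: M1 h1 a | apply: M1 h2 b].
have K d (i j : nat) : (i - h + (h - i) + (j - h + (h - j)) <= d)%N -> (i < m.+1)%N -> (j < m.+1)%N -> nd (pos (i, j)) p <= e -> Mg (mks m (i, j)).
  elim: d i j => [|d IH] i j hd hi hj n.
    by have [-> ->] : i = h /\ j = h by [lia|]; apply: connect0.
  have go i' j' : (minn i h <= i' <= maxn i h)%N -> (minn j h <= j' <= maxn j h)%N ->
     (i' - h + (h - i') + (j' - h + (h - j')) <= d)%N -> (i' < m.+1)%N -> (j' < m.+1)%N ->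
     adj4 (mks m (i', j')) (mks m (i, j)) || adj4 (mks m (i, j)) (mks m (i', j')) -> Mg (mks m (i, j)).
    move=> a b c hi' hj' ad; apply: (step (mks m (i', j'))) => //; first by rewrite ss_mks.
    by apply: IH => //; apply: mono n.
  have ssE k l : (k < m.+1)%N -> (l < m.+1)%N -> ss (mks m (k, l)) = (k, l) by move=> *; rewrite ss_mks.
  case: (ltngtP i h) => hih.
  - by apply: (go i.+1 j); rewrite ?/adj4 ?ssE ?eqxx ?orbT //; lia.
  - by apply: (go i.-1 j); rewrite ?/adj4 ?ssE ?prednK ?eqxx ?orbT //; lia.
  case: (ltngtP j h) => hjh.
  - by apply: (go i j.+1); rewrite ?/adj4 ?ssE ?eqxx ?orbT //; lia.
  - by apply: (go i j.-1); rewrite ?/adj4 ?ssE ?prednK ?eqxx ?orbT //; lia.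
  - by rewrite hih hjh; apply: connect0.
move=> t n; have [a b] := ss_lt t; have := K _ (ss t).1 (ss t).2 (leqnn _) a b.
by rewrite -surjective_pairing => /(_ n); case: (t) => i j; rewrite /mks /= !inord_val.
Qed.

Lemma ball_notLV e (v : V) : (forall x, nd x p <= e -> Gd x) -> nd (pos (vv v)) p + dl <= e -> ~~ LV Mg v.
Proof.
move=> He n; apply/existsPn => t; rewrite negb_and negbK; case ct: (corner _ _); last by rewrite orbT.
rewrite (ball_Mg He) //; have := pos_corner ct; have := nd_tri (pos (ss t)) (pos (vv v)) p.
rewrite (nd_sym (pos (ss t)) (pos (vv v))); lra.
Qed.

Lemma ball_notLE e (x : E) : (forall x, nd x p <= e -> Gd x) -> nd (pos (src x)) p + dl <= e -> ~~ LE Mg x.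
Proof.
move=> He n; apply/existsPn => t; rewrite negb_and negbK; case: (eqVneq (kd2 t x) 0%Z) => [_|nz]; first by rewrite orbT.
have /andP [ct _] := face_corner nz.
rewrite (ball_Mg He) //; have := pos_corner ct; have := nd_tri (pos (ss t)) (pos (src x)) p.
rewrite (nd_sym (pos (ss t)) (pos (src x))); lra.
Qed.
End Block.

(** * Dynamics of the block *)

Section Dyn.
Variables (f : pt -> pt) (p : pt) (R0 : R).
Hypothesis HD : isodyn f p R0.

Lemma fiter_small N e : 0 < e -> exists r, 0 < r /\ forall x, nd x p <= r -> forall t, (t <= N)%N -> nd (fiter f t x) p <= e.
Proof.
move=> he; elim: N => [|N [r [hr Hr]]].
  by exists e; split=> // x hx t; rewrite leqn0 => /eqP ->.
have [d [hd Hd]] := contat_fiter_fix _ _ _ HD N.+1 e he.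
exists (Rmin r (d / 2)); split; first by apply: Rmin_glb_lt; lra.
move=> x hx t; rewrite leq_eqVlt => /orP [/eqP ->|ht].
  rewrite nd_sym -[p in nd p _](fiter_fix f p N.+1 (iso_fix _ _ _ HD)); left; apply: Hd; rewrite nd_sym.
  by have := Rmin_r r (d / 2); lra.
by apply: Hr => //; have := Rmin_l r (d / 2); lra.
Qed.

Lemma Kminus_preds n z : Kminus f p R0 z -> exists y, fiter f n y = z /\ Kminus f p R0 y /\ forall i, (i <= n)%N -> Kminus f p R0 (fiter f i y).
Proof.
elim: n => [|n IH] Kz; first by exists z; do 2 split=> //; move=> i; rewrite leqn0 => /eqP ->.
have [y [E [Ky Hy]]] := IH Kz; have [w [Ew Kw]] := Kminus_pred _ _ _ HD y Ky.
exists w; split; first by rewrite fiter_S Ew.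
split=> // -[|i] hi //; by rewrite fiter_S Ew; apply: Hy.
Qed.

Variable s : R.
Hypotheses (hs : 0 < s) (hsR : s <= R0).
Hypothesis K2 : forall k x, nd x p <= s -> seg f p R0 k x -> nd (fiter f k x) p <= s ->
  forall j, (j <= k)%coq_nat -> nd (fiter f j x) p < R0.
Variable k : nat.
Hypothesis k1 : (0 < k)%N.
Hypothesis K1 : forall y, seg f p R0 (k + k)%coq_nat y -> nd (fiter f k y) p < s.
Let g := fiter f k.

Definition Gd x := nd x p <= s /\ seg f p R0 k x /\ nd (fiter f k x) p <= s.

Lemma Gd_p : Gd p.
Proof. by split; [|split]; rewrite ?fiter_fix ?nd_refl; try lra; [apply: seg_fix HD _ | apply: (iso_fix _ _ _ HD)]. Qed.

Lemma Gd_cont X : Gd X -> contat g X /\ nd (g X) p <= s.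
Proof. by move=> [_ [sX ?]]; split=> //; apply: (seg_contat _ _ _ HD k) => //; lia. Qed.

Lemma Gd_cv u x : cv u x -> (forall n, Gd (u n)) -> Gd x.
Proof.
move=> hu H.
have sx : seg f p R0 k x by apply: (seg_cv _ _ _ HD k u) => //; exists 0%N => n _; have [_ []] := H n.
have cx : contat g x by apply: (seg_contat _ _ _ HD k) => //; lia.
split; first by apply: cv_le hu _; exists 0%N => n _; have [] := H n.
by split=> //; apply: cv_le (contat_cv _ _ _ cx hu) _; exists 0%N => n _; have [_ []] := H n.
Qed.

Lemma nearG_cv sg (u : nat -> pt) X : incr sg -> (forall j, nearG Gd (3 * (s / INR (sg j))) (u j)) -> cv u X -> Gd X.
Proof.
move=> hsg H hu; have [G HG] := fchoice _ H.
apply: (@Gd_cv G) => [|n]; last by have [] := HG n.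
apply: (cv_near u _ _ (fun j => 3 * (s / INR (sg j)))) => //.
  move=> d hd; have nm := null_mesh hs hsg; apply: ev_imp (nm (d / 3) ltac:(lra)) _ => n; lra.
by exists 0%N => n _; rewrite nd_sym; have [] := HG n.
Qed.

Lemma fiter_muln N X : fiter f (N * k)%N X = fiter g N X.
Proof. exact: (fiter_mul f N k X). Qed.

(** Membership of the t-th point in [Gd] supplies the orbit of f between the times tk and (t+1)k. *)
Lemma Gd_seg N X : (forall t, (t <= N)%N -> Gd (fiter g t X)) -> seg f p R0 (N * k)%N X.
Proof.
elim: N => [|N IH] H.
  by move=> i hi; have -> : i = 0%N by [rewrite mul0n in hi; lia|]; have [q _] := H 0%N isT; rewrite /= in q; simpl; lra.
rewrite mulSn; apply: seg_join; first by apply: IH => t ht; apply: H; lia.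
have [_ [q _]] := H N (leqnSn _).
by rewrite fiter_muln.
Qed.

(** Going round the cycle yields forward and backward segments of every length, so the point lies in
    both local sets. *)
Lemma periodic_seg n X : (0 < n)%N -> seg f p R0 n X -> fiter f n X = X -> X = p.
Proof.
move=> hn sX E.
have P j : seg f p R0 (j * n)%N X /\ fiter f (j * n)%N X = X.
  elim: j => [|j [S1 E1]].
    by split=> // i hi; apply: sX; rewrite mul0n in hi; lia.
  rewrite mulSn; split; first by apply: seg_join => //; rewrite E1.
  by rewrite [LHS](fiter_add f n (j * n)%N) E1.
have jn j : (j <= j * n)%N by rewrite leq_pmulr.
apply: (Kminus_Kplus _ _ _ HD) => j.
  by apply: (Km_mono _ _ _ j (j * n)%N); [have := jn j; lia | exists X; have [] := P j].
by have [S1 _] := P j; apply: S1; have := jn j; lia.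
Qed.

Lemma Gd_periodic N X : (0 < N)%N -> (forall t, (t <= N)%N -> Gd (fiter g t X)) -> fiter g N X = X -> X = p.
Proof.
move=> hN H E; apply: (@periodic_seg (N * k)%N) (Gd_seg H) _; first by rewrite muln_gt0 hN.
by rewrite fiter_muln.
Qed.

Lemma Gd_ball : exists e, 0 < e /\ e <= s /\ forall x, nd x p <= e -> Gd x.
Proof.
have [r [hr Hr]] := fiter_small k hs.
exists (Rmin r s); split; first by apply: Rmin_glb_lt.
split; first exact: Rmin_r.
move=> x hx; have xr : nd x p <= r by have := Rmin_l r s; lra.
split; first by have := Rmin_r r s; lra.
split; last exact: Hr.
by move=> i hi; have := Hr x xr i ltac:(lia); lra.
Qed.

Lemma good_exists N : exists r, 0 < r /\ 2 * r < s /\ good g p s r N.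
Proof.
have [e [he [hes He]]] := Gd_ball.
have [r [hr Hr]] := fiter_small (N * k) he.
exists (Rmin (r / 4) (s / 4)); have m1 := Rmin_l (r / 4) (s / 4); have m2 := Rmin_r (r / 4) (s / 4).
split; first by apply: Rmin_glb_lt; lra.
split; first lra.
have K x : nd x p <= 2 * Rmin (r / 4) (s / 4) -> forall t, (t <= N)%N -> Gd (fiter g t x).
  by move=> hx t ht; apply: He; rewrite -fiter_muln; apply: Hr; [lra | rewrite leq_mul2r ht orbT].
split=> x hx t ht; first by have G := K x hx t ht; split; [have [] := Gd_cont G | have [] := G].
by apply: Gd_periodic => [|t' ht']; [lia | apply: K => //; lia].
Qed.

(** If X and g X were both in the block, they would span a segment of length 2k with midpoint g X,
    which [K1] places strictly inside the small square. Compactness makes the separation uniform. *)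
Lemma exit_gap : exists eta, 0 < eta /\ forall X, Gd X -> s <= nd (g X) p -> ~ nearG Gd eta (g X).
Proof.
apply: NNPP => Q.
have C (n : nat) : exists q : pt * pt, Gd q.1 /\ s <= nd (g q.1) p /\ Gd q.2 /\ nd (g q.1) q.2 <= / INR n.+1.
  apply: NNPP => Q'; apply: Q; exists (/ INR n.+1); split.
    by apply: Rinv_0_lt_compat; apply: lt_0_INR; lia.
  by move=> X GX hX [G [HG n']]; apply: Q'; exists (X, G).
have [q Hq] := fchoice _ C.
have [t [X [ht [hX bX]]]] := BW (fun n => (q n).1) p s (fun n => proj1 (proj1 (Hq n))).
have GX : Gd X by apply: (Gd_cv hX) => n; have [] := Hq (t n).
have [cX _] := Gd_cont GX.
have gX := contat_cv _ _ _ cX hX.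
have lX : s <= nd (g X) p by apply: cv_ge gX _; exists 0%N => n _; have [_ []] := Hq (t n).
have GgX : Gd (g X).
  apply: (@Gd_cv (fun n => (q (t n)).2)) => [|n]; last by have [_ [_ []]] := Hq (t n).
  apply: (cv_near (fun n => g (q (t n)).1) _ _ (fun n => / INR (t n).+1)) => //.
    exact: (null_sub _ t ht null_inv).
  by exists 0%N => n _; rewrite nd_sym; have [_ [_ []]] := Hq (t n).
have : seg f p R0 (k + k)%coq_nat X by apply: seg_join; [have [_ []] := GX | have [_ []] := GgX].
by move/K1; rewrite -/g; lra.
Qed.

(** Frontier vertices accumulate at points of [Gd] whose image is on the boundary of the small
    square, and [exit_gap] separates these images from the block. *)
Lemma front_far : exists eta, 0 < eta /\ ev (fun h => forall v x y, let pos := gpos' p s h in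
  ~ Gd (pos v) -> nd (pos v) p <= s -> nearG Gd (3 * (s / INR h)) (pos v) -> nd (pos x) (pos v) <= 3 * (s / INR h) ->
  stp (ah g p s h) x y -> ~ nearG Gd eta (pos y)).
Proof.
have [eta [he He]] := exit_gap; exists (eta / 2); split; first lra.
apply: NNPP => Q; have [sg [hsg Hsg]] := not_ev _ Q.
pose T := ((nat * nat) * (nat * nat) * (nat * nat))%type.
have C (j : nat) : exists q : T, let pos := gpos' p s (sg j) in
  ~ Gd (pos q.1.1) /\ nd (pos q.1.1) p <= s /\ nearG Gd (3 * (s / INR (sg j))) (pos q.1.1) /\
  nd (pos q.1.2) (pos q.1.1) <= 3 * (s / INR (sg j)) /\ stp (ah g p s (sg j)) q.1.2 q.2 /\ nearG Gd (eta / 2) (pos q.2).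
  apply: NNPP => Q'; apply: (Hsg j) => v x y pos a1 a2 a3 a4 a5 a6; apply: Q'.
  by exists (v, x, y).
have [q Hq] := fchoice _ C.
have [t [X [ht [hX bX]]]] := BW (fun j => gpos' p s (sg j) (q j).1.1) p s (fun j => proj1 (proj2 (Hq j))).
have isg : incr (fun j => sg (t j)) by apply: incr_comp.
have GX : Gd X by apply: (nearG_cv isg _ hX) => j; have [_ [_ []]] := Hq (t j).
have [cX bgX] := Gd_cont GX.
have cx : cv (fun j => gpos' p s (sg (t j)) (q (t j)).1.2) X.
  apply: (cv_near (fun j => gpos' p s (sg (t j)) (q (t j)).1.1) _ _ (fun j => 3 * (s / INR (sg (t j))))) => //.
    move=> d hd; have nm := null_mesh hs isg; apply: ev_imp (nm (d / 3) ltac:(lra)) _ => n; lra.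
  by exists 0%N => n _; have [_ [_ [_ []]]] := Hq (t n).
have cy := step_cv hs isg (fun j => proj1 (proj2 (proj2 (proj2 (proj2 (Hq (t j))))))) cx cX bgX.
apply: (He X GX).
  have [_ [sX _]] := GX.
  (* By [K2] the orbit segment of the limit is strictly inside the large square. The vertices nearby
     inherit such a segment, so they can miss [Gd] only through their image under g. *)
  have E : ev (fun j => forall i, (i < k.+1)%coq_nat -> nd (fiter f i (gpos' p s (sg (t j)) (q (t j)).1.1)) p < R0).
    apply: ev_fin => i hi.
    have L := K2 (proj1 GX) sX bgX (j := i) ltac:(lia).
    have ci : contat (fiter f i) X by apply: (seg_contat _ _ _ HD k) => //; lia.
    apply: ev_imp (contat_cv _ _ _ ci hX (R0 - nd (fiter f i X) p) ltac:(lra)) _ => n /= hn.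
    have := nd_tri (fiter f i (gpos' p s (sg (t n)) (q (t n)).1.1)) (fiter f i X) p; lra.
  apply: cv_ge (contat_cv _ _ _ cX hX) _; apply: ev_imp E _ => n hn.
  apply: Rnot_lt_le => L; have [a1 [a2 _]] := Hq (t n); apply: a1; split=> //; split; last by left.
  by move=> i hi; left; apply: hn; lia.
have [j hj] := ev_ex _ (cy (eta / 2) ltac:(lra)).
have [_ [_ [_ [_ [_ [G [HG n]]]]]]] := Hq (t j); exists G; split=> //.
by have := nd_tri (g X) (gpos' p s (sg (t j)) (q (t j)).2) G; rewrite (nd_sym (g X) (gpos' _ _ _ _)); lra.
Qed.

(** The grid map of the constant map with value x serves to round x to a grid point. *)
Lemma grid_point_cv sg x : incr sg -> nd x p <= s ->
  cv (fun j => gpos' p s (sg j) (ah (fun _ => x) p s (sg j) (sg j, sg j))) x.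
Proof.
move=> hsg hx; apply: (@step_cv (fun _ => x) p s sg hs hsg (fun j => (sg j, sg j)) _ p) => //.
- by move=> j; apply: stp_map.
- by apply: cv_ext (cv_const p) => n; rewrite pos_center.
- by move=> e he; exists 1; split=> [|y _]; [lra | rewrite nd_refl].
Qed.

(** With L empty on arbitrarily fine meshes the block would be the whole small square, which would
    then lie in [Kplus]. A k-fold predecessor of z is in that square and in [Kminus], hence is p,
    and so is z. *)
Lemma exit_nonempty z : Kminus f p R0 z -> z <> p -> ev (fun h => exists d0 : Vt (gridm h), LV (@Mg p s h Gd) d0).
Proof.
move=> Kz zp; apply: NNPP => Q; have [sg0 [hsg0 Hsg0]] := not_ev _ Q.
pose sg j := sg0 j.+1.
have hsg : incr sg by move=> j; apply: hsg0.
have Hsg n : ~ (exists d0 : Vt (gridm (sg n)), LV (@Mg p s (sg n) Gd) d0) by apply: Hsg0.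
have sg1 j : (0 < sg j)%N by have := incr_ge sg0 hsg0 j.+1; rewrite /sg; lia.
have BG x : nd x p <= s -> Gd x.
  move=> hx; apply: (nearG_cv hsg _ (grid_point_cv hsg hx)) => j.
  set v := ah _ _ _ _ _; have hv : inV (gridm (sg j)) v by apply: ah_inV.
  have : ~~ LV (@Mg p s (sg j) Gd) (mkv _ v).
    by apply/negP => L; apply: (Hsg j); exists (mkv _ v).
  move=> /(notLV_near hs (sg1 j) Gd_p); rewrite vv_mkv // => -[G [HG n]]; exists G; split=> //.
  have := INR_pos (sg1 j) => hp; have : 0 < s / INR (sg j) by apply: Rdiv_lt_0_compat.
  lra.
have BK x : nd x p <= s -> Kplus f p R0 x.
  move=> hx i.
  have P t : nd (fiter g t x) p <= s.
    by elim: t => [|t IH] //; have [_ [_]] := BG _ IH.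
  have := Gd_seg (N := i) (fun t _ => BG _ (P t)) => /(_ i); apply.
  by have := leq_pmulr i k1; lia.
have [y [E [Ky Hy]]] := Kminus_preds (k + k) Kz.
have sy : seg f p R0 (k + k)%coq_nat y by move=> i hi; apply: (Km_in f p R0 0); apply: Hy; lia.
have := K1 sy => ny.
have yp : fiter f k y = p.
  apply: (Kminus_Kplus _ _ _ HD); first by apply: Hy; lia.
  by apply: BK; lra.
by apply: zp; rewrite -E [LHS](fiter_add f k k) yp; apply: fiter_fix; apply: (iso_fix _ _ _ HD).
Qed.

(** A nonzero entry in the column at the square of q gives a walk in M that ends there. Its limit
    would be a backward orbit of q longer than q admits. *)
Lemma no_backward e q : (forall x, nd x p <= e -> Gd x) -> e <= s -> nd q p < e -> ~ Kminus f p R0 q ->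
  exists N, ev (fun h => exists Q : St (gridm h), @Mg p s h Gd Q /\
    forall i, ((pj (predC (LSi (@Mg p s h Gd))) *m F2 (gridm h) (ah g p s h) *m
      pj (predC (LSi (@Mg p s h Gd)))) ^+ N)%R i (enum_rank Q) = 0%R).
Proof.
move=> He hes hq nK.
have [j0 Hj0] : exists j, ~ Km f p R0 j q by apply: not_all_ex_not.
(* The successor excludes the exponent 0, for which the matrix is the identity and the walk has no
   step witnessing that its end is in M. *)
exists j0.+1; apply: NNPP => H; have [sg0 [hsg0 Hsg0]] := not_ev _ H.
have cq0 := grid_point_cv hsg0 (x := q) ltac:(lra).
have [N0 HN0] := ev_and _ _ (cq0 (e - nd q p) ltac:(lra)) (ev_ge 1).
pose sg j := sg0 (N0 + j)%N.
have hsg : incr sg by move=> j; rewrite /sg addnS; apply: hsg0.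
have cq := grid_point_cv hsg (x := q) ltac:(lra).
pose b j := ah (fun _ => q) p s (sg j) (sg j, sg j).
have sg1 j : (0 < sg j)%N by have := incr_ge sg0 hsg0 (N0 + j)%N; have [_] := HN0 (N0 + j)%N ltac:(lia); rewrite /sg; lia.
have bpos j : nd (gpos' p s (sg j) (b j)) p < e.
  have [n _] := HN0 (N0 + j)%N ltac:(lia); rewrite -/(sg j) -/(b j) in n.
  have := nd_tri (gpos' p s (sg j) (b j)) q p; lra.
have bs j : ss (mks (gridm (sg j)) (b j)) = b j.
  have hp := INR_pos (sg1 j).
  have key (i : nat) : Rabs (s / INR (sg j) * (INR i - INR (sg j))) < s -> (i < (gridm (sg j)).+1)%N.
    have -> : (gridm (sg j)).+1 = (sg j + sg j)%N by rewrite /gridm; have := sg1 j; lia.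
    move=> /Rabs_def2 [l _]; have : s / INR (sg j) * (INR i - INR (sg j)) * INR (sg j) < s * INR (sg j) by apply: Rmult_lt_compat_r.
    have -> : s / INR (sg j) * (INR i - INR (sg j)) * INR (sg j) = s * (INR i - INR (sg j)) by field; lra.
    move=> L; have : INR i < INR (sg j + sg j) by rewrite plus_INR; nra.
    by move/INR_lt => ?; lia.
  have sh (x y : R) : x + y - x = y by ring.
  have := bpos j; case: (b j) => i l /nd_lt; rewrite /gpos' /gpos /= !sh => -[l1 l2].
  by rewrite ss_mks //=; apply: key; lra.
pose MM j := @Mg p s (sg j) Gd.
have MQ j : MM j (mks (gridm (sg j)) (b j)).
  by apply: (ball_Mg hs (sg1 j) Gd_p He); rewrite bs; left.
have C (j : nat) : exists x : nat -> nat * nat, swalk (ah g p s (sg j)) j0.+1 x /\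
   (forall t, (t <= j0.+1)%N -> nearG Gd (3 * (s / INR (sg j))) (gpos' p s (sg j) (x t)) /\ nd (gpos' p s (sg j) (x t)) p <= s) /\ x j0.+1 = b j.
  apply: NNPP => Q'; apply: (Hsg0 (N0 + j)%N); exists (mks (gridm (sg j)) (b j)); split; first exact: MQ.
  move=> i; apply/eqP; apply: contraT => /exp_walk [w [w0 wN ww]]; case: Q'.
  have st t : (t < j0.+1)%N -> [/\ MM j (enum_val (w t)), MM j (enum_val (w t.+1)) & stp (ah g p s (sg j)) (ss (enum_val (w t))) (ss (enum_val (w t.+1)))].
    move=> /ww; rewrite mul_pjr mul_pjl /= /LSi !negbK -/(MM j) -/(sg j).
    case: (MM j _); last by rewrite !mul0r.
    case: (MM j _); last by rewrite !mulr0.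
    rewrite mul1r mulr1 => nz; split=> //; apply: stp_F2; first by move=> v; apply: ah_inV.
    by rewrite !enum_valK.
  exists (fun t => ss (enum_val (w t))); split; first by move=> t /st [].
  split; last by rewrite wN enum_rankK bs.
  move=> t ht.
  have Mt : MM j (enum_val (w t)).
    by move: ht; rewrite leq_eqVlt => /orP [/eqP ->|/st []//]; have [] := st j0 (ltnSn _).
  have hd : 0 < s / INR (sg j) by apply: Rdiv_lt_0_compat => //; apply: INR_pos.
  split.
    have := Mg_nearG hs (sg1 j) Gd_p Mt (corner_refl _) => -[G [HG n]]; exists G; split=> //; apply: Rle_trans n _; lra.
  apply: box_bd => //; have [a1 a2] := ss_lt (enum_val (w t)).
  by rewrite /inV (ltnW a1) (ltnW a2).
have [x Hx] := fchoice _ C.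
pose Qc h v := nearG Gd (3 * (s / INR h)) (gpos' p s h v) /\ nd (gpos' p s h v) p <= s.
have [s' [X [hs' GX cX]]] := @limit_walk g p s hs Qc Gd (fun h v q => proj2 q)
   (fun sg c X hs hq => nearG_cv hs (fun j => proj1 (hq j))) Gd_cont j0.+1 sg x hsg (fun j => proj1 (Hx j)) (fun j => proj1 (proj2 (Hx j))).
apply: Hj0; apply: (Km_mono _ _ _ _ (j0.+1 * k)%N); first by have := leq_pmulr j0.+1 k1; lia.
exists X; split; first exact: Gd_seg.
rewrite fiter_muln; apply: (cv_unique (fun j => gpos' p s (sg (s' j)) (x (s' j) j0.+1))); first exact: cX.
by apply: cv_ext (cv_sub _ _ _ hs' cq) => j; have [_ [_ ->]] := Hx (s' j).
Qed.
End Dyn.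

Lemma natrZ n : (n%:R)%R = Z.of_nat n.
Proof. by elim: n => // n IH; rewrite mulrS IH; lia. Qed.

Section Buckets.
Variables (eta dl s : R) (h K : nat).
Hypotheses (he : 0 < eta) (hdl : 0 < dl) (hh : INR h * dl = s) (hK : 2 * s / eta < INR K.+1).

Definition bkt (i : nat) : 'I_K.+1 := inord (nflo (INR i * dl / eta)).

Lemma bkt_near i j : (i <= h + h)%N -> (j <= h + h)%N -> bkt i = bkt j -> Rabs (dl * (INR i - INR j)) <= eta.
Proof.
have B (x : nat) : (x <= h + h)%N -> INR (bkt x) * eta <= INR x * dl < (INR (bkt x) + 1) * eta.
  move=> hx; have x0 := pos_INR x.
  have q0 : 0 <= INR x * dl / eta by apply: Rmult_le_pos; [nra | left; apply: Rinv_0_lt_compat].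
  have [a b] := nflo_spec q0.
  have E : INR x * dl / eta * eta = INR x * dl by field; lra.
  have lt : (nflo (INR x * dl / eta) < K.+1)%N.
    have : INR (nflo (INR x * dl / eta)) < INR K.+1.
      apply: Rle_lt_trans a _; apply: Rle_lt_trans hK; apply: Rmult_le_compat_r; first by left; apply: Rinv_0_lt_compat.
      have := INR_leq hx; rewrite plus_INR; nra.
    by move/INR_lt => ?; lia.
  rewrite /bkt inordK //; nra.
move=> hi hj E; have := B i hi; have := B j hj; rewrite E => -[a1 a2] [b1 b2].
rewrite Rmult_minus_distr_l; apply: Rabs_le; lra.
Qed.
End Buckets.

(** * The index formula for a single high iterate *)

Section Assembly.
Variables (f : pt -> pt) (p : pt) (R0 : R).
Hypothesis HD : isodyn f p R0.
Variable s : R.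
Hypotheses (hs : 0 < s) (hsR : s <= R0).
Hypothesis K2 : forall k x, nd x p <= s -> seg f p R0 k x -> nd (fiter f k x) p <= s ->
  forall j, (j <= k)%coq_nat -> nd (fiter f j x) p < R0.
Variable k : nat.
Hypothesis k1 : (0 < k)%N.
Hypothesis K1 : forall y, seg f p R0 (k + k)%coq_nat y -> nd (fiter f k y) p < s.
Variable z : pt.
Hypotheses (Kz : Kminus f p R0 z) (zp : z <> p).
Hypothesis noKm : forall e, 0 < e -> exists q, nd q p < e /\ ~ Kminus f p R0 q.
Let g := fiter f k.
Local Notation G := (Gd f p R0 s k).

Let GP : G p. Proof. exact: (Gd_p HD hs). Qed.

Lemma gp_fix : g p = p. Proof. exact: fiter_fix (iso_fix _ _ _ HD). Qed.

Theorem block_index : exists C, forall nmax r, 0 < r -> 2 * r < s -> good g p s r nmax ->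
  exists al : nat -> nat, (exists d, (0 < d <= C)%N /\ (0 < al d)%N) /\
   forall n, (0 < n <= nmax)%N -> idx (fiter g n) p r (1 - Z.of_nat (\sum_(1 <= d < C.+1 | d %| n) d * al d))%Z.
Proof.
have [e [he [hes He]]] := Gd_ball HD hs hsR k1.
have [q [hq nq]] := noKm he.
have [Nq evq] := no_backward HD hs hsR k1 He hes hq nq.
have [eta [heta evf]] := front_far HD hs K2 k1 K1.
have evd := exit_nonempty HD hs hsR k1 K1 Kz zp.
pose K := nflo (2 * s / (eta / 4)).
have hK : 2 * s / (eta / 4) < INR K.+1.
  have q0 : 0 <= 2 * s / (eta / 4) by apply: Rmult_le_pos; [lra | left; apply: Rinv_0_lt_compat; lra].
  by rewrite S_INR; have [] := nflo_spec q0.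
(* The number of boxes of side [eta / 4] covering the small square. It is fixed before [nmax] and
   the mesh are chosen. *)
pose C0 := #|{: 'I_K.+1 * 'I_K.+1}|.
exists C0.+1 => nmax r hr hrs Gr.
(* Cells within [e'] of p are, on a fine mesh, both off L and inside the window of radius r. *)
pose e' := Rmin (e / 2) (r / 2).
have e'0 : 0 < e' by apply: Rmin_glb_lt; lra.
have e'1 : e' <= e / 2 by apply: Rmin_l.
have e'2 : e' <= r / 2 by apply: Rmin_r.
pose Qc h v := nearG G (3 * (s / INR h)) (gpos' p s h v) /\ nd (gpos' p s h v) p <= s.
have [Gr1 Gr2] := Gr.
have ev0 : ev (fun h => forall N, (N < nmax)%coq_nat -> forall x, swalk (ah g p s h) N.+1 x -> x N.+1 = x 0%N ->
    nd (gpos' p s h (x 0%N)) p <= r -> forall t, (t <= N.+1)%N -> nd (gpos' p s h (x t)) p <= e').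
  apply: ev_fin => N hN; apply: closed_walk_start => //; last exact: gp_fix.
    by move=> x hx t ht; apply: Gr1; [lra | lia].
  by move=> x hx; apply: Gr2; [lra | lia].
have ev1 : ev (fun h => forall N, (N < nmax)%coq_nat -> forall x, swalk (ah g p s h) N.+1 x -> x N.+1 = x 0%N ->
    (forall t, (t <= N.+1)%N -> Qc h (x t)) -> nd (gpos' p s h (x 0%N)) p <= e').
  apply: ev_fin => N hN; apply: (@closed_walk_inside g p s hs Qc G (fun h v q => proj2 q)
     (fun sg c X hi hq => nearG_cv HD hs k1 hi (fun j => proj1 (hq j))) (@Gd_cont _ _ _ HD s k k1)) => // X GX.
  exact: (Gd_periodic HD hsR k1).
have ev2 : ev (fun h => forall N, (N < nmax)%coq_nat -> (0 < h)%N /\ idx (fiter g N.+1) p r (ltrh g p s h N.+1 r)).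
  apply: ev_fin => N hN; apply: index_grid => //.
    by move=> x hx t ht; apply: Gr1; [lra | lia].
  by move=> x hx; apply: Gr2; [lra | lia].
have id_incr : incr (fun n => n) by move=> n; lia.
have nm := null_mesh hs id_incr.
(* The mesh bounds serve, in order, the margin of the frontier images, the ball contained in M, and
   the rounded window. *)
pose mu := Rmin (eta / 16) (Rmin (e / 2) (r / 4)).
have mu0 : 0 < mu by apply: Rmin_glb_lt; [lra|apply: Rmin_glb_lt; lra].
have [mu1 mu2 mu3] : [/\ mu <= eta / 16, mu <= e / 2 & mu <= r / 4].
  have := Rmin_l (eta / 16) (Rmin (e / 2) (r / 4)); have := Rmin_r (eta / 16) (Rmin (e / 2) (r / 4)).
  have := Rmin_l (e / 2) (r / 4); have := Rmin_r (e / 2) (r / 4); rewrite -/mu => *; split; lra.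
have [h [[[Hq Hf] [[d0 Hd0] H0]] [[H1 H2] [Hm h0]]]] := ev_ex _ (ev_and _ _ (ev_and _ _ (ev_and _ _ evq evf) (ev_and _ _ evd ev0))
   (ev_and _ _ (ev_and _ _ ev1 ev2) (ev_and _ _ (nm mu mu0) (ev_ge 1)))).
have {}h0 : (0 < h)%N by lia.
have hp := INR_pos h0.
set dl := s / INR h in Hm.
have hdl : 0 < dl by apply: Rdiv_lt_0_compat.
have sdl : INR h * dl = s by rewrite /dl; field; lra.
pose m := gridm h; pose a := ah g p s h; pose M := @Mg p s h G; pose pos := gpos' p s h.
have nE : m.+1 = (h + h)%N by rewrite /m /gridm; lia.
have aV v : inV m (a v) by apply: ah_inV.
have Mind := Mg_ind (p := p) (s := s) (h := h) (Gd := G).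
have farE x y v : front M v -> nd (pos x) (pos (vv v)) <= 3 * dl -> stp a x y -> ~ nearG G eta (pos y).
  move=> fv nx st; apply: (Hf (vv v) x y) => //.
  - exact: (front_notGd hs h0 GP).
  - exact: vv_bd.
  - by have [G0 [HG n]] := front_nearG hs h0 GP fv; exists G0; split=> //; rewrite -/dl in n *; lra.
have far_of y d : d + 3 * dl <= eta -> forall y', nd (pos y') (pos y) <= d -> ~ nearG G eta (pos y) -> far s h G (pos y').
  move=> hd y' ny nf [G0 [HG n]]; apply: nf; exists G0; split=> //.
  have := nd_tri (pos y) (pos y') G0; rewrite (nd_sym (pos y) (pos y')); rewrite -/dl in n; lra.
have fA v : front M v -> ~ nearG G eta (pos (a (vv v))).
  by move=> fv; apply: (farE (vv v) _ v fv); [rewrite nd_refl; lra | apply: stp_map].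
have frontV v : front M v -> LV M (av a v).
  move=> fv; apply: (far_LV hs h0 GP); rewrite vv_av //.
  by apply: (far_of (a (vv v)) 0) (fA v fv); [lra | rewrite nd_refl; lra].
have frontF (x x' : Et m) : LE M x -> ME M x -> kF1 a x x' != 0%R -> LE M x'.
  move=> Lx Mx nz; have [l1 _] := LE_LV Lx; have [m1 _] := ME_MV Mx.
  have fx : front M (mkv m (src x)) by rewrite /front l1 m1.
  have st : stp a (src x) (src x') by apply: (@stp_F1 m) => //; rewrite mxEr.
  have := farE _ _ _ fx _ st; rewrite vv_mkv ?inV_src // nd_refl => H.
  apply: (far_LE hs h0 GP); apply: (far_of (src x') 0); [lra | rewrite nd_refl; lra | apply: H; lra].
(* The box between two grid points in one bucket stays within [eta / 4] of the first. If that one is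
   the image of a frontier vertex, the box remains far from M. *)
pose bk (v : Vt m) : 'I_C0 := enum_rank (bkt (eta / 4) dl K (vv v).1, bkt (eta / 4) dl K (vv v).2).
have bkP v w : front M v -> front M w -> bk (av a v) = bk (av a w) -> connect (lrel M) (av a v) (av a w).
  move=> fv fw /enum_rank_inj; rewrite !vv_av // => -[E1 E2].
  have /andP [v1 v2] := aV (vv v); have /andP [w1 w2] := aV (vv w); rewrite nE in v1 v2 w1 w2.
  have N1 := bkt_near (ltac:(lra) : 0 < eta / 4) hdl sdl hK v1 w1 E1.
  have N2 := bkt_near (ltac:(lra) : 0 < eta / 4) hdl sdl hK v2 w2 E2.
  apply: (far_box hs h0 GP) => // y y1 y2.
  apply: (far_of (a (vv v)) (eta / 4)) (fA v fv); first by lra.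
  have sub (i j l : nat) : (minn i j <= l <= maxn i j)%N -> Rabs (dl * (INR i - INR j)) <= eta / 4 -> Rabs (dl * (INR l - INR i)) <= eta / 4.
    have AM u : Rabs (dl * u) = dl * Rabs u by rewrite Rabs_mult (Rabs_pos_eq dl) //; lra.
    move=> hl; rewrite !AM => H; apply: Rle_trans H; apply: Rmult_le_compat_l; first lra.
    case: (leqP i j) => ij.
      have b1 : INR i <= INR l by apply/le_INR; lia.
      have b2 : INR l <= INR j by apply/le_INR; lia.
      rewrite Rabs_pos_eq; last lra.
      rewrite Rabs_left1; lra.
    have b1 : INR l <= INR i by apply/le_INR; lia.
    have b2 : INR j <= INR l by apply/le_INR; lia.
    rewrite Rabs_left1; last lra.
    rewrite Rabs_pos_eq; lra.
  apply/nd_le; rewrite /pos /gpos' /gpos /= -/dl.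
  have sh x u v' : x + dl * (u) - (x + dl * v') = dl * (u - v') by ring.
  split; rewrite sh (_ : forall u v' w', u - w' - (v' - w') = u - v'); try (by move=> *; ring).
    exact: sub y1 N1.
  exact: sub y2 N2.
have cnt := psi_count d0 bkP.
have [Q [MQ HQ]] := Hq.
pose psI := psiI M a d0.
have tr := region_trace Mind aV Hd0 frontV frontF MQ HQ.
(* A periodic point is a value of psi, and [psi_count] bounds the number of values. *)
have cycC : (#|[set x | LVi M x && cyc psI x]| <= C0.+1)%N.
  apply: leq_trans cnt; apply: leq_trans (leq_imset_card enum_rank _); apply: subset_leq_card; apply/subsetP => x.
  rewrite inE => /andP [_ /eqP cx]; move: cx; case: (order psI x) (order_gt0 psI x) => // o _ /= <-.
  by apply/imsetP; exists (psi M a d0 (enum_val (iter o psI x))) => //; apply/imsetP; exists (enum_val (iter o psI x)).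
have psL x : LVi M x -> LVi M (psI x) by move=> _; rewrite /LVi /psI /psiI enum_rankK; apply: psi_LV.
pose al d := (#|cyc_set psI (LVi M) d| %/ d)%N.
have cF n : (0 < n)%N -> _ := @count_fix _ psI (LVi M) psL C0.+1 n cycC.
exists al; split.
  (* A periodic point exists because L is not empty. Its period would give a zero count if all
     coefficients vanished. *)
  have [y Ly cy] := @cyc_exists _ psI (LVi M) psL (enum_rank d0) ltac:(by rewrite /LVi enum_rankK).
  have := cF (order psI y) (order_gt0 _ _).
  case: (pickP [pred d : 'I_C0.+2 | (0 < d)%N && (0 < al d)%N]) => [d /andP [d1 d2] _|H].
    by exists d; split=> //; rewrite d1 -ltnS ltn_ord.
  rewrite big_nat_cond big1 => [/card0_eq /(_ y)|d].
    by rewrite !inE Ly [X in _ && X]cy.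
  move=> /andP [/andP [d1 d2] _]; have := H (Ordinal d2); rewrite /= d1 /= -/(al d).
  by case: (al d) => // _; rewrite muln0.
move=> [//|N] /andP [_ hN].
have [_ I] := H2 N ltac:(lia).
suff E : ltrh g p s h N.+1 r = (1 - Z.of_nat (\sum_(1 <= d < C0.+2 | d %| N.+1) d * al d))%Z by rewrite -E.
rewrite -(cF N.+1) // -natrZ.
transitivity ((1 - #|[pred i | LVi M i && (iter N.+1 psI i == i)]|%:R)%R : Z); last by [].
rewrite -(tr N).
have hrs' : r < s by lra.
have nearD v : nd (pos v) p <= e' -> nd (pos v) p + dl <= e by lra.
have nW v : nd (pos v) p <= e' -> [&& h - rad r s h <= v.1, v.1.+1 <= h + rad r s h, h - rad r s h <= v.2 & v.2.+1 <= h + rad r s h]%N.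
  by move=> hv; apply: (@near_inW p) => //; [rewrite -/dl; lra | rewrite -/pos; lra].
have Qw x : inV m x -> nearG G (2 * dl) (pos x) -> Qc h x.
  by move=> hx [G0 [HG n]]; split; [exists G0; split=> //; rewrite -/dl -/pos; lra | apply: box_bd].
apply: (@ltr_trace m a N _ _ aV (fun v => nd (pos v) p <= e') (Qc h) (predC (LV M)) (predC (LE M)) (predC (fun t => ~~ M t))).
- by move=> x wx cx /(inW_pos p hs h0 hr hrs') x0; apply: H0 => //; lia.
- by move=> x wx cx hx; apply: (H1 N) => //; lia.
- move=> v hv; rewrite /= (ball_notLV hs h0 GP He (nearD _ hv)); have := nW _ hv; clear.
  by rewrite /oV /inW; case: (vv v) => i j /=; lia.
- move=> v hv; rewrite /= (ball_notLE hs h0 GP He (nearD _ hv)); have := nW _ hv; clear.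
  by rewrite /oE /inW /src /tgt /nsrc /ntgt; case: (ee v) => [[] [i j]] /=; lia.
- move=> v hv; have Mv : M v by apply: (ball_Mg hs h0 GP He); apply: Rle_trans hv _; lra.
  by rewrite /= negbK Mv; have := nW _ hv; clear; rewrite /oS /inW; case: (ss v) => i j /=; lia.
- by move=> v Lv; apply: Qw (inV_vv _) (notLV_near hs h0 GP Lv).
- by move=> v Lv; apply: Qw (inV_src _) (notLE_near hs h0 GP Lv).
- move=> v; rewrite /= negbK => Mv; apply: Qw.
    by have [a1 a2] := ss_lt v; rewrite /inV (ltnW a1) (ltnW a2).
  exact: (Mg_nearG hs h0 GP Mv (corner_refl _)).
Qed.
End Assembly.

Lemma idx_ext g g' p r k : (forall x, g x = g' x) -> idx g p r k -> idx g' p r k.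
Proof. by move=> E; apply: winding_ext => t _; rewrite E. Qed.

Lemma idx_unique g p r k k' : idx g p r k -> idx g p r k' -> k = k'.
Proof. exact: winding_unique. Qed.

(** * The sequence of indices of all iterates *)

Section IndexSequence.
Variables (f : pt -> pt) (p : pt) (R0 : R).
Hypothesis HD : isodyn f p R0.
Variable s : R.
Hypotheses (hs : 0 < s) (hsR : s <= R0).

(** The index is recorded for all smaller radii as well, so that different iterates can be compared
    on a common circle. *)
Definition small_index n r0 i := 0 < r0 /\ 2 * r0 < s /\ good f p s r0 n /\ forall r, 0 < r <= r0 -> idx (fiter f n) p r i.

Lemma small_index_exists n : (0 < n)%N -> exists q : R * Z, small_index n q.1 q.2.
Proof.
case: n => // n _; have [r0 [h0 [h1 G]]] := good_exists HD hs hsR (k := 1) isT n.+1.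
have [i [I _]] := @idx_radius f p s n r0 r0 hs h0 h1 h0 h1 (iso_fix _ _ _ HD) G G.
exists (r0, i); do 3 split=> //; move=> r /= [hr hr0].
have G' : good f p s r n.+1 by apply: good_le G.
have [i' [I1 I2]] := @idx_radius f p s n r0 r hs h0 h1 hr ltac:(lra) (iso_fix _ _ _ HD) G G'.
by rewrite (idx_unique I I1).
Qed.

Lemma index_sequence : exists i : nat -> Z, forall n, (0 < n)%N -> exists r0, small_index n r0 (i n).
Proof.
have H (n : nat) : exists q : R * Z, (0 < n)%N -> small_index n q.1 q.2.
  case: n => [|n]; first by exists (0, 0%Z).
  by have [q Hq] := small_index_exists (ltn0Sn n); exists q.
have [q Hq] := fchoice _ H.
by exists (fun n => (q n).2) => n /Hq; exists (q n).1.
Qed.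

Variable i : nat -> Z.
Hypothesis Hi : forall n, (0 < n)%N -> exists r0, small_index n r0 (i n).

Lemma index_prime q m : prime q -> (0 < m)%N -> exists c, i (q * m) = (i m + c * Z.of_nat q)%Z.
Proof.
move=> pq m0; have [r [hr [hrs G]]] := good_exists HD hs hsR m0 q.
have [r1 [h1 [_ [_ K1]]]] := Hi m0; have [r2 [h2 [_ [_ K2]]]] := Hi (n := (q * m)%N) ltac:(by rewrite muln_gt0 prime_gt0).
pose r' := Rmin r (Rmin r1 r2).
have m1 : r' <= r by apply: Rmin_l.
have [m2 m3] : r' <= r1 /\ r' <= r2.
  by have := Rmin_r r (Rmin r1 r2); have := Rmin_l r1 r2; have := Rmin_r r1 r2; rewrite -/r'; lra.
have m4 : 0 < r' by do 2 (apply: Rmin_glb_lt => //).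
have [a [b [c [A [B E]]]]] := idx_prime pq hs m4 ltac:(lra) (fiter_fix f p m (iso_fix _ _ _ HD)) (good_le m1 (leqnn q) G).
exists c.
have -> : i m = a by apply: idx_unique (K1 _ _) A; lra.
have -> : i (q * m)%N = b; last exact: E.
apply: idx_unique (K2 r' ltac:(lra)) _.
by apply: idx_ext B => x; rewrite [RHS](fiter_mul f q m).
Qed.
End IndexSequence.

Lemma index_formula f p R0 : isodyn f p R0 -> (exists z, Kminus f p R0 z /\ z <> p) ->
  (forall e, 0 < e -> exists q, nd q p < e /\ ~ Kminus f p R0 q) ->
  exists s C al, [/\ 0 < s <= R0, posal C al & forall n, (0 < n)%N -> exists r0, small_index f p s n r0 (1 - Z.of_nat (dsum C al n))].
Proof.
move=> HD [z [Kz zp]] noKm.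
have [s [hs [hsR K2]]] := seg_interior _ _ _ HD.
have [k0 K1] := seg_middle_ge _ _ _ HD s hs.
have [i Hi] := index_sequence HD hs hsR.
have [C [al [pa H]]] : exists C al, posal C al /\ forall n, (0 < n)%N -> (1 - i n)%Z = Z.of_nat (dsum C al n).
  apply: (@periodic_count (fun n => 1 - i n)%Z k0.+1) => // [k hk|q m pq m0]; last first.
    by have [c ->] := index_prime HD hs hsR Hi pq m0; exists (- c)%Z; lia.
  have k1 : (0 < k)%N by lia.
  have [C HC] := block_index HD hs hsR K2 k1 (K1 k ltac:(lia)) Kz zp noKm.
  exists C => nmax; have [r [hr [hrs G]]] := good_exists HD hs hsR k1 nmax.
  have HR : forall j : nat, exists r0, (j < nmax)%N -> 0 < r0 /\ forall r, 0 < r <= r0 -> idx (fiter f (j.+1 * k)) p r (i (j.+1 * k)%N).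
    move=> j; have [r0 [h0 [_ [_ K]]]] := Hi (j.+1 * k)%N ltac:(by rewrite muln_gt0 k1).
    by exists r0.
  (* A common radius for the finitely many iterates up to [nmax], as required by [block_index]. *)
  have [r' [hr' Hr']] : exists r', 0 < r' <= r /\ forall j, (j < nmax)%N -> idx (fiter f (j.+1 * k)) p r' (i (j.+1 * k)%N).
    have [rr Hrr] := fchoice _ HR.
    have : forall N, (N <= nmax)%N -> exists r', 0 < r' <= r /\ forall j, (j < N)%N -> forall u, 0 < u <= r' -> idx (fiter f (j.+1 * k)) p u (i (j.+1 * k)%N).
      elim=> [|N IH] hN; first by exists r; split; [lra|].
      have [u [hu Hu]] := IH (ltnW hN); have [v0 Hv] := Hrr N hN.
      have m1 := Rmin_l u (rr N); have m2 := Rmin_r u (rr N); have m0 := Rmin_glb_lt _ _ _ (proj1 hu) v0.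
      exists (Rmin u (rr N)); split; first lra.
      move=> j; rewrite ltnS leq_eqVlt => /orP [/eqP ->|hj] w hw; first by apply: Hv; lra.
      by apply: Hu => //; lra.
    move=> /(_ nmax (leqnn _)) [u [hu Hu]]; exists u; split=> // j hj; apply: Hu => //; lra.
  have G' : good (fiter f k) p s r' nmax by apply: good_le G => //; lra.
  have [al [pa Ha]] := HC nmax r' (proj1 hr') ltac:(lra) G'.
  exists al; split=> // -[//|n] hn.
  have A := Ha n.+1 hn; have B := Hr' n ltac:(lia).
  have {}A : idx (fiter f (n.+1 * k)) p r' (1 - Z.of_nat (dsum C al n.+1)).
    by apply: idx_ext A => x; rewrite [RHS](fiter_mul f n.+1 k).
  by rewrite (idx_unique B A); lia.
exists s, C, al; split=> // n n0; have [r0 K] := Hi n n0; exists r0.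
by rewrite -(H n n0) (_ : (1 - (1 - i n))%Z = i n) //; lia.
Qed.

Lemma dvdn_mod d n : (0 < d)%N -> (d %| n) = Nat.eqb (Nat.modulo n d) 0.
Proof.
move=> d0; apply/idP/idP => [/dvdnP [c ->]|/Nat.eqb_spec H].
  by apply/Nat.eqb_spec; rewrite -multE Nat.Div0.mod_mul.
by apply/dvdnP; exists (Nat.div n d); have := Nat.div_mod n d ltac:(lia); rewrite H; nia.
Qed.

Lemma sum_Z_filter (P : nat -> bool) (F : nat -> Z) a len :
  sum_Z (List.map F (List.filter P (List.seq a len))) = (\sum_(a <= d < a + len) (if P d then F d else 0))%R.
Proof.
elim: len a => [|len IH] a; first by rewrite addn0 big_geq.
rewrite /= addnS big_ltn; last by lia.
by rewrite -addSn -IH; case: (P a) => //=; rewrite add0r.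
Qed.

Lemma fp_index_small U f p R0 s n r0 k : isodyn f p R0 -> (forall x, nd x p <= R0 -> U x) -> 0 < s <= R0 -> (0 < n)%N ->
  small_index f p s n r0 k -> fp_index (fiter_dom U f n) (fiter f n) p k.
Proof.
move=> HD HU hs n0 [h0 [h1 [[G1 G2] I]]]; split; first exact: fiter_fix (iso_fix _ _ _ HD).
have dn x : dist2 x p <= r0 -> nd x p <= 2 * r0 by have := nd_le_dist2 x p; lra.
exists r0; split=> //; split; last split; last split.
- move=> x /dn hx j hj; apply: HU; have [_] := G1 x hx j ltac:(lia); lra.
- move=> x /dn hx e he.
  have c : contat (fiter f n) x by apply: contat_fiter => j hj; have [] := G1 x hx j ltac:(lia).
  have [d [hd Hd]] := c (e / 2) ltac:(lra); exists d; split=> // y _ hy.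
  have := Hd y; have := nd_le_dist2 x y; have := dist2_le_nd (fiter f n x) (fiter f n y).
  move=> a1 a2 /(_ ltac:(lra)); lra.
- by move=> x /dn hx; apply: G2 => //; rewrite n0 leqnn.
- by apply: I; lra.
Qed.

Theorem index_iterates (U : pt -> Prop) (f : pt -> pt) (p : pt)
  (hU : open2 U) (hf : cont_on2 U f) (hp : U p)
  (hiso : isolated_fixed_set U f p)
  (hsink : ~ is_sink U f p) (hsource : ~ is_source U f p) :
  exists (F : list nat) (a : nat -> nat),
    F <> nil /\ NoDup F /\
    (forall k, In k F -> (1 <= k)%coq_nat /\ (1 <= a k)%coq_nat) /\
    forall n : nat, (1 <= n)%coq_nat ->
      fp_index (fiter_dom U f n) (fiter f n) p
        (sigk 1 n - sum_Z (List.map (fun k => (Z.of_nat (a k) * sigk k n)%Z) F))%Z.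
Proof.
have [R0 [HD HU]] := isodyn_of_isolated _ _ _ hU hf hp hiso.
have hR := iso_pos _ _ _ HD.
(* Not a sink: the local unstable set is not reduced to p. *)
have Ez : exists z, Kminus f p R0 z /\ z <> p.
  apply: NNPP => Q; apply: hsink; apply: (sink_of_Kminus U f p R0 HD HU hiso) => x Kx.
  by apply: NNPP => xp; apply: Q; exists x.
(* Not a source: arbitrarily close to p there is another point whose forward orbit stays close.
   Being in [Kplus], it cannot also be in [Kminus]. *)
have Eq e : 0 < e -> exists q, nd q p < e /\ ~ Kminus f p R0 q.
  move=> he; apply: NNPP => Q; apply: hsource.
  pose rho := Rmin (e / 2) R0.
  have m1 : rho <= e / 2 by apply: Rmin_l.
  have m2 : rho <= R0 by apply: Rmin_r.
  have m0 : 0 < rho by apply: Rmin_glb_lt; lra.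
  apply: (source_of_Kplus U f p R0 HD HU hiso rho (conj m0 m2)) => x Hx.
  apply: NNPP => xp; apply: Q; exists x; split; first by have := Hx 0%N => /=; lra.
  move=> Kx; apply: xp; apply: (Kminus_Kplus _ _ _ HD) => // j; have := Hx j; lra.
have [s [C [al [hs [d [hd ad]] H]]]] := index_formula HD Ez Eq.
(* Indices with zero coefficient are dropped to make every [a k] positive; [posal] keeps the list
   nonempty. *)
exists (List.filter (fun d => 0 < al d)%N (List.seq 1 C)), al.
have inF j : List.In j (List.filter (fun d => 0 < al d)%N (List.seq 1 C)) <-> (0 < j <= C)%N /\ (0 < al j)%N.
  by rewrite filter_In in_seq; split=> -[a b]; split=> //; lia.
split; first by move=> E; have := proj2 (inF d) (conj hd ad); rewrite E.
split; first by apply: NoDup_filter; apply: seq_NoDup.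
split; first by move=> j /inF [a b]; split; lia.
move=> n n1; have n0 : (0 < n)%N by lia.
have [r0 K] := H n n0.
rewrite (_ : _ - _ = 1 - Z.of_nat (dsum C al n))%Z; first exact: fp_index_small HD HU hs n0 K.
rewrite sum_Z_filter (_ : sigk 1 n = 1%Z); last by rewrite /sigk Nat.mod_1_r.
congr (Z.sub _ _); rewrite /dsum [X in Z.of_nat X]big_mkcond /= add1n -[RHS]natrZ natr_sum.
rewrite big_nat_cond [RHS]big_nat_cond; apply: eq_bigr => j /andP [/andP [j0 _] _].
rewrite /sigk -dvdn_mod //; rewrite natrZ; case: (j %| n); case: (posnP (al j)) => [a0|_] //; rewrite ?a0 ?muln0 ?Z.mul_0_r //.
by rewrite Nat2Z.inj_mul Z.mul_comm.
Qed.

End Plane.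

Theorem theorem1 (U : pt -> Prop) (f : pt -> pt) (p : pt)
  (hU : open2 U) (hf : cont_on2 U f) (hp : U p) (hfix : f p = p)
  (hiso : isolated_fixed_set U f p)
  (hsink : ~ is_sink U f p) (hsource : ~ is_source U f p) :
  exists (F : list nat) (a : nat -> nat),
    F <> nil /\ NoDup F /\
    (forall k, In k F -> (1 <= k)%nat /\ (1 <= a k)%nat) /\
    forall n : nat, (1 <= n)%nat ->
      fp_index (fiter_dom U f n) (fiter f n) p
        (sigk 1 n - sum_Z (map (fun k => (Z.of_nat (a k) * sigk k n)%Z) F))%Z.
Proof. exact (Plane.index_iterates hU hf hp hiso hsink hsource). Qed.
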